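(* Let $\Gamma$ be a hyperbolic group with $\partial\Gamma=S^1$. Let $\rho_0\colon\Gamma\to\mathrm{Homeo}(S^1)$ be either the standard boundary action, or a lift of this action to a $k$-fold cover of $S^1$, for some integer $k\ge 1$. Then the connected component of $\rho_0$ in $\mathrm{Hom}(\Gamma,\mathrm{Homeo}(S^1))$ is equal to the set of actions $\rho\in\mathrm{Hom}(\Gamma,\mathrm{Homeo}(S^1))$ that are semi-conjugate to $\rho_0$ by a monotone, degree one semi-conjugacy.
   Context: The standard boundary action $\rho_\partial$ of a hyperbolic group $\Gamma$ is the action by homeomorphisms on its Gromov boundary $\partial\Gamma$ extending the action of $\Gamma$ on itself by left multiplication. A lift of $\rho_\partial$ to a $k$-fold cover is an action $\rho_0\colon\Gamma\to\mathrm{Homeo}(S^1)$ for which there is a degree $k$ covering map $\psi\colon S^1\to S^1$ with $\rho_\partial(\gamma)\circ\psi=\psi\circ\rho_0(\gamma)$ for all $\gamma\in\Gamma$. An action $\rho$ is semi-conjugate to $\rho_0$ by a monotone, degree one semi-conjugacy if there is a continuous surjective map $h\colon S^1\to S^1$ such that $h\circ\rho(\gamma)=\rho_0(\gamma)\circ h$ for all $\gamma\in\Gamma$, and such that $h$ lifts to a non-decreasing map $\tilde h\colon\mathbb{R}\to\mathbb{R}$ with $\tilde h(x+1)=\tilde h(x)+1$ (where $S^1=\mathbb{R}/\mathbb{Z}$). $\mathrm{Homeo}(S^1)$ carries the $C^0$ topology and $\mathrm{Hom}(\Gamma,\mathrm{Homeo}(S^1))$ the topology of pointwise convergence on $\Gamma$.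 *)

(* Defs.v *)
From HB Require Import structures.
From mathcomp Require Import all_boot all_order all_algebra.
From mathcomp Require Import all_classical all_reals all_analysis.
From mathcomp Require Import archimedean generic_quotient ring_quotient.
From mathcomp Require Import lra.

Set Implicit Arguments.
Unset Strict Implicit.
Unset Printing Implicit Defensive.

Import Order.TTheory GRing.Theory Num.Theory.
Import numFieldNormedType.Exports.

Local Open Scope classical_set_scope.
Local Open Scope ring_scope.

Record homeo (T U : topologicalType) := Homeo {
  homeo_fun :> T -> U;
  homeo_inv : U -> T;
  homeo_cts : continuous homeo_fun;
  homeo_inv_cts : continuous homeo_inv;
  homeoK : cancel homeo_fun homeo_inv;
  homeoVK : cancel homeo_inv homeo_fun }.

Section HomeoOps.
Variables T U V : topologicalType.

Lemma homeoP (f g : homeo T U) : f =1 g -> f = g.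
Proof.
case: f g => [f f' fc f'c fK f'K] [g g' gc g'c gK g'K] /= /funext fg.
subst g; have f'g' : f' = g'.
  by apply/funext => y; rewrite -[y in LHS]g'K fK.
by subst g'; congr Homeo; exact: Prop_irrelevance.
Qed.

Lemma id_cts (A : topologicalType) : continuous (@id A).
Proof. by move=> x; exact: cvg_id. Qed.

Definition homeo_id : homeo T T :=
  @Homeo T T id id (@id_cts T) (@id_cts T) (fun=> erefl) (fun=> erefl).

Definition homeo_sym (f : homeo T U) : homeo U T :=
  Homeo (@homeo_inv_cts _ _ f) (@homeo_cts _ _ f)
        (@homeoVK _ _ f) (@homeoK _ _ f).

Lemma continuous_comp_all (A B C : topologicalType) (g : B -> C) (f : A -> B) :
  continuous g -> continuous f -> continuous (g \o f).
Proof. by move=> gc fc x; apply: continuous_comp; [exact: fc|exact: gc]. Qed.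

Definition homeo_comp (g : homeo U V) (f : homeo T U) : homeo T V :=
  Homeo (continuous_comp_all (@homeo_cts _ _ g) (@homeo_cts _ _ f))
        (continuous_comp_all (@homeo_inv_cts _ _ f) (@homeo_inv_cts _ _ g))
        (can_comp (@homeoK _ _ g) (@homeoK _ _ f))
        (can_comp (@homeoVK _ _ f) (@homeoVK _ _ g)).

End HomeoOps.

(** Homeo(T): a group under composition, with the compact-open topology
    (for compact metrizable [T], the C^0 topology of uniform convergence). *)
Definition Homeo_group (T : topologicalType) : Type := homeo T T.

Section HomeoGroup.
Variable T : topologicalType.
Local Notation H := (Homeo_group T).

HB.instance Definition _ := gen_eqMixin H.
HB.instance Definition _ := gen_choiceMixin H.

Lemma Homeo_mulA : associative (@homeo_comp T T T : H -> H -> H).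
Proof. by move=> f g h; apply: homeoP. Qed.
Lemma Homeo_mul1 : left_id (@homeo_id T : H) (@homeo_comp T T T).
Proof. by move=> f; apply: homeoP. Qed.
Lemma Homeo_1mul : right_id (@homeo_id T : H) (@homeo_comp T T T).
Proof. by move=> f; apply: homeoP. Qed.
Lemma Homeo_mulV :
  left_inverse (@homeo_id T : H) (@homeo_sym T T) (@homeo_comp T T T).
Proof. by move=> f; apply: homeoP => x; exact: homeoK. Qed.
Lemma Homeo_Vmul :
  right_inverse (@homeo_id T : H) (@homeo_sym T T) (@homeo_comp T T T).
Proof. by move=> f; apply: homeoP => x; exact: homeoVK. Qed.

HB.instance Definition _ :=
  isGroup.Build H Homeo_mulA Homeo_mul1 Homeo_1mul Homeo_mulV Homeo_Vmul.

HB.instance Definition _ := Topological.copy H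
  (@initial_topology H {compact-open, T -> T} (@homeo_fun T T)).

End HomeoGroup.

Definition homeo_conj (T U : topologicalType) (phi : homeo T U)
    (f : Homeo_group T) : Homeo_group U :=
  homeo_comp phi (homeo_comp f (homeo_sym phi)).

Definition HomHomeo (G : groupType) (T : topologicalType) : Type :=
  {multiplicative G -> Homeo_group T}.

Section HomTopology.
Variables (G : groupType) (T : topologicalType).

Definition hom_fun (rho : HomHomeo G T) : G -> Homeo_group T :=
  (rho : {multiplicative G -> Homeo_group T}).

Lemma HomHomeoP (rho sigma : HomHomeo G T) :
  (forall g, hom_fun rho g = hom_fun sigma g) -> rho = sigma.
Proof.
case: rho sigma => [f [[fM]]] [f' [[fM']]] ff'.
have E : f = f' by apply/funext; exact: ff'.
by subst f'; rewrite (Prop_irrelevance fM fM').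
Qed.

HB.instance Definition _ := gen_eqMixin (HomHomeo G T).
HB.instance Definition _ := gen_choiceMixin (HomHomeo G T).
HB.instance Definition _ := Topological.copy (HomHomeo G T)
  (@initial_topology (HomHomeo G T) {ptws G -> Homeo_group T} hom_fun).
End HomTopology.
Coercion hom_fun : HomHomeo >-> Funclass.

Section Words.
Variable G : groupType.

Definition is_word (S : seq G) (w : seq G) : bool :=
  all (fun s => (s \in S) || (s^-1%g \in S)) w.

Record genset := GenSet {
  gens :> seq G;
  gensP : forall g, exists2 w, is_word gens w & g = (\prod_(s <- w) s)%g }.

Variable S : genset.

Definition spelled (g : G) (n : nat) : bool :=
  `[< exists w, [/\ is_word S w, g = (\prod_(s <- w) s)%g & size w = n] >].

Lemma spelled_ex g : exists n, spelled g n.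
Proof. by have [w Sw ->] := gensP S g; exists (size w); apply/asboolP; exists w. Qed.

Definition wlen (g : G) : nat := ex_minn (spelled_ex g).

Definition wdist (x y : G) : nat := wlen (x^-1 * y)%g.

Definition gprod (w x y : G) : rat :=
  ((wdist w x)%:R + (wdist w y)%:R - (wdist x y)%:R) / 2.

(** Gromov's four-point condition for the word metric; whether it holds does
    not depend on the finite generating set. *)
Definition hyperbolic : Prop := exists delta : rat, forall w x y z : G,
  Num.min (gprod w x y) (gprod w y z) - delta <= gprod w x z.

Lemma wlenP g :
  exists w, [/\ is_word S w, g = (\prod_(s <- w) s)%g & size w = wlen g].
Proof. by rewrite /wlen; case: ex_minnP => n /asboolP. Qed.

Lemma wlen_le w : is_word S w -> (wlen (\prod_(s <- w) s)%g <= size w)%N.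
Proof.
move=> Sw; rewrite /wlen; case: ex_minnP => n _; apply.
by apply/asboolP; exists w.
Qed.

Lemma wlenM g h : (wlen (g * h)%g <= wlen g + wlen h)%N.
Proof.
have [v [Sv gE <-]] := wlenP g; have [w [Sw hE <-]] := wlenP h.
rewrite -size_cat {1}gE {1}hE -big_cat; apply: wlen_le.
by rewrite /is_word all_cat; apply/andP.
Qed.

Lemma wlenV_le g : (wlen g^-1%g <= wlen g)%N.
Proof.
have [w [Sw gE <-]] := wlenP g.
have -> : (g^-1 = \prod_(s <- rev [seq s^-1%g | s <- w]) s)%g.
  rewrite gE; elim: w {Sw gE} => [|s w IH]; first by rewrite !big_nil invg1.
  by rewrite big_cons invgM IH map_cons rev_cons -cats1 big_cat big_seq1.
rewrite -[leqRHS](size_map (fun s : G => s^-1%g)) -size_rev; apply: wlen_le.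
rewrite /is_word all_rev all_map; apply: sub_all Sw => s /=.
by rewrite invgK orbC.
Qed.

Lemma wlenV g : wlen g^-1%g = wlen g.
Proof. by apply/eqP; rewrite eqn_leq wlenV_le -[leqLHS](congr1 wlen (invgK g)) wlenV_le. Qed.

Lemma gprod_translate g x y :
  gprod 1%g x y <= gprod 1%g (g * x)%g (g * y)%g + (wlen g)%:R.
Proof.
rewrite /gprod /wdist !invg1 !mul1g invgM !mulgA mulgVK.
have le z : ((wlen z)%:R : rat) <= (wlen (g * z)%g)%:R + (wlen g)%:R.
  rewrite -natrD ler_nat addnC -(wlenV g) -{1}(mulKg g z); exact: wlenM.
by have := le x; have := le y; lra.
Qed.

(** lim (x_i | y_j) = +oo as i, j -> +oo. *)
Definition gprod_to_infty (x y : nat -> G) : Prop :=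
  forall M : nat, exists N : nat, forall i j : nat, (N <= i)%N -> (N <= j)%N ->
    M%:R <= gprod 1%g (x i) (y j).

Definition converges_to_infty (x : nat -> G) : Prop := gprod_to_infty x x.

Definition boundary_class (x : nat -> G) : set (nat -> G) :=
  [set y | converges_to_infty y /\ gprod_to_infty x y].

Record boundary := Boundary {
  bseqs :> set (nat -> G);
  bseqsP : exists2 x, converges_to_infty x & bseqs = boundary_class x }.

Lemma boundaryP (p q : boundary) : bseqs p = bseqs q -> p = q.
Proof.
case: p q => [A hA] [B hB] /= AB; subst B; congr Boundary.
exact: Prop_irrelevance.
Qed.

(** [q] lies in [bnbhd p r] when some representatives satisfy
    liminf_(i, j) (x_i | y_j) >= r; as Gromov products of group elements are
    half-integers, this means (x_i | y_j) >= r for all large i, j. *)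
Definition bnbhd (p : boundary) (r : nat) : set boundary :=
  [set q | exists x y, [/\ bseqs p x, bseqs q y &
    exists N : nat, forall i j : nat, (N <= i)%N -> (N <= j)%N ->
      r%:R <= gprod 1%g (x i) (y j)]].

Lemma bnbhd_sub p r s : (r <= s)%N -> bnbhd p s `<=` bnbhd p r.
Proof.
move=> rs q [x [y [px qy [N h]]]]; exists x, y; split => //.
by exists N => i j Ni Nj; apply: le_trans (h i j Ni Nj); rewrite ler_nat.
Qed.

Definition bopen (A : set boundary) : Prop :=
  forall p, A p -> exists r, bnbhd p r `<=` A.

Lemma bopenT : bopen setT.
Proof. by move=> p _; exists 0%N. Qed.

Lemma bopenI : setI_closed bopen.
Proof.
move=> A B oA oB p [/oA[r rA] /oB[s sB]]; exists (maxn r s) => q hq; split.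
- by apply: rA; apply: bnbhd_sub hq; exact: leq_maxl.
- by apply: sB; apply: bnbhd_sub hq; exact: leq_maxr.
Qed.

Lemma bopen_bigU (I : Type) (f : I -> set boundary) :
  (forall i, bopen (f i)) -> bopen (\bigcup_i f i).
Proof. by move=> of_ p [i _ /of_[r rf]]; exists r => q /rf; exists i. Qed.

HB.instance Definition _ := gen_eqMixin boundary.
HB.instance Definition _ := gen_choiceMixin boundary.
HB.instance Definition _ :=
  isOpenTopological.Build boundary bopenT bopenI bopen_bigU.

Lemma boundary_openE : (@open boundary : set (set boundary)) = bopen.
Proof. by []. Qed.

Definition translate (g : G) (x : nat -> G) : nat -> G := fun n => (g * x n)%g.

Lemma translateK g : cancel (translate g) (translate g^-1%g).
Proof. by move=> x; apply/funext => n; rewrite /translate mulKg. Qed.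

Lemma translateVK g : cancel (translate g^-1%g) (translate g).
Proof. by move=> x; apply/funext => n; rewrite /translate mulVKg. Qed.

Lemma translate_to_infty g x y :
  gprod_to_infty x y -> gprod_to_infty (translate g x) (translate g y).
Proof.
move=> h M; have [N hN] := h (M + wlen g)%N; exists N => i j Ni Nj.
by have := gprod_translate g (x i) (y j); have := hN i j Ni Nj; rewrite natrD; lra.
Qed.

Lemma bact_subproof g (p : boundary) :
  exists2 x, converges_to_infty x & translate g @` p = boundary_class x.
Proof.
case: p => A [x xoo AE] /=; exists (translate g x).
  exact: translate_to_infty.
rewrite AE; apply/seteqP; split => y /=.
  by move=> [z [zoo xz] <-]; split; exact: translate_to_infty.
move=> [yoo xy]; exists (translate g^-1%g y); last exact: translateVK.
split; first exact: translate_to_infty.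
by rewrite -(translateK g x); exact: translate_to_infty.
Qed.

Definition bact (g : G) (p : boundary) : boundary := Boundary (bact_subproof g p).

Lemma bactM g h p : bact (g * h)%g p = bact g (bact h p).
Proof.
apply: boundaryP => /=; rewrite image_comp; congr (_ @` _).
by apply/funext => x; apply/funext => n; rewrite /translate /= mulgA.
Qed.

Lemma bact1 p : bact 1%g p = p.
Proof.
apply: boundaryP => /=; rewrite -[RHS]image_id; congr (_ @` _).
by apply/funext => x; apply/funext => n; rewrite /translate mul1g.
Qed.

Lemma bactK g : cancel (bact g) (bact g^-1%g).
Proof. by move=> p; rewrite -bactM mulVg bact1. Qed.

Lemma bactVK g : cancel (bact g^-1%g) (bact g).
Proof. by move=> p; rewrite -bactM mulgV bact1. Qed.

Lemma bact_continuous g : continuous (bact g).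
Proof.
apply/continuousP => A; rewrite !boundary_openE => oA p /= /oA[r rA]; exists (r + wlen g)%N.
move=> q [x [y [px qy [N h]]]]; apply: rA.
exists (translate g x), (translate g y); split; [by exists x|by exists y|].
exists N => i j Ni Nj.
by have := gprod_translate g (x i) (y j); have := h i j Ni Nj; rewrite natrD; lra.
Qed.

Definition bact_homeo (g : G) : Homeo_group boundary :=
  Homeo (@bact_continuous g) (@bact_continuous g^-1%g) (bactK g) (bactVK g).

Section Transport.
Variables (T : topologicalType) (phi : homeo boundary T).

Definition boundary_action_fun (g : G) : Homeo_group T :=
  homeo_conj phi (bact_homeo g).

Lemma boundary_action_morph :
  {morph boundary_action_fun : g h / (g * h)%g}.
Proof.
move=> g h; apply: homeoP => x /=.
by rewrite bactM homeoK.
Qed.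

HB.instance Definition _ :=
  isMultiplicative.Build _ _ boundary_action_fun boundary_action_morph.

(** The action on the boundary induced by left multiplication, read on [T]
    through an identification [phi] of the boundary with [T]. *)
Definition boundary_action : HomHomeo G T :=
  (boundary_action_fun : {multiplicative G -> Homeo_group T}).

End Transport.

End Words.

Section Circle.
Variable R : realType.

Definition circle_int : zmodClosed R :=
  GRing.ZmodClosed.clone R Num.int_num_subdef _.

Definition circle : Type := quotient_topology (Quotient.quot circle_int).

HB.instance Definition _ := Topological.on circle.

Definition circle_proj : R -> circle := \pi_circle%qT.

Lemma circle_projP (x y : R) :
  circle_proj x = circle_proj y <-> x - y \is a Num.int.
Proof.
have -> : (x - y \is a Num.int) = (x - y \in circle_int) by [].
by rewrite Quotient.idealrBE; split=> [xy|/eqP xy]; [apply/eqP|].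
Qed.

Lemma circle_proj_surj (p : circle) : exists x, circle_proj x = p.
Proof. by exists (repr p); exact: reprK. Qed.

Lemma circle_openE (A : set circle) : open A = open (circle_proj @^-1` A).
Proof. by []. Qed.

Definition is_lift_of (ht : R -> R) (h : circle -> circle) : Prop :=
  continuous ht /\ forall x, circle_proj (ht x) = h (circle_proj x).

Definition monotone_degree_one (h : circle -> circle) : Prop :=
  exists ht : R -> R, [/\ is_lift_of ht h,
    {homo ht : x y / x <= y} & forall x, ht (x + 1) = ht x + 1].

End Circle.

(** Every point of [Y] has an evenly covered open neighbourhood [U], [F] being
    the set of sheets above it and [s] the inverse of [psi] on the sheet [V]. *)
Definition covering_map (X Y : topologicalType) (psi : X -> Y) : Prop :=
  continuous psi /\
  forall y, exists U : set Y, [/\ open U, U y &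
    exists F : set (set X), [/\ trivIset F id,
      \bigcup_(V in F) V = psi @^-1` U &
      forall V, F V -> open V /\
        exists s : Y -> X, [/\ {within U, continuous s}, s @` U = V &
          forall z, U z -> psi (s z) = z]]].

(** The degree is the number of sheets; [psi] may reverse orientation. *)
Definition covering_map_of_degree (X Y : topologicalType) (k : nat)
    (psi : X -> Y) : Prop :=
  covering_map psi /\ forall y, (psi @^-1` [set y] #= `I_k)%card.

Definition is_lift_to_cover (G : groupType) (T : topologicalType) (k : nat)
    (rho rho0 : HomHomeo G T) : Prop :=
  exists2 psi : T -> T, covering_map_of_degree k psi &
    forall g x, rho g (psi x) = psi (rho0 g x).

Definition semi_conjugate (G : groupType) (R : realType)
    (rho rho0 : HomHomeo G (circle R)) : Prop :=
  exists h : circle R -> circle R,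
    [/\ continuous h, range h = setT, monotone_degree_one h &
      forall g x, h (rho g x) = rho0 g (h x)].

(* Main.v *)
Require Import Defs.
From HB Require Import structures.
From mathcomp Require Import all_boot all_order all_algebra.
From mathcomp Require Import all_classical all_reals all_analysis.
From mathcomp Require Import finmap archimedean lra ring zify.

(** An action semi-conjugate to rho0 is deformed to rho0 by conjugating it with
    the straight-line homotopy from the identity to the semi-conjugacy. So the
    actions semi-conjugate to rho0 form a connected set, and it remains to see
    that they form an open and closed one.

    Two properties of the boundary action, both read off from Gromov products,
    are used: it is properly discontinuous on triples, and every point is
    conical (arbitrarily small balls around it are expanded to a definite size
    by elements collapsing their complement). Their local consequences pass to
    covers.

    Openness reduces, by the same homotopy, to actions rho close to rho0. Write
    a point x as a code: a sequence of elements of a fixed finite set, each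
    expanding a small ball around the current point of the orbit. Along its code
    x is a pseudo-orbit of rho0, shadowed by the orbit of a unique point h x.
    Proper discontinuity on triples makes any two codes of x fellow-travel, so
    h does not depend on the code and is equivariant; expansivity then makes h
    continuous and monotone.

    For closedness, the lifts of the semi-conjugacies of a convergent family
    have a monotone limit T, and the graph of T with its jumps filled in is
    invariant. Conical expansion blows a jump up to one covering a dense subset
    of the boundary; there are finitely many such large jumps, and their
    endpoints give a finite orbit on the boundary. There is none: two points of
    such an orbit could be brought together, and a global fixed point b
    contradicts proper discontinuity on triples, by a ping-pong argument with
    elements that fix b. *)

Set Implicit Arguments.
Unset Strict Implicit.
Unset Printing Implicit Defensive.

Import Order.TTheory GRing.Theory Num.Theory.
Import numFieldNormedType.Exports.

Local Open Scope classical_set_scope.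
Local Open Scope ring_scope.

(** * The metric of the circle *)

(** The arc-length metric of the circle is related to the boundary only topologically, so no element
    is known to expand by a factor. Expansion is therefore stated between two scales: points at
    distance at least [s] from [x] go to distance at least [c] from its image. Such steps compose
    once [c] exceeds [s], but they do not by themselves make inverse branches contract. The
    contraction comes from proper discontinuity on triples: a pair of points that stays close for a
    long time would produce as many distinct group elements inside a fixed finite set.

    A lift to a cover of degree at least 2 is not conical, since distinct points of a fibre are
    never brought together. It only inherits the weaker [expanding] and [proper_expansion], which
    suffice for openness. The closedness argument needs the collapse itself and so measures jumps
    through [psi].

    Elements of the group may reverse orientation. Arguments that would use a cyclic order are
    replaced by metric ones, or by the intermediate value theorem along either direction of an
    arc. *)

Section IntegerDistance.
Variable R : realType.
Implicit Types x y : R.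

Definition int_dist x : R :=
  Num.min (x - (Num.floor x)%:~R) (1 - (x - (Num.floor x)%:~R)).

Lemma int_dist_ex x : exists n : int, int_dist x = `|x - n%:~R|.
Proof.
have /andP[lo hi] := floor_itv x; rewrite intrD in hi.
rewrite /int_dist; case: leP => h.
  by exists (Num.floor x); rewrite ger0_norm //; lra.
by exists (Num.floor x + 1); rewrite intrD ler0_norm; lra.
Qed.

Lemma int_dist_le x (n : int) : int_dist x <= `|x - n%:~R|.
Proof.
have /andP[lo hi] := floor_itv x; rewrite intrD in hi.
rewrite /int_dist ge_min; have [nx|nx] := leP n (Num.floor x).
  apply/orP; left; have : n%:~R <= (Num.floor x)%:~R :> R by rewrite ler_int.
  by move=> h; rewrite ger0_norm; lra.
apply/orP; right.
have : (Num.floor x + 1)%:~R <= n%:~R :> R by rewrite ler_int lezD1.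
by rewrite intrD => h; rewrite ler0_norm; lra.
Qed.

Lemma int_dist_le_half x : int_dist x <= 1 / 2.
Proof. by rewrite /int_dist ge_min; case: leP => //= h; lra. Qed.

Lemma int_dist_ge0 x : 0 <= int_dist x.
Proof. by have [n ->] := int_dist_ex x. Qed.

Lemma int_dist_le_norm x : int_dist x <= `|x|.
Proof. by have := int_dist_le x 0; rewrite subr0. Qed.

Lemma int_distN x : int_dist (- x) = int_dist x.
Proof.
suff le y : int_dist (- y) <= int_dist y.
  by apply/le_anti; rewrite le -{1}(opprK x) le.
have [n ->] := int_dist_ex y; rewrite -normrN opprB.
by have := int_dist_le (- y) (- n); rewrite intrN opprK addrC.
Qed.

Lemma int_distD x y : int_dist (x + y) <= int_dist x + int_dist y.
Proof.
have [n ->] := int_dist_ex x; have [m ->] := int_dist_ex y.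
apply: le_trans (int_dist_le _ (n + m)) _.
by rewrite intrD opprD addrACA ler_normD.
Qed.

Lemma int_distDint x (n : int) : int_dist (x + n%:~R) = int_dist x.
Proof.
suff le y (m : int) : int_dist (y + m%:~R) <= int_dist y.
  apply/le_anti; rewrite le /=.
  by have := le (x + n%:~R) (- n); rewrite intrN addrK.
have [k ->] := int_dist_ex y.
apply: le_trans (int_dist_le _ (k + m)) _.
by rewrite le_eqVlt intrD (_ : _ - _ = y - k%:~R) ?eqxx //; ring.
Qed.

Lemma int_dist_small x : `|x| <= 1 / 2 -> int_dist x = `|x|.
Proof.
move=> hx; apply/le_anti; rewrite int_dist_le_norm /=.
have [n ->] := int_dist_ex x; have [->|n0] := eqVneq n 0; first by rewrite subr0.
have n1 : 1 <= `|n%:~R : R| by rewrite -intr_norm ler1z norm_intr_ge1 // intr_int.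
have := ler_normB (n%:~R : R) (n%:~R - x); rewrite (_ : n%:~R - (n%:~R - x) = x); last by ring.
have := ler_normD (n%:~R - x) x; rewrite subrK distrC; lra.
Qed.

End IntegerDistance.

Lemma positive_lower_bound (R : realFieldType) (I : eqType) (r : I -> R) (l : seq I) :
  (forall i, i \in l -> 0 < r i) -> exists2 e, 0 < e & forall i, i \in l -> e <= r i.
Proof.
elim: l => [|i l ih] r0; first by exists 1.
have [j jl|e e0 he] := ih; first by apply: r0; rewrite inE jl orbT.
exists (Num.min e (r i)); first by rewrite lt_min e0 r0 // mem_head.
move=> j; rewrite inE ge_min => /predU1P[->|/he ->//]; by rewrite lexx orbT.
Qed.

Section CircleMetric.
Variable R : realType.
Local Notation X := (circle R).
Local Notation pi := (@circle_proj R).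
Implicit Types (p q r : X) (x y : R).

Definition cdist p q : R := int_dist (repr p - repr q).

Lemma circle_proj_int x (n : int) : pi (x + n%:~R) = pi x.
Proof. by apply/circle_projP; rewrite addrC addKr intr_int. Qed.

Lemma circle_proj_eq x y : pi x = pi y -> exists n : int, x = y + n%:~R.
Proof.
by move=> /circle_projP /intrP[n e]; exists n; rewrite -e addrC subrK.
Qed.

Lemma cdistE x y : cdist (pi x) (pi y) = int_dist (x - y).
Proof.
have rep z : exists n : int, repr (pi z) = z + n%:~R.
  by apply: circle_proj_eq; rewrite /circle_proj reprK.
have [n xn] := rep x; have [m yn] := rep y; rewrite /cdist xn yn.
by rewrite -(int_distDint (x - y) (n - m)) intrB; congr int_dist; ring.
Qed.

Lemma cdist_ge0 p q : 0 <= cdist p q. Proof. exact: int_dist_ge0. Qed.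

Lemma cdist_le_half p q : cdist p q <= 1 / 2. Proof. exact: int_dist_le_half. Qed.

Lemma cdistC p q : cdist p q = cdist q p.
Proof. by rewrite /cdist -int_distN opprB. Qed.

Lemma cdist_tri q p r : cdist p r <= cdist p q + cdist q r.
Proof. by rewrite /cdist -(subrKA (repr q)) int_distD. Qed.

Lemma cdistxx p : cdist p p = 0.
Proof.
apply/le_anti; rewrite cdist_ge0 andbT /cdist subrr.
by rewrite (le_trans (int_dist_le_norm 0)) ?normr0.
Qed.

Lemma cdist_proj_le x y : cdist (pi x) (pi y) <= `|x - y|.
Proof. by rewrite cdistE int_dist_le_norm. Qed.

Lemma cdist_proj x y : `|x - y| <= 1 / 2 -> cdist (pi x) (pi y) = `|x - y|.
Proof. by rewrite cdistE; exact: int_dist_small. Qed.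

Lemma cdist_lift x q : exists2 y, pi y = q & `|x - y| = cdist (pi x) q.
Proof.
have [z <-] := circle_proj_surj q; rewrite cdistE.
have [n ->] := int_dist_ex (x - z); exists (z + n%:~R); first exact: circle_proj_int.
by rewrite opprD addrA.
Qed.

Lemma cdist_eq0 p q : cdist p q = 0 -> p = q.
Proof.
have [x <-] := circle_proj_surj p; have [y <- <-] := cdist_lift x q.
by move=> /normr0P; rewrite subr_eq0 => /eqP ->.
Qed.

Lemma cdist_gt0 p q : p <> q -> 0 < cdist p q.
Proof.
move=> pq; rewrite lt_neqAle cdist_ge0 andbT eq_sym.
by apply/eqP => /cdist_eq0.
Qed.

Lemma cdist_attains p s : 0 <= s <= 1 / 2 -> exists q, cdist q p = s.
Proof.
move=> /andP[s0 s1]; have [x <-] := circle_proj_surj p.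
by exists (pi (x + s)); rewrite cdist_proj addrAC subrr add0r ger0_norm.
Qed.

Lemma circle_open_cdistP (A : set X) :
  open A <-> forall p, A p -> exists2 e, 0 < e & forall q, cdist p q < e -> A q.
Proof.
rewrite circle_openE openE; split=> oA.
  move=> p Ap; have [x xp] := circle_proj_surj p.
  have /oA/nbhs_ballP[e /= e0 he] : (pi @^-1` A) x by rewrite /= xp.
  exists e => // q; rewrite -xp; have [y <- <-] := cdist_lift x q.
  by move=> xy; apply: he; rewrite /ball /=.
move=> x /oA[e e0 he]; apply/nbhs_ballP; exists e => //= y xy.
by apply: he; apply: le_lt_trans (cdist_proj_le _ _) _.
Qed.

Lemma circle_nbhsP p (A : set X) :
  nbhs p A <-> exists2 e, 0 < e & forall q, cdist p q < e -> A q.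
Proof.
rewrite nbhsE; split=> [[B [oB Bp] BA]|[e e0 he]].
  have [e e0 he] := (circle_open_cdistP B).1 oB p Bp.
  by exists e => // q /he /BA.
exists [set q | cdist p q < e]; last by [].
split; last by rewrite /= cdistxx.
apply/circle_open_cdistP => q /= pq; exists (e - cdist p q); first by rewrite subr_gt0.
by move=> r qr; apply: le_lt_trans (cdist_tri q _ _) _; lra.
Qed.

Lemma circle_proj_continuous : continuous pi.
Proof.
move=> x A /circle_nbhsP[e e0 he]; apply/nbhs_ballP; exists e => //= y xy.
by apply: he; apply: le_lt_trans (cdist_proj_le _ _) _.
Qed.

Lemma circle_continuousP (f : X -> X) : continuous f <->
  forall p e, 0 < e ->
    exists2 d, 0 < d & forall q, cdist p q < d -> cdist (f p) (f q) < e.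
Proof.
split=> [fc p e e0|fc p A /circle_nbhsP[e e0 he]].
  have /fc : nbhs (f p) [set q | cdist (f p) q < e].
    by apply/circle_nbhsP; exists e.
  by move=> /circle_nbhsP.
have [d d0 hd] := fc p e e0.
by apply/circle_nbhsP; exists d => // q /hd; exact: he.
Qed.

Lemma circle_finite_cover (r : X -> R) : (forall p, 0 < r p) ->
  exists ps : seq X, forall q, exists2 p, p \in ps & cdist p q < r p.
Proof.
move=> r0; have := @segment_compact R 0 1; rewrite compact_cover.
case/(_ R setT (fun x => ball x (r (pi x)))).
- by move=> x _; exact: ball_open.
- by move=> x _; exists x => //; exact: ballxx.
move=> D _ cov; exists [seq pi x | x <- enum_fset D] => q.
have [y yq] := circle_proj_surj q.
have /cov[x /= xD xy] : `[0, 1]%classic (y - (Num.floor y)%:~R).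
  have /andP[lo hi] := floor_itv y; rewrite intrD in hi.
  by rewrite /= in_itv /=; apply/andP; split; lra.
exists (pi x); first by rewrite map_f.
rewrite -yq -(subrK (Num.floor y)%:~R y) circle_proj_int.
exact: le_lt_trans (cdist_proj_le _ _) _.
Qed.

(** Lebesgue-number form of compactness. One [e] serves both as radius of the neighbourhood and as
    parameter of [P], at no cost since [P] is monotone in it. *)
Lemma circle_uniformly (P : R -> X -> Prop) :
  (forall p d e, d <= e -> P e p -> P d p) ->
  (forall p, exists2 e, 0 < e & forall q, cdist p q < e -> P e q) ->
  exists2 e, 0 < e & forall p, P e p.
Proof.
move=> mono loc.
have [r rP] : {r : X -> R & forall p, 0 < r p /\ forall q, cdist p q < r p -> P (r p) q}.
  by apply: (@choice _ _ (fun p e => 0 < e /\ forall q, cdist p q < e -> P e q)) => p;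
     have [e e0 he] := loc p; exists e.
have [ps cov] := circle_finite_cover (fun p => (rP p).1).
have [e e0 he] := positive_lower_bound (fun p (_ : p \in ps) => (rP p).1).
exists e => // q; have [p pps pq] := cov q.
exact: mono (he p pps) ((rP p).2 _ pq).
Qed.

Lemma circle_uniformly_nat (P : nat -> X -> Prop) :
  (forall p m n, (m <= n)%N -> P m p -> P n p) ->
  (forall p, exists n, exists2 e, 0 < e & forall q, cdist p q < e -> P n q) ->
  exists n, forall p, P n p.
Proof.
move=> mono loc; have [n nP] := choice loc.
have [r rP] : {r : X -> R & forall p, 0 < r p /\ forall q, cdist p q < r p -> P (n p) q}.
  by apply: (@choice _ _ (fun p e => 0 < e /\ forall q, cdist p q < e -> P (n p) q)) => p;
     have [e e0 he] := nP p; exists e.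
have [ps cov] := circle_finite_cover (fun p => (rP p).1).
exists (\max_(p <- ps) n p)%N => q; have [p pps pq] := cov q.
by apply: mono ((rP p).2 _ pq); rewrite (big_rem p) //= leq_maxl.
Qed.

(** Cantor intersection: the complements are open and increasing, so they cover the circle only if
    one of them does. *)
Lemma circle_nested (Y : nat -> set X) :
  (forall n q, ~ Y n q -> exists2 e, 0 < e & forall q', cdist q q' < e -> ~ Y n q') ->
  (forall n, Y n.+1 `<=` Y n) -> (forall n, Y n !=set0) ->
  exists p, forall n, Y n p.
Proof.
move=> clo dec ne; apply: contrapT => none.
have sub m n : (m <= n)%N -> Y n `<=` Y m.
  by move=> /subnK <-; elim: (n - m)%N => // k ih q /dec; exact: ih.
have [n hn] : exists n, forall q, ~ Y n q.
  apply: circle_uniformly_nat => [q m n mn nY /(sub _ _ mn)//|q].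
  have [n nY] : exists n, ~ Y n q by apply/existsNP => h; apply: none; exists q.
  by exists n; exact: clo.
by have [q /hn] := ne n.
Qed.

Lemma circle_uniform_continuity (f : X -> X) : continuous f ->
  forall e, 0 < e ->
    exists2 d, 0 < d & forall p q, cdist p q < d -> cdist (f p) (f q) < e.
Proof.
move=> /circle_continuousP fc e e0.
apply: (@circle_uniformly (fun d p => forall q, cdist p q < d -> cdist (f p) (f q) < e)).
  by move=> p d d' dd' h q pq; apply: h; apply: lt_le_trans dd'.
move=> p; have e2 : 0 < e / 2 by lra.
have [d d0 hd] := fc p _ e2; exists (d / 2) => [|q pq q' qq']; first by lra.
have tri := cdist_tri q p q'.
have hq : cdist (f p) (f q) < e / 2 by apply: hd; lra.
have hq' : cdist (f p) (f q') < e / 2 by apply: hd; lra.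
by apply: le_lt_trans (cdist_tri (f p) _ _) _; rewrite (cdistC (f q)); lra.
Qed.

Lemma finitely_many_uniform (I : eqType) (f : I -> X -> X) (l : seq I) :
  (forall i, i \in l -> continuous (f i)) -> forall e, 0 < e ->
  exists2 d, 0 < d &
    forall i p q, i \in l -> cdist p q < d -> cdist (f i p) (f i q) < e.
Proof.
move=> fc e e0; elim: l fc => [|i l ih] fc; first by exists 1.
have [|d d0 hd] := ih; first by move=> j jl; apply: fc; rewrite inE jl orbT.
have [d' d'0 hd'] := circle_uniform_continuity (fc i (mem_head _ _)) e0.
exists (Num.min d d'); first by rewrite lt_min d0.
move=> j p q; rewrite inE lt_min => /predU1P[->|jl] /andP[pq pq'].
  exact: hd'.
exact: hd.
Qed.

Lemma circle_intermediate (f : X -> X) (q : X) (a b s : R) : continuous f -> a <= b ->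
  cdist (f (pi a)) q <= s <= cdist (f (pi b)) q \/
  cdist (f (pi b)) q <= s <= cdist (f (pi a)) q ->
  exists2 t, a <= t <= b & cdist (f (pi t)) q = s.
Proof.
move=> fc ab hs; pose u (t : R) := cdist (f (pi t)) q.
have uc : continuous u.
  move=> t; apply/cvgrPdist_lt => e e0.
  have [d d0 hd] := circle_uniform_continuity fc e0.
  apply/nbhs_ballP; exists d => //= t' tt'.
  have : cdist (f (pi t)) (f (pi t')) < e.
    by apply: hd; apply: le_lt_trans (cdist_proj_le _ _) _.
  move=> h; rewrite ltr_norml /u.
  have := cdist_tri (f (pi t')) (f (pi t)) q; have := cdist_tri (f (pi t)) (f (pi t')) q.
  by rewrite (cdistC (f (pi t')) (f (pi t))); lra.
have [||t] := @IVT R u a b s ab; last by rewrite in_itv; exists t.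
  exact: continuous_subspaceT.
by rewrite ge_min le_max /u; case: hs => /andP[-> ->]; rewrite ?orbT.
Qed.

End CircleMetric.

(** * The topology of Hom(G, Homeo(S^1)) *)

Section HomTopologyMetric.
Variables (R : realType) (G : groupType).
Local Notation X := (circle R).
Implicit Types (rho : HomHomeo G X) (l : seq G).

Definition hom_close l (e : R) rho rho' : Prop :=
  forall g x, g \in l -> cdist (rho g x) (rho' g x) < e.

Lemma circle_hausdorff : hausdorff_space X.
Proof.
move=> p q clus; apply: contrapT => /cdist_gt0 pq.
have ball_nbhs p' : nbhs p' [set r | cdist p' r < cdist p q / 2].
  by apply/circle_nbhsP; exists (cdist p q / 2) => //; lra.
have [r [/= pr qr]] := clus _ _ (ball_nbhs p) (ball_nbhs q).
by have := cdist_tri r p q; rewrite (cdistC r q); lra.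
Qed.

Lemma circle_compact : compact [set: X].
Proof.
have -> : [set: X] = (@circle_proj R) @` `[0, 1]%classic.
  apply/seteqP; split => // q _; have [y <-] := circle_proj_surj q.
  exists (y - (Num.floor y)%:~R); last by rewrite -intrN circle_proj_int.
  have /andP[lo hi] := floor_itv y; rewrite intrD in hi.
  by rewrite /= in_itv /=; apply/andP; split; lra.
apply: continuous_compact; last exact: segment_compact.
exact/continuous_subspaceT/circle_proj_continuous.
Qed.

Lemma initial_cvg (S : choiceType) (T : topologicalType) (f : S -> T)
    (F : set_system S) (s : S) : Filter F ->
  (forall A, nbhs (f s) A -> F (f @^-1` A)) -> F --> (s : initial_topology f).
Proof.
move=> FF h A [_ [[B oB <-] Bfs] sub]; apply: filterS sub _; apply: h.
exact: open_nbhs_nbhs.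
Qed.

Let homeo_map : Homeo_group X -> {compact-open, X -> X} := @homeo_fun X X.

(** On a compact metric space the compact-open topology is that of uniform convergence. A uniform
    ball contains a finite intersection of conditions sending [K p] into [O p], where the closed
    balls [K p] cover the circle and are so small that [f] maps each within [e / 4] of [f p]. *)
Lemma homeo_nbhsP (f : Homeo_group X) (A : set (Homeo_group X)) :
  nbhs f A <-> exists2 e, 0 < e &
    forall f' : Homeo_group X, (forall x, cdist (f x) (f' x) < e) -> A f'.
Proof.
split.
- pose F : set_system (Homeo_group X) := filter_from [set e : R | 0 < e]
    (fun e => [set f' : Homeo_group X | forall x, cdist (f x) (f' x) < e]).
  have FF : Filter F.
    apply: filter_from_filter; first by exists 1 => /=.
    move=> d e d0 e0; exists (Num.min d e); first by rewrite /= lt_min d0.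
    by move=> f' h; split=> x; have := h x; rewrite lt_min => /andP[].
  suff cvF : F --> (f : initial_topology homeo_map).
    by move=> /cvF[e /= e0 he]; exists e.
  apply: initial_cvg => B fB.
  have : homeo_map @ F -->
         homeo_map f; last by apply.
  apply/compact_open_cvgP => K O cK oO KO.
  have clK : closed K := compact_closed circle_hausdorff cK.
  have [e e0 he] : exists2 e, 0 < e &
      forall p, K p -> forall y, cdist (f p) y < e -> O y.
    apply: (@circle_uniformly R (fun e p => K p -> forall y, cdist (f p) y < e -> O y)).
      by move=> p d e de h Kp y py; apply: h => //; apply: lt_le_trans de.
    move=> p; have [Kp|nKp] := pselect (K p); last first.
      have [e e0 he] := (circle_open_cdistP _).1 (closed_openC clK) p nKp.
      by exists e => // q /he.
    have [e e0 he] := (circle_open_cdistP _).1 oO (f p) (KO _ (ex_intro2 _ _ p Kp erefl)).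
    have e2 : 0 < e / 2 by lra.
    have [d d0 hd] := (circle_continuousP _).1 (@homeo_cts _ _ f) p _ e2.
    exists (Num.min d (e / 2)); first by rewrite lt_min d0.
    move=> q; rewrite lt_min => /andP[/hd pq _] Kq y; rewrite lt_min => /andP[_ qy].
    by apply: he; apply: le_lt_trans (cdist_tri (f q) _ _) _; lra.
  by exists e => //= f' hf' _ [p Kp <-]; exact: he (hf' p).
- case=> e e0 he; have e2 : 0 < e / 4 by lra.
  have fc := @homeo_cts _ _ f.
  have [r r0 hr] := circle_uniform_continuity fc e2.
  have r2 : 0 < r / 2 by lra.
  have [ps cov] := circle_finite_cover (fun _ : X => r2).
  pose K p : set X := [set q | cdist p q <= r / 2].
  pose O p : set X := [set q | cdist (f p) q < e / 2].
  pose U p : set (Homeo_group X) := homeo_map @^-1` [set g | g @` K p `<=` O p].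
  have UP p : nbhs f (U p).
    apply: (@initial_continuous _ _ homeo_map f).
    apply: open_nbhs_nbhs; split; first apply: compact_open_open.
    - apply: (subclosed_compact _ circle_compact) => // .
      rewrite -openC; apply/circle_open_cdistP => q /= /negP; rewrite -ltNge => pq.
      exists (cdist p q - r / 2); first by lra.
      move=> q' qq'; apply/negP; rewrite -ltNge.
      by have := cdist_tri q' p q; rewrite (cdistC q' q); lra.
    - apply/circle_open_cdistP => q; rewrite /O /= => pq.
      exists (e / 2 - cdist (f p) q); first by lra.
      by move=> q' qq'; apply: le_lt_trans (cdist_tri q _ _) _; lra.
    - move=> y [q Kq <-]; rewrite /K /= in Kq.
      by have /hr : cdist p q < r by [lra]; rewrite /O /homeo_map /=; lra.
  have : nbhs f [set f' | forall p, p \in ps -> U p f'].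
    elim: (ps) => [|p ps' ih]; first by apply: filterS filterT.
    apply: filterS (filterI (UP p) ih) => f' [h1 h2] p'.
    by rewrite inE => /predU1P[->|/h2].
  apply: filterS => f' h; apply: he => x; have [p pps px] := cov x.
  have h1 : cdist (f p) (f' x) < e / 2 by apply: (h p pps); exists x => //; exact: ltW.
  have h2 : cdist (f p) (f x) < e / 4 by apply: hr; lra.
  by have := cdist_tri (f p) (f x) (f' x); rewrite (cdistC (f x) (f p)); lra.
Qed.

Lemma hom_nbhsP rho (A : set (HomHomeo G X)) :
  nbhs rho A <-> exists l, exists2 e, 0 < e &
    forall rho', hom_close l e rho rho' -> A rho'.
Proof.
pose H := {ptws G -> Homeo_group X}.
split.
- pose F : set_system (HomHomeo G X) := filter_from [set le : seq G * R | 0 < le.2]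
    (fun le => [set rho' | hom_close le.1 le.2 rho rho']).
  have FF : Filter F.
    apply: filter_from_filter; first by exists ([::], 1) => /=.
    move=> [l d] [l' e] /= d0 e0; exists (l ++ l', Num.min d e).
      by rewrite /= lt_min d0.
    move=> rho' /= h; split=> g x /= gl.
      by have := h g x; rewrite mem_cat gl lt_min => /(_ isT) /andP[].
    by have := h g x; rewrite mem_cat gl orbT lt_min => /(_ isT) /andP[].
  suff cvF : F --> (rho : initial_topology (@hom_fun G X : _ -> H)).
    by move=> /cvF[[l e] /= e0 he]; exists l, e.
  apply: initial_cvg => B rhoB.
  have : (@hom_fun G X : _ -> H) @ F --> (hom_fun rho : H); last by apply.
  apply/cvg_sup => g; apply: initial_cvg => C /homeo_nbhsP[e e0 he].
  exists ([:: g], e) => //= rho' h; apply: he => x; apply: h.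
  exact: mem_head.
- case=> l [e e0 he].
  pose U g : set (HomHomeo G X) :=
    [set rho' : HomHomeo G X | forall x, cdist (rho g x) (rho' g x) < e].
  have UP g : nbhs rho (U g).
    pose V : set (G -> Homeo_group X) := [set f | forall x, cdist (rho g x) (f g x) < e].
    apply: (@initial_continuous _ _ (@hom_fun G X : _ -> H) rho V).
    have /cvg_sup/(_ g) cv : nbhs (hom_fun rho : H) --> (hom_fun rho : H) by [].
    apply: (cv V).
    apply: (@initial_continuous _ _ (fun f : G -> Homeo_group X => f g) (hom_fun rho)
      [set f : Homeo_group X | forall x, cdist (rho g x) (f x) < e]).
    by apply/homeo_nbhsP; exists e.
  have : nbhs rho [set rho' | forall g, g \in l -> U g rho'].
    elim: (l) => [|g l' ih]; first by apply: filterS filterT.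
    apply: filterS (filterI (UP g) ih) => rho' [h1 h2] g'.
    by rewrite inE => /predU1P[->|/h2].
  by apply: filterS => rho' h; apply: he => g x gl; exact: h.
Qed.

End HomTopologyMetric.

(** * Gromov products and the boundary action *)

Section GromovProduct.
Variables (G : groupType) (S : genset G).
Local Notation gp := (gprod S).
Implicit Types (w x y z g : G) (u v : nat -> G) (r : rat).

Lemma wdistC x y : wdist S x y = wdist S y x.
Proof. by rewrite /wdist -wlenV invgM invgK. Qed.

Lemma gprodC w x y : gp w x y = gp w y x.
Proof. by rewrite /gprod (wdistC x y); congr ((_ - _) / _); rewrite addrC. Qed.

Lemma gprod_mul g x y : gp 1%g (g * x)%g (g * y)%g = gp g^-1%g x y.
Proof. by rewrite /gprod /wdist !invg1 !mul1g invgK invgM !mulgA mulgVK. Qed.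

Lemma gprod_base w x : gp w 1%g x = (wlen S w)%:R - gp 1%g w x.
Proof.
have e : wdist S w 1%g = wdist S 1%g w by exact: wdistC.
by rewrite /gprod e [wdist S 1%g w]/wdist invg1 mul1g; lra.
Qed.

(** With [gprod_le], an eventual bound that stands in for the Gromov product of two boundary points,
    whose value depends on the representatives up to a multiple of delta. *)
Definition gprod_ge u v r : Prop :=
  exists N, forall i j, (N <= i)%N -> (N <= j)%N -> r <= gp 1%g (u i) (v j).

Definition gprod_le u v r : Prop :=
  exists N, forall i j, (N <= i)%N -> (N <= j)%N -> gp 1%g (u i) (v j) <= r.

Lemma gprod_geC u v r : gprod_ge u v r -> gprod_ge v u r.
Proof. by case=> N h; exists N => i j Ni Nj; rewrite gprodC; exact: h. Qed.

Lemma gprod_ge_weak u v r r' : r' <= r -> gprod_ge u v r -> gprod_ge u v r'.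
Proof. by move=> r'r [N h]; exists N => i j Ni Nj; apply: le_trans r'r (h _ _ Ni Nj). Qed.

Lemma rat_nat_bound r : exists n : nat, r <= n%:R.
Proof. by exists (Num.trunc r).+1; exact/ltW/truncnS_gt. Qed.

Lemma gprod_to_infty_ge u v r : gprod_to_infty S u v -> gprod_ge u v r.
Proof.
have [n rn] := rat_nat_bound r; move=> /(_ n)[N h].
by exists N => i j Ni Nj; apply: le_trans rn (h _ _ Ni Nj).
Qed.

Lemma wlen_ball_finite n : exists l : seq G, forall g : G, (wlen S g <= n)%N -> g \in l.
Proof.
pose T := (S : seq G) ++ [seq s^-1%g | s <- (S : seq G)].
elim: n => [|n [l hl]].
  exists [:: 1%g] => g; rewrite leqn0 => /eqP g0.
  have [w [_ gE]] := wlenP S g; rewrite g0 => /size0nil w0.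
  by rewrite gE w0 big_nil mem_head.
exists (1%g :: [seq (s * h)%g | s <- T, h <- l]) => g gn; rewrite inE.
have [[|s w] [Sw gE wg]] := wlenP S g; first by rewrite gE big_nil eqxx.
move: Sw => /andP[Ss Sw]; apply/orP; right; rewrite gE big_cons.
apply: allpairs_f; last first.
  by apply: hl; apply: leq_trans (wlen_le Sw) _; rewrite -ltnS (leq_trans _ gn) // -wg.
rewrite mem_cat; case/orP: Ss => [->//|Ss]; apply/orP; right.
by apply/mapP; exists s^-1%g => //; rewrite invgK.
Qed.

Lemma geodesic_prefix g (L : nat) : (L <= wlen S g)%N ->
  exists2 w, wlen S w = L & (wlen S (w^-1 * g)%g <= wlen S g - L)%N.
Proof.
move=> Lg; have [s [Ss gE sg]] := wlenP S g.
move: Ss; rewrite -{1}(cat_take_drop L s) /is_word all_cat => /andP[S1 S2].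
pose w := (\prod_(t <- take L s) t)%g.
have wg : (w^-1 * g)%g = (\prod_(t <- drop L s) t)%g.
  by rewrite gE -{1}(cat_take_drop L s) big_cat /= mulKg.
have d : (wlen S (w^-1 * g)%g <= wlen S g - L)%N.
  by rewrite wg -sg -size_drop; exact: wlen_le.
exists w => //; apply/eqP; rewrite eqn_leq.
have -> /= : (wlen S w <= L)%N.
  apply: leq_trans (wlen_le S1) _; rewrite size_take.
  by case: ltnP => //; rewrite sg => /leq_trans; apply.
by have := wlenM S w (w^-1 * g)%g; rewrite mulVKg; lia.
Qed.

Section Hyperbolic.
Variable delta : rat.
Hypothesis delta_ge0 : 0 <= delta.
Hypothesis four_point : forall w x y z r,
  r <= gp w x y -> r <= gp w y z -> r - delta <= gp w x z.

Lemma gprod_ge_trans u v u' r :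
  gprod_ge u v r -> gprod_ge v u' r -> gprod_ge u u' (r - delta).
Proof.
move=> [N hN] [M hM]; exists (maxn N M) => i j.
rewrite !geq_max => /andP[Ni Mi] /andP[Nj Mj].
exact: four_point (hN i i Ni Ni) (hM i j Mi Mj).
Qed.

Lemma boundary_rep_ex (p : boundary S) : exists u, bseqs p u.
Proof. by have [u uoo ->] := bseqsP p; exists u. Qed.

Lemma boundary_rep_ge (p : boundary S) u v r : bseqs p u -> bseqs p v -> gprod_ge u v r.
Proof.
have [u0 u0oo ->] := bseqsP p => -[_ u0u] [_ u0v].
apply: (@gprod_ge_weak _ _ (r + delta - delta)); first by lra.
apply: gprod_ge_trans (gprod_to_infty_ge _ u0v).
exact/gprod_geC/gprod_to_infty_ge.
Qed.

Lemma gprod_ge_rep (p q : boundary S) u u' v v' r :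
  bseqs p u -> bseqs p u' -> bseqs q v -> bseqs q v' ->
  gprod_ge u v r -> gprod_ge u' v' (r - 2 * delta).
Proof.
move=> pu pu' qv qv' uv.
apply: (@gprod_ge_weak _ _ (r - delta - delta)); first by lra.
apply: (@gprod_ge_trans _ v); last exact: boundary_rep_ge qv qv'.
by apply: gprod_ge_trans uv; exact: boundary_rep_ge pu' pu.
Qed.

(** A single late pair with product above [r + 2 * delta] would, by two uses of the four-point
    condition, force the bound [r] for all late pairs. *)
Lemma gprod_le_rep (p q : boundary S) u v r :
  bseqs p u -> bseqs q v -> ~ gprod_ge u v r -> gprod_le u v (r + 2 * delta).
Proof.
move=> pu qv nuv.
have [N hN] := boundary_rep_ge (r + 2 * delta) pu pu.
have [M hM] := boundary_rep_ge (r + 2 * delta) qv qv.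
exists (maxn N M) => i j; rewrite !geq_max => /andP[Ni Mi] /andP[Nj Mj].
rewrite leNgt; apply/negP => big; apply: nuv; exists (maxn N M) => i' j'.
rewrite !geq_max => /andP[Ni' Mi'] /andP[Nj' Mj'].
have h1 := four_point (hN i' i Ni' Ni) (ltW big).
have h2 : r + 2 * delta - delta <= gp 1%g (v j) (v j').
  by have := hM j j' Mj Mj'; have := delta_ge0; lra.
by have h := four_point h1 h2; lra.
Qed.

(* If both 1 and w see the triple x, y, z with small Gromov products, they are
   close: w projects near 1 as seen from at least two of the three points. *)
Lemma triple_center w x y z r :
  gp 1%g x y <= r -> gp 1%g y z <= r -> gp 1%g x z <= r ->
  gp w x y <= r -> gp w y z <= r -> gp w x z <= r ->
  (wlen S w)%:R <= 2 * r + 2 * delta.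
Proof.
have two a b : gp 1%g a w <= r + delta -> gp 1%g b w <= r + delta -> gp w a b <= r ->
    (wlen S w)%:R <= 2 * r + 2 * delta.
  move=> ha hb hab; have ea := gprod_base w a; have eb := gprod_base w b.
  rewrite leNgt; apply/negP => big.
  have d0 := delta_ge0; have h : r + delta < (wlen S w)%:R - (r + delta) by lra.
  have := @four_point w a 1%g b ((wlen S w)%:R - (r + delta)).
  rewrite (gprodC w a 1%g) ea eb (gprodC 1%g w a) (gprodC 1%g w b).
  have -> : (wlen S w)%:R - (r + delta) <= (wlen S w)%:R - gp 1%g a w by lra.
  have -> : (wlen S w)%:R - (r + delta) <= (wlen S w)%:R - gp 1%g b w by lra.
  by move=> /(_ isT isT) h'; lra.
have side a b : gp 1%g a b <= r -> gp 1%g a w <= r + delta \/ gp 1%g b w <= r + delta.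
  move=> ab; have [|ha] := leP (gp 1%g a w) (r + delta); first by left.
  have d0 := delta_ge0; right; rewrite leNgt; apply/negP => hb.
  pose m := Num.min (gp 1%g a w) (gp 1%g b w).
  have mgt : r + delta < m by rewrite lt_min ha.
  have := @four_point 1%g a w b m.
  by rewrite (gprodC 1%g w b) !ge_min !lexx orbT => /(_ isT isT) h; lra.
move=> xy yz xz wxy wyz wxz; case: (side x y xy) => h1.
  by case: (side y z yz) => h2; [apply: (two x y)|apply: (two x z)].
by case: (side x z xz) => h2; [apply: (two x y)|apply: (two y z)].
Qed.

End Hyperbolic.
End GromovProduct.

Lemma hyperbolic_four_point (G : groupType) (S : genset G) : hyperbolic S ->
  exists2 delta : rat, 0 <= delta & forall w x y z r,
    r <= gprod S w x y -> r <= gprod S w y z -> r - delta <= gprod S w x z.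
Proof.
move=> [delta h]; exists (Num.max delta 0); first by rewrite le_max lexx orbT.
move=> w x y z r xy yz; apply: le_trans (h w x y z).
by apply: lerB; rewrite ?le_min ?xy ?le_max ?lexx.
Qed.

(** * Proper discontinuity on triples and conical points, for the boundary action *)

Section ActionProperties.
Variables (R : realType) (G : groupType).
Local Notation X := (circle R).
Implicit Types (rho : HomHomeo G X).

Definition separated_triple (k : R) (p q r : X) : Prop :=
  [/\ k <= cdist p q, k <= cdist q r & k <= cdist p r].

Definition triple_proper rho : Prop := forall k : R, 0 < k ->
  exists B : seq G, forall g p q r, separated_triple k p q r ->
    separated_triple k (rho g p) (rho g q) (rho g r) -> g \in B.

(** [c] comes before [s], [t] and [z]: the size reached is uniform while the ball shrinks. *)
Definition conical rho : Prop := exists2 c : R, 0 < c &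
  forall s t : R, 0 < s -> 0 < t -> forall z, exists g,
    (forall w, s <= cdist w z -> c <= cdist (rho g w) (rho g z)) /\
    (forall w w', s <= cdist w z -> s <= cdist w' z ->
      cdist (rho g w) (rho g w') <= t).

End ActionProperties.

Section BoundaryAction.
Variables (R : realType) (G : groupType) (S : genset G).
Hypothesis hypG : hyperbolic S.
Variable phi : homeo (boundary S) (circle R).
Local Notation X := (circle R).
Local Notation gp := (gprod S).
Implicit Types (p q : X) (r : rat) (u v : nat -> G).

Definition represents u p : Prop := bseqs (homeo_inv phi p) u.

Lemma represents_ex p : exists u, represents u p.
Proof. exact: boundary_rep_ex. Qed.

Lemma represents_act g u p :
  represents u p -> represents (translate g u) (boundary_action phi g p).
Proof. by rewrite /represents /= homeoK => pu; exists u. Qed.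

(** Open sets are those containing some [bnbhd p r] around each of their points; that [bnbhd b n] is
    a neighbourhood in this topology uses hyperbolicity. The points with some [bnbhd] of their own
    inside it form an open set, by enlarging the radius by [2 * delta]. *)
Lemma bnbhd_nbhs (b : boundary S) n : nbhs b (bnbhd b n).
Proof.
have [delta d0 fp] := hyperbolic_four_point hypG.
rewrite nbhsE; exists [set q | exists m, bnbhd q m `<=` bnbhd b n]; last first.
  move=> q [m sub]; apply: sub; have [u qu] := boundary_rep_ex q.
  exists u, u; split => //; have := boundary_rep_ge fp m%:R qu qu; exact.
split; last by exists n.
rewrite boundary_openE => q [m sub]; have [k hk] := rat_nat_bound (2 * delta).
exists (m + k)%N => q' [x [y [qx q'y xy]]]; exists (m + k)%N.
move=> q'' [y' [z [q'y' q''z yz]]]; apply: sub.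
exists x, z; split => //.
suff : gprod_ge S x z m%:R by [].
apply: (@gprod_ge_weak _ _ _ _ ((m + k)%:R - delta - delta)); first by rewrite natrD; lra.
apply: (gprod_ge_trans fp _ (v := y)).
  by apply: gprod_ge_weak xy; lra.
apply: (gprod_ge_trans fp _ (v := y')) yz.
exact: (boundary_rep_ge fp _ q'y q'y').
Qed.

(** With its converse [gprod_large_near], translates between closeness on the circle and large
    Gromov products, uniformly in the points by compactness. *)
Lemma near_gprod_large r : exists2 c : R, 0 < c & forall p q, cdist p q < c ->
  forall u v, represents u p -> represents v q -> gprod_ge S u v r.
Proof.
have [delta d0 fp] := hyperbolic_four_point hypG.
apply: (@circle_uniformly R (fun c p => forall q, cdist p q < c -> forall u v,
  represents u p -> represents v q -> gprod_ge S u v r)).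
  by move=> p d e de h q pq; apply: h; apply: lt_le_trans de.
move=> p0; have [n hn] := rat_nat_bound (r + 3 * delta).
have /circle_nbhsP[e e0 he] := @homeo_inv_cts _ _ phi p0 _ (bnbhd_nbhs (homeo_inv phi p0) n).
have [u0 u0P] := represents_ex p0.
have near p u : cdist p0 p < e -> represents u p -> gprod_ge S u0 u (n%:R - 2 * delta).
  move=> /he [x [y [p0x py xy]]] pu.
  exact: (gprod_ge_rep fp p0x u0P py pu xy).
exists (e / 2) => [|p pp0 q pq u v pu qv]; first by lra.
apply: (@gprod_ge_weak _ _ _ _ (n%:R - 2 * delta - delta)); first by lra.
apply: (gprod_ge_trans fp (v := u0)).
  by apply: gprod_geC; apply: near pu; lra.
by apply: near qv; have := cdist_tri p p0 q; lra.
Qed.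

Lemma gprod_large_near (k : R) : 0 < k -> exists r, forall p q u v,
  represents u p -> represents v q -> gprod_ge S u v r -> cdist p q < k.
Proof.
move=> k0; have [delta d0 fp] := hyperbolic_four_point hypG.
suff [n hn] : exists n : nat, forall p q u v,
    represents u p -> represents v q -> gprod_ge S u v n%:R -> cdist p q < k.
  by exists n%:R.
apply: (@circle_uniformly_nat R (fun n p => forall q u v,
  represents u p -> represents v q -> gprod_ge S u v n%:R -> cdist p q < k)).
  move=> p m n mn h q u v pu qv uv; apply: (h q u v) => //.
  by apply: gprod_ge_weak uv; rewrite ler_nat.
move=> p0; set b0 := homeo_inv phi p0.
have : nbhs b0 [set b | cdist p0 (phi b) < k / 2].
  apply: (@homeo_cts _ _ phi b0 [set q | cdist p0 q < k / 2]).
  by rewrite /b0 homeoVK; apply/circle_nbhsP; exists (k / 2) => //; lra.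
rewrite nbhsE => -[A [oA Ab0] Asub].
have [m mA] : exists m, bnbhd b0 m `<=` A by exact: oA.
have [l hl] := rat_nat_bound delta.
have [u0 u0P] := represents_ex p0.
have [l' hl'] := rat_nat_bound (2 * delta).
have /circle_nbhsP[e e0 he] :=
  @homeo_inv_cts _ _ phi p0 _ (bnbhd_nbhs b0 (m + l + l')).
have /circle_nbhsP[e' e'0 he'] :=
  @homeo_inv_cts _ _ phi p0 _ (bnbhd_nbhs b0 m).
exists (m + l)%N; exists (Num.min e e'); first by rewrite lt_min e0.
move=> p; rewrite lt_min => /andP[/he pp0 /he' pp0'] q u v pu qv uv.
have close b : bnbhd b0 m b -> cdist p0 (phi b) < k / 2 by move=> /mA/Asub.
have hp := close _ pp0'; rewrite homeoVK in hp.
suff hq : cdist p0 q < k / 2.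
  by apply: le_lt_trans (cdist_tri p0 _ _) _; rewrite (cdistC p p0); lra.
rewrite -(homeoVK phi q); apply: close.
case: pp0 => x [y [p0x py xy]]; exists u0, v; split => //.
have h : gprod_ge S u0 u ((m + l + l')%:R - 2 * delta).
  exact: (gprod_ge_rep fp p0x u0P py pu xy).
suff : gprod_ge S u0 v m%:R by [].
apply: (@gprod_ge_weak _ _ _ _ ((m + l)%:R - delta)); first by rewrite natrD; lra.
apply: (gprod_ge_trans fp (v := u)) uv.
by apply: gprod_ge_weak h; rewrite [X in _ <= X - _]natrD; lra.
Qed.

(** The product of [g x] and [g y] at 1 is that of [x] and [y] at [g^-1]. Hence both 1 and [g^-1]
    see the triple with small products, [triple_center] bounds the length of [g], and balls are
    finite. *)
Lemma boundary_action_triple_proper : triple_proper (boundary_action phi : HomHomeo G X).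
Proof.
have [delta d0 fp] := hyperbolic_four_point hypG.
move=> k k0; have [r hr] := gprod_large_near k0.
have far p q u v : represents u p -> represents v q -> k <= cdist p q ->
    gprod_le S u v (r + 2 * delta).
  move=> pu qv pq; apply: (gprod_le_rep d0 fp pu qv) => uv.
  by have := hr _ _ _ _ pu qv uv; rewrite ltNge pq.
have [n hn] := rat_nat_bound (2 * (r + 2 * delta) + 2 * delta).
have [B hB] := wlen_ball_finite S n; exists B => g p q s [pq qs ps] [gpq gqs gps].
have [u pu] := represents_ex p; have [v qv] := represents_ex q.
have [w sw] := represents_ex s.
have [n1 h1] := far _ _ _ _ pu qv pq; have [n2 h2] := far _ _ _ _ qv sw qs.
have [n3 h3] := far _ _ _ _ pu sw ps.
have act := represents_act g.
have [m1 k1] := far _ _ _ _ (act _ _ pu) (act _ _ qv) gpq.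
have [m2 k2] := far _ _ _ _ (act _ _ qv) (act _ _ sw) gqs.
have [m3 k3] := far _ _ _ _ (act _ _ pu) (act _ _ sw) gps.
pose N := (n1 + n2 + n3 + m1 + m2 + m3)%N.
apply: hB; rewrite -wlenV -(ler_nat rat); apply: le_trans hn.
apply: (triple_center d0 fp (x := u N) (y := v N) (z := w N)).
- by apply: h1; rewrite /N; clear; lia.
- by apply: h2; rewrite /N; clear; lia.
- by apply: h3; rewrite /N; clear; lia.
- by rewrite -gprod_mul; apply: k1; rewrite /N; clear; lia.
- by rewrite -gprod_mul; apply: k2; rewrite /N; clear; lia.
- by rewrite -gprod_mul; apply: k3; rewrite /N; clear; lia.
Qed.

(** Take [g = w^-1] with [w] at depth [L] on a geodesic word towards [z]. Seen from [w], the
    identity lies away from [z], and every point at distance at least [s] from [z] lies in the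
    direction of the identity; so these points cluster together and keep clear of [z]. *)
Lemma boundary_action_conical : conical (boundary_action phi : HomHomeo G X).
Proof.
have [delta d0 fp] := hyperbolic_four_point hypG.
have [c c0 hc] := near_gprod_large (2 * delta + 1).
exists c => // s t s0 t0 z.
have [r hr] := gprod_large_near s0; have [r' hr'] := gprod_large_near t0.
pose M := r + 2 * delta.
have far q u v : represents u z -> represents v q -> s <= cdist q z ->
    gprod_le S u v M.
  move=> zu qv qz; apply: (gprod_le_rep d0 fp zu qv) => uv.
  by have := hr _ _ _ _ zu qv uv; rewrite cdistC ltNge qz.
(* [L1] makes [w] deep enough for the expansion, [L2] for the collapse to size [t]. *)
have [L1 hL1] := rat_nat_bound (M + 4 * delta + 1).
have [L2 hL2] := rat_nat_bound (M + r' + 4 * delta).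
pose L := (L1 + L2)%N.
have L0 : M + 4 * delta + 1 <= L%:R by rewrite natrD; have := ler0n rat L2; lra.
have L0' : M + r' + 4 * delta <= L%:R by rewrite natrD; have := ler0n rat L1; lra.
have [x zx] := represents_ex z.
have [N hN] := boundary_rep_ge fp L%:R zx zx.
have xL : (L <= wlen S (x N))%N.
  rewrite -(ler_nat rat); have := hN N N (leqnn _) (leqnn _).
  rewrite /gprod /wdist invg1 !mul1g mulVg.
  have -> : wlen S 1%g = 0%N.
    apply/eqP; rewrite -leqn0; have := @wlen_le _ S [::] isT.
    by rewrite big_nil.
  by move=> h; lra.
have [w wL wx] := geodesic_prefix xL.
have wxN : L%:R <= gp 1%g w (x N).
  have := wlenM S w (w^-1 * x N)%g; rewrite mulVKg => h.
  have : (wlen S (w^-1 * x N)%g + L <= wlen S (x N))%N by lia.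
  rewrite -(ler_nat rat) natrD => h'.
  by rewrite /gprod /wdist invg1 !mul1g wL; lra.
have w1 i : (N <= i)%N -> gp w (x i) 1%g <= delta.
  move=> Ni; have := fp 1%g w (x N) (x i) L%:R wxN (hN _ _ (leqnn _) Ni).
  by rewrite (gprodC S w (x i)) gprod_base wL => h; lra.
have away q v : represents v q -> s <= cdist q z ->
    exists N', forall j, (N' <= j)%N -> L%:R - M - delta <= gp w (v j) 1%g.
  move=> qv qz; have [N' hN'] := far _ _ _ zx qv qz.
  exists N' => j N'j; rewrite (gprodC S w (v j)) gprod_base wL.
  suff : gp 1%g w (v j) <= M + delta by move=> h; lra.
  rewrite leNgt; apply/negP => big.
  pose i := maxn N N'.
  have wi : M + delta < gp 1%g w (x i).
    have := fp 1%g w (x N) (x i) L%:R wxN (hN _ _ (leqnn _) (leq_maxl _ _)).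
    by move=> h; lra.
  pose m := Num.min (gp 1%g w (x i)) (gp 1%g w (v j)).
  have mM : M + delta < m by rewrite lt_min wi.
  have := fp 1%g (x i) w (v j) m.
  rewrite (gprodC S 1%g (x i) w) !ge_min !lexx orbT => /(_ isT isT) h.
  by have h' := hN' i j (leq_maxr _ _) N'j; lra.
exists w^-1%g; split=> [q qz|q q' qz q'z].
- rewrite leNgt; apply/negP => gq.
  have [v qv] := represents_ex q.
  have [N1 h1] := away _ _ qv qz.
  have [N2 h2] := hc _ _ gq _ _ (represents_act w^-1%g qv) (represents_act w^-1%g zx).
  pose i := (N + N1 + N2)%N.
  have {}h2 : 2 * delta + 1 <= gp w (v i) (x i).
    by have := h2 i i; rewrite /translate gprod_mul invgK; apply; rewrite /i; clear; lia.
  have {}h1 : L%:R - M - delta <= gp w (v i) 1%g by apply: h1; rewrite /i; clear; lia.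
  have h3 : gp w (x i) 1%g <= delta by apply: w1; rewrite /i; clear; lia.
  have h4 := @fp w (x i) (v i) 1%g (2 * delta + 1).
  have h5 : 2 * delta + 1 <= gp w (v i) 1%g by lra.
  by have := h4 _ h5; rewrite (gprodC S w (x i) (v i)) => /(_ h2) h6; lra.
- have [v qv] := represents_ex q; have [v' q'v'] := represents_ex q'.
  have [N1 h1] := away _ _ qv qz; have [N2 h2] := away _ _ q'v' q'z.
  apply/ltW; apply: (hr' _ _ _ _ (represents_act w^-1%g qv) (represents_act w^-1%g q'v')).
  exists (N1 + N2)%N => i j Ni Nj; rewrite /translate gprod_mul invgK.
  have {}h1 : L%:R - M - delta <= gp w (v i) 1%g by apply: h1; move: Ni; clear; lia.
  have {}h2 : L%:R - M - delta <= gp w 1%g (v' j).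
    by rewrite (gprodC S w 1%g); apply: h2; move: Nj; clear; lia.
  by have h := fp _ _ _ _ _ h1 h2; lra.
Qed.

End BoundaryAction.

(** * Expansion and lifts to covers *)

Section HomBasics.
Variables (R : realType) (G : groupType).
Local Notation X := (circle R).
Implicit Types (rho : HomHomeo G X) (g h : G) (x y : X).

Lemma homM rho g h x : rho (g * h)%g x = rho g (rho h x).
Proof. by rewrite /hom_fun gmulfM. Qed.

Lemma hom1 rho x : rho 1%g x = x.
Proof. by apply: (can_inj (@homeoK _ _ (rho 1%g))); rewrite -homM mulg1. Qed.

Lemma homK rho g : cancel (rho g) (rho g^-1%g).
Proof. by move=> x; rewrite -homM mulVg hom1. Qed.

Lemma homVK rho g : cancel (rho g^-1%g) (rho g).
Proof. by move=> x; rewrite -homM mulgV hom1. Qed.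

Lemma hom_continuous rho g : continuous (rho g).
Proof. exact: homeo_cts. Qed.

Lemma hom_equicontinuous rho (l : seq G) (e : R) : 0 < e -> exists2 d, 0 < d &
  forall g x y, g \in l -> cdist x y < d -> cdist (rho g x) (rho g y) < e.
Proof. by apply: finitely_many_uniform => g _; exact: hom_continuous. Qed.

Definition expands (f : X -> X) x (s c : R) : Prop :=
  forall w, s <= cdist w x -> c <= cdist (f w) (f x).

(** What a cover inherits of conicality: small balls reach one definite size [c], by finitely many
    elements for each scale. *)
Definition expanding rho : Prop := exists2 c : R, 0 < c & forall s, 0 < s ->
  exists F : seq G, forall x, exists2 g, g \in F & expands (rho g) x s c.

(* For the boundary action this follows from proper discontinuity on triples:
   g' g^-1 carries the images under g of x, l and a point far from x to their
   images under g', and both triples are separated. *)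
Definition proper_expansion rho : Prop := exists2 r0 : R, 0 < r0 & forall c2 : R, 0 < c2 ->
  exists2 c1 : R, 0 < c1 & forall k : R, 0 < k -> exists B : seq G,
  forall g g' x l, expands (rho g) x r0 c2 -> expands (rho g') x r0 c2 ->
    k <= cdist (rho g l) (rho g x) <= c1 -> k <= cdist (rho g' l) (rho g' x) <= c1 ->
    (g' * g^-1)%g \in B.

Lemma expands_weak (f : X -> X) x (s c s' c' : R) :
  s <= s' -> c' <= c -> expands f x s c -> expands f x s' c'.
Proof. by move=> ss' cc' h w s'w; apply: le_trans cc' (h w (le_trans ss' s'w)). Qed.

Lemma expands_comp (f g : X -> X) x (s c s' c' : R) : s' <= c ->
  expands f x s c -> expands g (f x) s' c' -> expands (g \o f) x s c'.
Proof. by move=> s'c hf hg w sw; apply: hg; apply: le_trans s'c (hf w sw). Qed.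

(** The point is found on the shorter arc from [p] to [p']. *)
Lemma circle_intermediate_near (f : X -> X) (q p p' : X) (s : R) : continuous f ->
  cdist (f p) q <= s <= cdist (f p') q ->
  exists2 v, cdist v p <= cdist p p' & cdist (f v) q = s.
Proof.
move=> fc; have [a <-] := circle_proj_surj p.
have [b <- ab] := cdist_lift a p' => hs; rewrite -ab.
have close t : `|t - a| <= `|a - b| -> cdist (circle_proj t) (circle_proj a) <= `|a - b|.
  exact: le_trans (cdist_proj_le _ _).
have [ba|/ltW ba] := leP a b.
  have [t /andP[at_ tb] ht] := circle_intermediate fc ba (or_introl hs).
  by exists (circle_proj t) => //; apply: close; rewrite [leRHS]distrC !ger0_norm; lra.
have [t /andP[at_ tb] ht] := circle_intermediate fc ba (or_intror hs).
by exists (circle_proj t) => //; apply: close; rewrite distrC !ger0_norm; lra.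
Qed.

End HomBasics.

(** * Covering maps as uniform local homeomorphisms *)

Section LocalHomeo.
Variable R : realType.
Local Notation X := (circle R).
Implicit Types (psi : X -> X) (x y : X).

(** What is kept of a covering map: uniform openness, and quantitative injectivity at distances up
    to [r]. The identity has both, so the boundary action and its lifts are treated at once. *)
Definition uniform_local_homeo psi : Prop := [/\ continuous psi,
  forall e : R, 0 < e -> exists2 d, 0 < d & forall x y, cdist (psi x) y < d ->
    exists2 x', cdist x x' < e & psi x' = y &
  exists2 r : R, 0 < r & forall k, 0 < k -> exists2 k', 0 < k' &
    forall v v', k <= cdist v v' <= r -> k' <= cdist (psi v) (psi v')].

Lemma id_uniform_local_homeo : uniform_local_homeo id.
Proof.
split; first by move=> x; exact: cvg_id.
  by move=> e e0; exists e => // x y xy; exists y.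
by exists 1 => // k k0; exists k => // v v' /andP[].
Qed.

Lemma covering_map_section psi x : covering_map psi -> exists V U (s : X -> X),
  [/\ open V, V x, (forall v, V v -> U (psi v) /\ s (psi v) = v) &
     (forall y, U y -> psi (s y) = y) /\
     (forall y e, U y -> 0 < e -> exists2 d, 0 < d &
       forall y', cdist y y' < d -> U y' /\ cdist (s y) (s y') < e)].
Proof.
move=> [_ cov]; have [U [oU Ux [F [_ FU FV]]]] := cov (psi x).
have [V VF Vx] : (\bigcup_(V in F) V) x by rewrite FU.
have [oV [s [sc sU spsi]]] := FV V VF.
exists V, U, s; split => //.
  by rewrite -sU => _ [z Uz <-]; rewrite spsi.
split=> // y e Uy e0.
have : nbhs (s y) [set y' | cdist (s y) y' < e] by apply/circle_nbhsP; exists e.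
move/subspace_continuousP : (sc) => /(_ y Uy) h /h /circle_nbhsP[d d0 hd].
have [d' d'0 hd'] := (circle_open_cdistP U).1 oU y Uy.
exists (Num.min d d'); first by rewrite lt_min d0.
by move=> y'; rewrite lt_min => /andP[/hd sy /hd' Uy']; split=> //; exact: sy.
Qed.

Lemma covering_map_uniform_local_homeo psi : covering_map psi -> uniform_local_homeo psi.
Proof.
move=> cov; have psic : continuous psi by case: cov.
split=> //.
- move=> e e0; apply: (@circle_uniformly R (fun d x => forall y, cdist (psi x) y < d ->
    exists2 x', cdist x x' < e & psi x' = y)).
    by move=> p d d' dd' h y py; apply: h; apply: lt_le_trans dd'.
  move=> x; have [V [U [s [oV Vx VU [Us sc]]]]] := covering_map_section x cov.
  have [Upx spx] := VU x Vx.
  have e2 : 0 < e / 2 by lra.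
  have [d d0 hd] := sc _ _ Upx e2.
  have d2 : 0 < d / 2 by lra.
  have [d' d'0 hd'] := (circle_continuousP _).1 psic x _ d2.
  exists (Num.min (d / 2) (Num.min d' (e / 2))).
    by rewrite !lt_min d2 d'0 e2.
  move=> q; rewrite !lt_min => /andP[_ /andP[/hd' pq xq]] y.
  rewrite lt_min => /andP[qy _].
  have [|Uy sy] := hd y; first by apply: le_lt_trans (cdist_tri (psi q) _ _) _; lra.
  exists (s y); last exact: Us.
  by rewrite spx in sy; apply: le_lt_trans (cdist_tri x _ _) _; rewrite (cdistC q x); lra.
- pose P (r : R) x := exists V U (s : X -> X),
    [/\ forall v, cdist x v < r -> V v, (forall v, V v -> U (psi v) /\ s (psi v) = v) &
     (forall y e, U y -> 0 < e -> exists2 d, 0 < d &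
       forall y', cdist y y' < d -> U y' /\ cdist (s y) (s y') < e)].
  have [r r0 hr] : exists2 r, 0 < r & forall x, P r x.
    apply: (@circle_uniformly R P).
      move=> p d d' dd' [V [U [s [h1 h2 h3]]]]; exists V, U, s; split=> // v dv.
      by apply: h1; apply: lt_le_trans dd'.
    move=> x; have [V [U [s [oV Vx VU [_ sc]]]]] := covering_map_section x cov.
    have [e e0 he] := (circle_open_cdistP V).1 oV x Vx.
    exists (e / 2) => [|q xq]; first by lra.
    exists V, U, s; split=> // v qv; apply: he.
    by apply: le_lt_trans (cdist_tri q _ _) _; lra.
  exists (r / 2) => [|k k0]; first by lra.
  suff [k' k'0 hk'] : exists2 k', 0 < k' & forall v v', k <= cdist v v' <= r / 2 ->
      k' <= cdist (psi v) (psi v') by exists k'.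
  apply: (@circle_uniformly R (fun k' v => forall v', k <= cdist v v' <= r / 2 ->
      k' <= cdist (psi v) (psi v'))).
    by move=> p d d' dd' h v' /h; exact: le_trans.
  move=> v0; have [V [U [s [hV VU sc]]]] := hr v0.
  have Vv0 : V v0 by apply: hV; rewrite cdistxx.
  have [Uv0 sv0] := VU v0 Vv0.
  have k2 : 0 < k / 2 by lra.
  have [d d0 hd] := sc _ _ Uv0 k2; rewrite sv0 in hd.
  have d2 : 0 < d / 2 by lra.
  have [d' d'0 hd'] := (circle_continuousP _).1 psic v0 _ d2.
  exists (Num.min (d / 2) (Num.min d' (Num.min (k / 2) (r / 2)))).
    by rewrite !lt_min d2 d'0 k2 /=; lra.
  move=> v; rewrite !lt_min => /andP[_ /andP[/hd' pv /andP[kv rv]]] v' /andP[kvv' rvv'].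
  rewrite ge_min; apply/orP; left; rewrite leNgt; apply/negP => close.
  have Vv' : V v'.
    by apply: hV; apply: le_lt_trans (cdist_tri v _ _) _; lra.
  have [_ sv'] := VU v' Vv'.
  have [|_] := hd (psi v'); first by apply: le_lt_trans (cdist_tri (psi v) _ _) _; lra.
  by rewrite sv' => h; have := cdist_tri v0 v v'; rewrite (cdistC v v0); lra.
Qed.

End LocalHomeo.

Section Lifting.
Variables (R : realType) (G : groupType).
Local Notation X := (circle R).
Variables (psi : X -> X) (rhob rho0 : HomHomeo G X).
Hypothesis psiP : uniform_local_homeo psi.
Hypothesis lift : forall g x, rhob g (psi x) = psi (rho0 g x).

(** A point [w] far from [x] may lie over a point near [psi x], where nothing is expanded. If its
    image were close to [rho0 g x], the arc joining the two images would contain the image of a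
    point at distance exactly [min (s / 2) r] from [x]. By local injectivity that point projects
    away from [psi x], so it is expanded downstairs, against the continuity of [psi]. *)
Lemma lift_expanding : conical rhob -> expanding rho0.
Proof.
case: psiP => psic _ [r r0 hinj] [c c0 hcon].
have [c' c'0 hc'] := circle_uniform_continuity psic c0.
exists (c' / 2) => [|s s0]; first by lra.
have pointwise x : exists g, expands (rho0 g) x (s / 2) c'.
  have s1 : 0 < Num.min (s / 2) r by rewrite lt_min r0 andbT; lra.
  have [k' k'0 hk'] := hinj _ s1.
  have [g [hg _]] := hcon _ _ k'0 c'0 (psi x); exists g => w sw.
  rewrite leNgt; apply/negP => close.
  have hs : cdist (rho0 g^-1%g (rho0 g x)) x <= Num.min (s / 2) r
      <= cdist (rho0 g^-1%g (rho0 g w)) x.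
    by rewrite !homK cdistxx (ltW s1) ge_min sw.
  have [v vx hv] := circle_intermediate_near (@hom_continuous _ _ rho0 g^-1%g) hs.
  rewrite (cdistC (rho0 g x)) in vx.
  have : cdist (psi (rho0 g^-1%g v)) (psi x) < k'.
    rewrite ltNge; apply/negP => /hg; rewrite !lift homVK leNgt => /negP; apply.
    by apply: hc'; apply: le_lt_trans vx close.
  by rewrite ltNge => /negP; apply; apply: hk'; rewrite hv lexx ge_min lexx orbT.
(* The factors 2 left on [s] and [c'] let the element chosen at [x] serve a neighbourhood of [x]. *)
have [gx hgx] := choice pointwise.
have c4 : 0 < c' / 2 by lra.
have [e eP] : {e : X -> R & forall x, 0 < e x /\ forall q, cdist x q < e x ->
    expands (rho0 (gx x)) q s (c' / 2)}.
  apply: (@choice _ _ (fun x e => 0 < e /\ forall q, cdist x q < e ->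
    expands (rho0 (gx x)) q s (c' / 2))) => x.
  have [d d0 hd] := (circle_continuousP _).1 (@hom_continuous _ _ rho0 (gx x)) x _ c4.
  exists (Num.min d (s / 2)); split; first by rewrite lt_min d0; lra.
  move=> q; rewrite lt_min => /andP[/hd close xq] w qw.
  have /hgx h : s / 2 <= cdist w x by have := cdist_tri x w q; lra.
  by have := cdist_tri (rho0 (gx x) q) (rho0 (gx x) w) (rho0 (gx x) x);
     rewrite (cdistC (rho0 (gx x) q) (rho0 (gx x) x)); lra.
have [ps cov] := circle_finite_cover (fun x => (eP x).1).
exists [seq gx p | p <- ps] => x; have [p pps px] := cov x.
by exists (gx p); [exact: map_f|exact: (eP p).2].
Qed.

(** The third point of the triple is taken downstairs, at distance 1/2 from [psi x]. Its image stays
    away from that of [psi x]: otherwise uniform openness lifts it to some [v] near [rho0 h x],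
    expansion puts [rho0 h^-1 v] within [r1] of [x], and the third point would be closer than
    1/2. *)
Lemma lift_proper_expansion : triple_proper rhob -> proper_expansion rho0.
Proof.
case: psiP => psic hopen [r r0 hinj] hprop.
have half : 0 < 1 / 2 :> R by lra.
have [r1 r10 hr1] := circle_uniform_continuity psic half.
exists r1 => // c2 c20; have [c2' c2'0 hc2'] := hopen _ c20.
have c4 : 0 < c2' / 2 by lra.
have [m m0 hm] := circle_uniform_continuity psic c4.
exists (Num.min r (m / 2)) => [|k k0]; first by rewrite lt_min r0; lra.
have [k' k'0 hk'] := hinj _ k0.
have kk0 : 0 < Num.min k' (c2' / 2) by rewrite lt_min k'0.
have [B hB] := hprop _ kk0.
exists B => g g' x l eg eg'; rewrite ![_ <= Num.min r _]le_min.
move=> /and3P[kl lr lm] /and3P[kl' lr' lm'].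
have [far oz] : exists q, cdist q (psi x) = 1 / 2.
  by apply: cdist_attains; rewrite lexx andbT ltW.
have sep h : expands (rho0 h) x r1 c2 -> k <= cdist (rho0 h l) (rho0 h x) ->
    cdist (rho0 h l) (rho0 h x) <= r -> cdist (rho0 h l) (rho0 h x) <= m / 2 ->
    separated_triple (Num.min k' (c2' / 2)) (rhob h (psi l)) (rhob h (psi x)) (rhob h far).
  move=> eh hkl hlr hlm.
  have farz : c2' <= cdist (psi (rho0 h x)) (rhob h far).
    rewrite leNgt; apply/negP => /hc2'[v hv psiv].
    have := eh (rho0 h^-1%g v); rewrite homVK => eh'.
    have : cdist (rho0 h^-1%g v) x < r1.
      by rewrite ltNge; apply/negP => /eh'; rewrite cdistC leNgt hv.
    by move=> /hr1; rewrite -lift psiv homK oz ltxx.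
  have near : cdist (psi (rho0 h l)) (psi (rho0 h x)) < c2' / 2 by apply: hm; lra.
  split; rewrite ge_min !lift.
  - by apply/orP; left; apply: hk'; rewrite hkl.
  - by apply/orP; right; lra.
  - by apply/orP; right; have := cdist_tri (psi (rho0 h l)) (psi (rho0 h x)) (rhob h far);
       rewrite (cdistC (psi (rho0 h x)) (psi (rho0 h l))); lra.
apply: hB (sep g eg kl lr lm) _; rewrite -!homM mulgVK.
exact: sep.
Qed.

End Lifting.

(** * Expanding codes and shadowing *)

Section Codes.
Variables (R : realType) (G : groupType) (rho0 : HomHomeo G (circle R)).
Local Notation X := (circle R).
Implicit Types (x y w : X) (g : nat -> G) (n m N : nat).

Fixpoint code_prod g n : G := if n is m.+1 then (g m * code_prod g m)%g else 1%g.

Definition skip m g : nat -> G := fun i => g (m + i)%N.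

Lemma code_prodD g m n : code_prod g (m + n) = (code_prod (skip m g) n * code_prod g m)%g.
Proof. by elim: n => [|n ih]; rewrite ?addn0 ?mul1g // addnS /= ih mulgA. Qed.

(** The points at distance at least [r] from [y] form an arc, lifted to [[Y + r, Y + 1 - r]], on
    which the intermediate value theorem applies. *)
Lemma circle_intermediate_far (f : X -> X) q y w w' (r t : R) : continuous f ->
  r <= cdist w y -> r <= cdist w' y -> cdist (f w) q <= t <= cdist (f w') q ->
  exists2 e, r <= cdist e y & cdist (f e) q = t.
Proof.
move=> fc; have [Y <-] := circle_proj_surj y.
have lift v : r <= cdist v (circle_proj Y) ->
    exists2 V, circle_proj V = v & Y + r <= V <= Y + 1 - r.
  have [V0 <-] := circle_proj_surj v.
  pose n := Num.floor (V0 - Y); have /andP[lo hi] := floor_itv (V0 - Y).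
  rewrite intrD in hi; rewrite -/n in lo hi.
  rewrite cdistE => h; exists (V0 - n%:~R); first by rewrite -intrN circle_proj_int.
  have h1 := int_dist_le (V0 - Y) n; have h2 := int_dist_le (V0 - Y) (n + 1).
  rewrite intrD in h2; rewrite ger0_norm in h1; last by lra.
  by rewrite ler0_norm in h2; [apply/andP; split; lra|lra].
move=> /lift[W <- /andP[W1 W2]] /lift[W' <- /andP[W'1 W'2]] hs.
have far v : Y + r <= v <= Y + 1 - r -> r <= cdist (circle_proj v) (circle_proj Y).
  move=> /andP[v1 v2]; rewrite cdistE; have [n ->] := int_dist_ex (v - Y).
  have [n0|n1] := leP n 0.
    have : n%:~R <= 0 :> R by rewrite lerz0.
    by move=> h; apply: le_trans (ler_norm _); lra.
  have : 1 <= n%:~R :> R by rewrite ler1z.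
  by move=> h; rewrite -normrN; apply: le_trans (ler_norm _); lra.
have [WW'|/ltW WW'] := leP W W'.
  have [v /andP[v1 v2] hv] := circle_intermediate fc WW' (or_introl hs).
  by exists (circle_proj v) => //; apply: far; apply/andP; split; lra.
have [v /andP[v1 v2] hv] := circle_intermediate fc WW' (or_intror hs).
by exists (circle_proj v) => //; apply: far; apply/andP; split; lra.
Qed.

Lemma code_prod_modulus (F : seq G) n (e : R) : 0 < e -> exists2 d, 0 < d &
  forall g x y, (forall i, (i < n)%N -> g i \in F) -> cdist x y < d ->
    cdist (rho0 (code_prod g n) x) (rho0 (code_prod g n) y) < e.
Proof.
elim: n e => [|n ih] e e0.
  by exists e => // g x y _; rewrite /= !hom1.
have [d d0 hd] := hom_equicontinuous rho0 F e0.
have [d' d'0 hd'] := ih _ d0; exists d' => // g x y gF xy.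
rewrite /= !homM; apply: hd; first exact: gF.
by apply: hd' xy => i ni; apply: gF; apply: ltnW.
Qed.

(** [2 * s < c] lets expanding steps be composed. [C], the expansion along pseudo-orbits, is at
    least [2 * c] to absorb the passage to a nearby orbit. [c <= r0] makes the identity expand from
    [r0] to [c]. One letter of [F] cannot stretch a distance below [k] to [2 * s]. *)
Variables (F : seq G) (s c C r0 c1 k : R).
Hypothesis consts : [/\ 0 < s, 2 * s < c, 2 * c <= C & 2 * s <= 1 / 2] /\
  [/\ c <= r0, 2 * s <= c1, 0 < k & k <= 2 * s].
Hypothesis F_modulus : forall a x y, a \in F -> cdist x y < k ->
  cdist (rho0 a x) (rho0 a y) < 2 * s.
Hypothesis proper : forall e : R, 0 < e -> exists B : seq G,
  forall a a' x l, expands (rho0 a) x r0 c -> expands (rho0 a') x r0 c ->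
    e <= cdist (rho0 a l) (rho0 a x) <= c1 -> e <= cdist (rho0 a' l) (rho0 a' x) <= c1 ->
    (a' * a^-1)%g \in B.

Definition exp_code N y g : Prop := forall i, (i < N)%N -> g i \in F /\
  expands (rho0 (g i)) (rho0 (code_prod g i) y) (2 * s) c.

Lemma code_weak N N' y g : (N' <= N)%N -> exp_code N y g -> exp_code N' y g.
Proof. by move=> N'N h i iN'; apply: h; apply: leq_trans N'N. Qed.

Lemma code_shift N m y g : exp_code (m + N) y g ->
  exp_code N (rho0 (code_prod g m) y) (skip m g).
Proof.
move=> h i iN; have [] := h (m + i)%N; first by rewrite ltn_add2l.
by rewrite code_prodD homM.
Qed.

Lemma code_expands N y g n : exp_code N y g -> (0 < n <= N)%N ->
  expands (rho0 (code_prod g n)) y (2 * s) c.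
Proof.
have [[s0 s2c _ _] _] := consts; move=> h; elim: n => // n ih nN.
have [_ gn] := h n nN; case: n ih nN gn => [|n] ih nN gn.
  by move: gn; rewrite /= hom1 mulg1.
have s2c' : 2 * s <= c by lra.
have := expands_comp s2c' (ih (ltnW nN)) gn.
by move=> h' w sw; have := h' w sw; rewrite /= -!homM.
Qed.

(** Equal prefixes would leave a segment of the code with product 1, which cannot move a point from
    distance [2 * s] to distance at least [c]. *)
Lemma code_prod_neq N y g i j : exp_code N y g -> (i < j <= N)%N ->
  code_prod g i <> code_prod g j.
Proof.
have [[s0 s2c _ sh] _] := consts; move=> h /andP[ij jN] e.
have jE : (i + (j - i) = j)%N by rewrite subnKC // ltnW.
have hi : exp_code (j - i) (rho0 (code_prod g i) y) (skip i g).
  by apply: code_shift; rewrite jE; exact: code_weak jN h.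
have one : code_prod (skip i g) (j - i) = 1%g.
  by apply: (mulIg (code_prod g i)); rewrite mul1g -code_prodD jE.
have : (0 < j - i <= j - i)%N by rewrite leqnn subn_gt0 ij.
move=> /(code_expands hi); rewrite one => ex.
have [|w hw] := @cdist_attains R (rho0 (code_prod g i) y) (2 * s).
  by apply/andP; split; lra.
by have := ex w; rewrite hw !hom1 hw => /(_ (lexx _)); rewrite leNgt s2c.
Qed.

(** Suppose [w] is [r]-far from [y] but [c]-close at time [n]. Then it was [2 * s]-close at each
    time [0 < i < n], and for each such [i] some point at distance at least [r] and less than
    [2 * s] from [y] is at distance exactly [2 * s] at time [i]. [proper], applied to the prefix and
    to 1, puts the inverses of all these prefixes in one finite set, while prefixes are distinct. *)
Lemma code_shrink (r : R) : 0 < r -> exists N0, forall N y g n, exp_code N y g ->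
  (N0 <= n <= N)%N -> expands (rho0 (code_prod g n)) y r c.
Proof.
have [[s0 s2c _ sh] [cr0 s2c1 k0 _]] := consts; move=> rpos.
have e0 : 0 < Num.min r (2 * s) by rewrite lt_min rpos; lra.
(* The times [0 < i < n] then number at least [size B + 1]. *)
have [B hB] := proper e0; exists (size B).+2 => N y g n hc /andP[Bn nN] w rw.
rewrite leNgt; apply/negP => close.
have small i : (0 < i < n)%N ->
    cdist (rho0 (code_prod g i) w) (rho0 (code_prod g i) y) < 2 * s.
  move=> /andP[i0 i_n]; rewrite ltNge; apply/negP => big.
  have nE : (i + (n - i) = n)%N by rewrite subnKC // ltnW.
  have hi : exp_code (n - i) (rho0 (code_prod g i) y) (skip i g).
    by apply: code_shift; rewrite nE; exact: code_weak nN hc.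
  have : (0 < n - i <= n - i)%N by rewrite leqnn subn_gt0 i_n.
  move=> /(code_expands hi)/(_ _ big); rewrite -!homM -code_prodD nE.
  by rewrite leNgt close.
have inB i : (0 < i < n)%N -> (code_prod g i)^-1%g \in B.
  move=> /andP[i0 i_n]; have iN : (0 < i <= N)%N by rewrite i0 (leq_trans (ltnW i_n)).
  have ex := code_expands hc iN.
  have [w' hw'] : exists w', cdist w' y = 1 / 2.
    by apply: cdist_attains; rewrite lexx andbT; lra.
  have far : 2 * s <= cdist (rho0 (code_prod g i) w') (rho0 (code_prod g i) y).
    by apply: le_trans (ltW s2c) (ex _ _); rewrite hw'.
  have r2 : r <= cdist w' y by rewrite hw'; exact: le_trans rw (cdist_le_half _ _).
  have [|e re he] := circle_intermediate_far (t := 2 * s)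
    (q := rho0 (code_prod g i) y) (@hom_continuous _ _ rho0 (code_prod g i)) rw r2.
    by rewrite far andbT ltW // small // i0.
  have es : cdist e y < 2 * s.
    rewrite ltNge; apply/negP => /ex; rewrite he; lra.
  have := hB (code_prod g i) 1%g y e; rewrite mul1g; apply.
  - by apply: expands_weak ex; lra.
  - by move=> v rv; rewrite !hom1; exact: le_trans rv.
  - by rewrite he s2c1 ge_min lexx orbT.
  - by rewrite !hom1 ge_min re /=; lra.
have : (n.-1 <= size B)%N.
  rewrite -(size_iota 1 n.-1) -(size_map (fun i => (code_prod g i)^-1%g)).
  apply: uniq_leq_size; last first.
    move=> h /mapP[i]; rewrite mem_iota => hi ->; apply: inB; move: hi Bn; clear; lia.
  rewrite map_inj_in_uniq ?iota_uniq // => i j; rewrite !mem_iota => hi hj /invg_inj e.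
  have neq a b : (a < b)%N -> b \in iota 1 n.-1 -> code_prod g a <> code_prod g b.
    rewrite mem_iota => ab hb; apply: (code_prod_neq hc).
    by move: ab hb nN; clear; lia.
  have [ij|ij|//] := ltngtP i j.
    by case: (neq i j) => //; rewrite mem_iota.
  by case: (neq j i) => //; rewrite mem_iota.
by move: Bn; clear; lia.
Qed.

(** Choose [l] at distance exactly [2 * s] from [y] at a fixed time of [g]. It is neither too far
    from [y] nor too near, so along [g'] it reaches distance [2 * s] in bounded time; just before,
    its distance lies between [k] and [2 * s]. Both group elements expand [y] and hold [l] at a
    controlled distance, as the hypothesis on [B0] asks. *)
Lemma codes_fellow_travel (B0 B : seq G) :
  (forall a a' x l, expands (rho0 a) x r0 c -> expands (rho0 a') x r0 c ->
    k <= cdist (rho0 a l) (rho0 a x) <= c1 -> k <= cdist (rho0 a' l) (rho0 a' x) <= c1 ->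
    (a' * a^-1)%g \in B0) ->
  exists N, forall b y g g', b \in B -> exp_code N y g -> exp_code N (rho0 b y) g' ->
    exists n m, [/\ (0 < n <= N)%N, (0 < m <= N)%N &
      (code_prod g' m * b * (code_prod g n)^-1)%g \in B0].
Proof.
have [[s0 s2c _ sh] [cr0 s2c1 k0 ks]] := consts; move=> hB0.
have s20 : 0 < 2 * s by lra.
have r00 : 0 < r0 by lra.
pose cont (b : G) (_ : b \in B) := @hom_continuous _ _ rho0 b.
pose contV (b : G) (_ : b \in B) := @hom_continuous _ _ rho0 b^-1%g.
have [r1 r10 hr1] := finitely_many_uniform contV r00.
have [N1 hN1] := code_shrink r10.
have [d1 d10 hd1] := code_prod_modulus F N1.+1 s20.
have [r2 r20 hr2] := finitely_many_uniform cont d10.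
have [N2 hN2] := code_shrink r20.
have [d3 d30 hd3] := code_prod_modulus F N2.+1 s20.
have [r3 r30 hr3] := finitely_many_uniform contV d30.
have [N3 hN3] := code_shrink r30.
pose N := (N1 + N2 + N3).+2; exists N => b y g g' bB hg hg'.
have gF i : (i < N)%N -> g i \in F by move=> /hg[].
have g'F i : (i < N)%N -> g' i \in F by move=> /hg'[].
have [|p hp] := @cdist_attains R (rho0 (code_prod g N2.+1) y) (2 * s).
  by apply/andP; split; lra.
pose l := rho0 (code_prod g N2.+1)^-1%g p.
have hl : cdist (rho0 (code_prod g N2.+1) l) (rho0 (code_prod g N2.+1) y) = 2 * s.
  by rewrite /l homVK.
have ly : cdist l y < r2.
  rewrite ltNge; apply/negP => /(hN2 N y g N2.+1 hg) h.
  by have := h ltac:(by rewrite /N; clear; lia); rewrite hl leNgt s2c.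
pose D m := cdist (rho0 (code_prod g' m) (rho0 b l)) (rho0 (code_prod g' m) (rho0 b y)).
have DN1 : D N1.+1 < 2 * s.
  apply: hd1; last by apply: hr2.
  by move=> i hi; apply: g'F; move: hi; rewrite /N; clear; lia.
have DN3 : 2 * s <= D (N3 + N1.+1)%N.
  apply: ltW; apply: lt_le_trans s2c _; rewrite /D.
  apply: (hN3 N _ _ _ hg'); first by rewrite /N; clear; lia.
  rewrite leNgt; apply/negP => /(hr3 b _ _ bB); rewrite !homK => h.
  have : 2 * s < 2 * s; last by rewrite ltxx.
  rewrite -{1}hl; apply: hd3 h => i hi; apply: gF; move: hi; rewrite /N; clear; lia.
have [m [mN Dm Dm1]] : exists m, [/\ (N1 < m < N3 + N1.+1)%N, D m < 2 * s & 2 * s <= D m.+1].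
  apply: contrapT => none.
  have : forall j, (j <= N3)%N -> D (N1.+1 + j)%N < 2 * s.
    elim=> [|j ih] jN; first by rewrite addn0.
    rewrite ltNge; apply/negP => big; apply: none; exists (N1.+1 + j)%N.
    split; [by move: jN; clear; lia|exact: ih (ltnW jN)|by rewrite addnS in big].
  by move=> /(_ N3 (leqnn _)); rewrite addnC ltNge DN3.
have kD : k <= D m.
  rewrite leNgt; apply/negP => /(F_modulus (a := g' m)) h.
  have := h ltac:(by apply: g'F; move: mN; rewrite /N; clear; lia).
  by move: Dm1; rewrite /D /= !homM leNgt => /negP.
exists N2.+1, m; split.
- by rewrite /N; clear; lia.
- by move: mN; rewrite /N; clear; lia.
apply: (hB0 _ _ y l).
- have h := @code_expands N y g N2.+1 hg ltac:(by rewrite /N; clear; lia).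
  by apply: expands_weak h; lra.
- move=> w rw; rewrite !homM; apply: (hN1 N _ _ _ hg').
    by move: mN; rewrite /N; clear; lia.
  rewrite leNgt; apply/negP => /(hr1 b _ _ bB); rewrite !homK.
  by rewrite ltNge rw.
- by rewrite hl ks s2c1.
- by move: kD Dm; rewrite /D !homM => -> /= h; lra.
Qed.

End Codes.

(** * Shadowing the orbits of a nearby action *)

Section Shadowing.
Variables (R : realType) (G : groupType) (rho0 : HomHomeo G (circle R)).
Local Notation X := (circle R).
Implicit Types (x y w : X) (g : nat -> G) (n m N : nat) (rho : HomHomeo G X).

Variables (F : seq G) (s c C r0 c1 k : R).
Hypothesis consts : [/\ 0 < s, 2 * s < c, 2 * c <= C & 2 * s <= 1 / 2] /\
  [/\ c <= r0, 2 * s <= c1, 0 < k & k <= 2 * s].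
Hypothesis F_modulus : forall a x y, a \in F -> cdist x y < k ->
  cdist (rho0 a x) (rho0 a y) < 2 * s.
Hypothesis F_expands : forall x, exists2 a, a \in F & expands (rho0 a) x s C.
Hypothesis proper : forall e : R, 0 < e -> exists B : seq G,
  forall a a' x l, expands (rho0 a) x r0 c -> expands (rho0 a') x r0 c ->
    e <= cdist (rho0 a l) (rho0 a x) <= c1 -> e <= cdist (rho0 a' l) (rho0 a' x) <= c1 ->
    (a' * a^-1)%g \in B.
Local Notation exp_code := (exp_code rho0 F s c).

(** The point moves under [rho], but the letters are chosen for the expansion of [rho0]. *)
Definition pseudo_code rho x g : Prop := forall i, g i \in F /\
  expands (rho0 (g i)) (rho (code_prod g i) x) s C.

Definition shadows rho x g y : Prop :=
  forall n, cdist (rho0 (code_prod g n) y) (rho (code_prod g n) x) <= s.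

Lemma pseudo_code_shift rho x g m :
  pseudo_code rho x g -> pseudo_code rho (rho (code_prod g m) x) (skip m g).
Proof. by move=> h i; have := h (m + i)%N; rewrite code_prodD homM. Qed.

Lemma shadows_shift rho x g y m : shadows rho x g y ->
  shadows rho (rho (code_prod g m) x) (skip m g) (rho0 (code_prod g m) y).
Proof. by move=> h i; have := h (m + i)%N; rewrite code_prodD !homM. Qed.

Lemma pseudo_code_ex rho x : exists g, pseudo_code rho x g.
Proof.
have [nxt hnxt] : {nxt : X -> G & forall x, nxt x \in F /\ expands (rho0 (nxt x)) x s C}.
  apply: (@choice _ _ (fun x a => a \in F /\ expands (rho0 a) x s C)) => z.
  by have [a aF ha] := F_expands z; exists a.
pose xs := fix xs i := if i is j.+1 then rho (nxt (xs j)) (xs j) else x.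
exists (fun i => nxt (xs i)) => i.
suff -> : rho (code_prod (fun i => nxt (xs i)) i) x = xs i by exact: hnxt.
by elim: i => [|i ih] /=; rewrite ?hom1 // homM ih.
Qed.

Lemma pseudo_orbit_close N (e : R) : 0 < e -> exists2 d, 0 < d & forall rho x x' g,
  hom_close F d rho0 rho -> (forall i, g i \in F) -> cdist x x' < d ->
  forall i, (i <= N)%N -> cdist (rho0 (code_prod g i) x) (rho (code_prod g i) x') < e.
Proof.
elim: N e => [|N ih] e e0.
  by exists e => // rho x x' g _ _ xx' i; rewrite leqn0 => /eqP -> /=; rewrite !hom1.
have e2 : 0 < e / 2 by lra.
have [t t0 ht] := hom_equicontinuous rho0 F e2.
have em0 : 0 < Num.min e t by rewrite lt_min e0.
have [d d0 hd] := ih _ em0; exists (Num.min d (e / 2)); first by rewrite lt_min d0.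
move=> rho x x' g close gF; rewrite lt_min => /andP[xx' _] i.
have close1 : hom_close F d rho0 rho.
  by move=> a z aF; have := close a z aF; rewrite lt_min => /andP[].
have h := hd rho x x' g close1 gF xx'.
rewrite leq_eqVlt => /predU1P[->|]; last first.
  by rewrite ltnS => /h; rewrite lt_min => /andP[].
have := h N (leqnn _); rewrite lt_min => /andP[_ /(ht (g N) _ _ (gF N)) h1].
have := close (g N) (rho (code_prod g N) x') (gF N); rewrite lt_min => /andP[_ h2].
rewrite /= !homM.
by apply: le_lt_trans (cdist_tri (rho0 (g N) (rho (code_prod g N) x')) _ _) _; lra.
Qed.

Section Perturbation.
Variables (rho : HomHomeo G X) (d : R).
Hypothesis ds : d <= s.
Hypothesis close : hom_close F d rho0 rho.

(** A distance of at least [s] at time [n] would grow beyond [C - d], which exceeds [2 * s]. *)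
Lemma pseudo_code_pull x g w n : pseudo_code rho x g ->
  cdist (rho0 (code_prod g n.+1) w) (rho (code_prod g n.+1) x) <= 2 * s ->
  cdist (rho0 (code_prod g n) w) (rho (code_prod g n) x) < s.
Proof.
have [[s0 s2c cC _] _] := consts; have ds' := ds.
move=> /(_ n)[gF ex] near; rewrite ltNge; apply/negP => /ex.
rewrite /= !homM in near.
have := close (rho (code_prod g n) x) gF.
set p := rho0 (g n) (rho0 _ w); set q := rho0 (g n) _; set r := rho (g n) _ => qr.
have := cdist_tri r p q; rewrite (cdistC r q) => h1 h2.
by move: near; rewrite -/p -/r => h3; lra.
Qed.

Lemma shadow_ex x g : pseudo_code rho x g -> exists y, shadows rho x g y.
Proof.
have [[s0 s2c cC _] _] := consts => hg.
apply: (@circle_nested R (fun n y =>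
  cdist (rho0 (code_prod g n) y) (rho (code_prod g n) x) <= s)).
- move=> n q /negP; rewrite -ltNge => far.
  have e0 : 0 < cdist (rho0 (code_prod g n) q) (rho (code_prod g n) x) - s by lra.
  have [e ep he] := (circle_continuousP _).1 (@hom_continuous _ _ rho0 (code_prod g n)) q _ e0.
  exists e => // q' /he qq'; apply/negP; rewrite -ltNge.
  have := cdist_tri (rho0 (code_prod g n) q') (rho0 (code_prod g n) q) (rho (code_prod g n) x).
  by lra.
- move=> n y h; apply/ltW/pseudo_code_pull => //; lra.
- by move=> n; exists (rho0 (code_prod g n)^-1%g (rho (code_prod g n) x));
     rewrite homVK cdistxx ltW.
Qed.

Lemma pseudo_code_code N x g y : pseudo_code rho x g ->
  (forall i, (i <= N)%N -> cdist (rho0 (code_prod g i) y) (rho (code_prod g i) x) <= s) ->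
  exp_code N y g.
Proof.
have [[s0 s2c cC _] _] := consts; have ds' := ds.
move=> hg near i iN; have [gF ex] := hg i; split=> // w far.
have n0 := near i (ltnW iN); have := near i.+1 iN; rewrite /= !homM => n1.
have /ex : s <= cdist w (rho (code_prod g i) x).
  have := cdist_tri (rho (code_prod g i) x) w (rho0 (code_prod g i) y).
  by rewrite (cdistC (rho _ x)); lra.
have := close (rho (code_prod g i) x) gF.
set p := rho0 (g i) w; set q := rho0 (g i) (rho _ x); set r := rho (g i) _ => qr pq.
set t := rho0 (g i) _; rewrite -/t -/r in n1.
have := cdist_tri t p q; have := cdist_tri r t q; rewrite (cdistC r q); lra.
Qed.

Lemma shadow_code N x g y : pseudo_code rho x g -> shadows rho x g y -> exp_code N y g.
Proof. by move=> hg hy; apply: (pseudo_code_code hg) => i _; exact: hy. Qed.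

Lemma shadow_unique x g y y' : pseudo_code rho x g ->
  shadows rho x g y -> shadows rho x g y' -> y = y'.
Proof.
have [[s0 s2c cC _] _] := consts; move=> hg hy hy'.
apply: contrapT => neq; have y'y : 0 < cdist y' y by apply: cdist_gt0 => e; apply: neq.
have [N hN] := code_shrink F consts proper y'y.
have NN : (N <= N <= N)%N by rewrite leqnn.
have := hN N y g N (shadow_code hg hy) NN y' (lexx _).
have := cdist_tri (rho (code_prod g N) x) (rho0 (code_prod g N) y') (rho0 (code_prod g N) y).
have := hy N; have := hy' N; rewrite (cdistC (rho _ _)); lra.
Qed.

(** Closeness at one late time pulls back to all earlier times, which allows comparing codes that
    meet only now and then. *)
Lemma shadow_from_often x g y : pseudo_code rho x g ->
  (forall n, exists2 m, (n <= m)%N &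
    cdist (rho0 (code_prod g m) y) (rho (code_prod g m) x) <= 2 * s) ->
  shadows rho x g y.
Proof.
have [[s0 _ _ _] _] := consts; move=> hg often n.
have [m nm hm] := often n.+1; rewrite -(subnK (ltnW nm)) in hm.
have [j mj] : exists j, (m - n = j.+1)%N.
  by exists (m - n).-1; rewrite prednK // subn_gt0.
rewrite mj in hm; elim: (j) hm => [|j' ih] hm; first exact/ltW/pseudo_code_pull.
by apply: ih; have := pseudo_code_pull hg hm; lra.
Qed.

End Perturbation.

(** Restart at time [n], from [z = rho (code_prod g n) x]. For [N] more steps its orbits under
    [rho0] and [rho] stay close, so the tail of the code is an expanding code of [z]. A shadow
    [a]-far from [z] would be [c]-far from its orbit [N] steps later. *)
Lemma shadow_accuracy (a : R) : 0 < a -> exists2 d, 0 < d & forall rho,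
  hom_close F d rho0 rho -> forall x g y, pseudo_code rho x g -> shadows rho x g y ->
  forall n, cdist (rho0 (code_prod g n) y) (rho (code_prod g n) x) < a.
Proof.
have [[s0 s2c cC _] _] := consts; move=> a0.
have [N hN] := code_shrink F consts proper a0.
have [d d0 hd] := pseudo_orbit_close N s0.
exists (Num.min d s) => [|rho close x g y hg hy n]; first by rewrite lt_min d0.
have closed : hom_close F d rho0 rho.
  by move=> b z bF; have := close b z bF; rewrite lt_min => /andP[].
have hgn := pseudo_code_shift n hg; have hyn := shadows_shift n hy.
set z := rho (code_prod g n) x in hgn hyn *.
have gF i : skip n g i \in F by have [] := hgn i.
have horbit i : (i <= N)%N -> cdist (rho0 (code_prod (skip n g) i) z)
    (rho (code_prod (skip n g) i) z) <= s.
  by move=> iN; apply/ltW/hd => //; rewrite cdistxx.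
have ds : Num.min d s <= s by rewrite ge_min lexx orbT.
have hc : exp_code N z (skip n g) := pseudo_code_code ds close hgn horbit.
have NN : (N <= N <= N)%N by rewrite leqnn.
rewrite ltNge; apply/negP => /(hN _ _ _ _ hc NN).
have := horbit N (leqnn _); have := hyn N.
set p := rho0 _ (rho0 _ y); set q := rho _ z; set r := rho0 _ z => pq rq.
by have := cdist_tri q p r; rewrite (cdistC q r); lra.
Qed.

(** Iterated fellow travelling gives arbitrarily late times where [g'] after [b] equals some [b'] of
    the finite set [B] after [g]. There the orbit of [rho0 b y] is near that of [rho b x], since
    [rho] is close to [rho0] on [B]. Hence [rho0 b y] is a shadow too, and shadows are unique. *)
Lemma shadow_equivariant (T : seq G) : exists2 d, 0 < d & exists L : seq G,
  forall rho, hom_close L d rho0 rho -> hom_close F d rho0 rho /\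
  forall x g y b g' y', b \in T ->
    pseudo_code rho x g -> shadows rho x g y ->
    pseudo_code rho (rho b x) g' -> shadows rho (rho b x) g' y' -> y' = rho0 b y.
Proof.
have [[s0 s2c cC _] [_ _ k0 _]] := consts.
have [B0 hB0] := proper k0; pose B := T ++ B0.
have [N hN] := codes_fellow_travel consts F_modulus proper B hB0.
have [d1 d10 hd1] := pseudo_orbit_close N s0.
have [a a0 ha] := hom_equicontinuous rho0 B s0.
have [d2 d20 hd2] := shadow_accuracy a0.
pose d := Num.min (Num.min d1 d2) s.
have dd1 : d <= d1 by rewrite /d !ge_min lexx.
have dd2 : d <= d2 by rewrite /d !ge_min lexx orbT.
have ds : d <= s by rewrite /d ge_min lexx orbT.
exists d; first by rewrite !lt_min d10 d20.
exists (F ++ B) => rho close.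
have weak L' d' : {subset L' <= F ++ B} -> d <= d' -> hom_close L' d' rho0 rho.
  by move=> sub dd' b z /sub bL; apply: lt_le_trans dd'; exact: close.
have FL : {subset F <= F ++ B} by move=> b bF; rewrite mem_cat bF.
have closeF := weak F d FL (lexx _).
split=> // x g y b g' y' bT hg hy hg' hy'.
apply: (shadow_unique ds closeF hg' hy').
apply: (shadow_from_often ds closeF hg').
have step n m b1 : b1 \in B -> (code_prod g' m * b = b1 * code_prod g n)%g ->
    exists n' m' b', [/\ b' \in B, (m < m')%N &
      (code_prod g' m' * b = b' * code_prod g n')%g].
  move=> b1B eq1; set z := rho (code_prod g n) x.
  have hgn : pseudo_code rho z (skip n g) := pseudo_code_shift n hg.
  have hgm : pseudo_code rho (rho b1 z) (skip m g').
    have := pseudo_code_shift m hg'; rewrite -homM eq1 homM; exact.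
  have orbit u u' f : pseudo_code rho u' f -> cdist u u' < d1 -> exp_code N u f.
    move=> hf uu'; apply: (pseudo_code_code ds closeF hf) => i iN.
    apply/ltW; apply: hd1 uu' _ iN; first exact: weak.
    by move=> j; have [] := hf j.
  have c1' : exp_code N z (skip n g) by apply: orbit hgn _; rewrite cdistxx.
  have c2' : exp_code N (rho0 b1 z) (skip m g').
    apply: orbit hgm _; apply: lt_le_trans dd1; apply: close.
    by rewrite mem_cat b1B orbT.
  have [n' [m' [_ /andP[m'0 _] hB]]] := hN b1 z _ _ b1B c1' c2'.
  exists (n + n')%N, (m + m')%N,
    (code_prod (skip m g') m' * b1 * (code_prod (skip n g) n')^-1)%g.
  split; [|by rewrite -{1}(addn0 m) ltn_add2l|].
    by rewrite mem_cat hB orbT.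
  by rewrite !code_prodD -!mulgA eq1 mulKg !mulgA.
have often M : exists n m b', [/\ b' \in B, (M <= m)%N &
    (code_prod g' m * b = b' * code_prod g n)%g].
  elim: M => [|M [n [m [b1 [b1B Mm /step[//|n' [m' [b' [b'B mm' e]]]]]]]]].
    by exists 0%N, 0%N, b; rewrite mul1g mulg1 mem_cat bT.
  by exists n', m', b'; split=> //; apply: leq_ltn_trans mm'.
move=> M; have [n [m [b' [b'B Mm e]]]] := often M; exists m => //.
rewrite -!homM e !homM.
have h1 : cdist (rho0 (code_prod g n) y) (rho (code_prod g n) x) < a.
  by apply: (hd2 rho _ x g y hg hy n); exact: weak.
have := ha b' _ _ b'B h1.
have := close b' (rho (code_prod g n) x) _; rewrite mem_cat b'B orbT => /(_ isT).
set p := rho0 b' (rho0 _ _); set q := rho0 b' _; set r := rho b' _ => qr pq.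
by have := cdist_tri q p r; lra.
Qed.

End Shadowing.

(** * Stability of expanding actions *)

Section Stability.
Variables (R : realType) (G : groupType) (S : genset G) (rho0 : HomHomeo G (circle R)).
Local Notation X := (circle R).
Local Notation pi := (@circle_proj R).
Hypothesis rho0_expanding : expanding rho0.
Hypothesis rho0_proper : proper_expansion rho0.
Implicit Types (p q y : X).

Lemma shadowing_constants : exists (F : seq G) (s c C r0 c1 k : R),
  [/\ [/\ 0 < s, 2 * s < c, 2 * c <= C & 2 * s <= 1 / 2] /\
      [/\ c <= r0, 2 * s <= c1, 0 < k & k <= 2 * s],
   forall a p q, a \in F -> cdist p q < k -> cdist (rho0 a p) (rho0 a q) < 2 * s,
   forall p, exists2 a, a \in F & expands (rho0 a) p s C &
   forall e : R, 0 < e -> exists B : seq G,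
     forall a a' p l, expands (rho0 a) p r0 c -> expands (rho0 a') p r0 c ->
     e <= cdist (rho0 a l) (rho0 a p) <= c1 -> e <= cdist (rho0 a' l) (rho0 a' p) <= c1 ->
     (a' * a^-1)%g \in B].
Proof.
have [C C0 hC] := rho0_expanding; have [r0 r00 hr0] := rho0_proper.
pose c := Num.min (C / 2) r0.
have c0 : 0 < c by rewrite lt_min r00 andbT; lra.
have cC : 2 * c <= C.
  have : c <= C / 2 by rewrite ge_min lexx.
  by lra.
(* [c1] depends on [c], and [s] on both; the quantifiers of [proper_expansion] follow this order. *)
have [c1 c10 hc1] := hr0 c c0.
pose s := Num.min (Num.min (c / 4) (c1 / 2)) (1 / 4).
have s0 : 0 < s by rewrite !lt_min; apply/andP; split; [apply/andP; split|]; lra.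
have sc : s <= c / 4 by rewrite !ge_min lexx.
have sc1 : s <= c1 / 2 by rewrite !ge_min lexx orbT.
have s4 : s <= 1 / 4 by rewrite !ge_min lexx !orbT.
have [F hF] := hC s s0.
have s20 : 0 < 2 * s by lra.
have [k k0 hk] := hom_equicontinuous rho0 F s20.
exists F, s, c, C, r0, c1, (Num.min k (2 * s)); split=> //.
- split; split=> //; try lra; first by rewrite ge_min lexx orbT.
    by rewrite lt_min k0.
  by rewrite ge_min lexx orbT.
- by move=> a p q aF; rewrite lt_min => /andP[pq _]; exact: hk.
Qed.

(** [rho0] is regarded as a perturbation of itself: [y] shadows its own code, and [code_shrink]
    separates every other point from it. *)
Lemma expansive_codes : exists (F : seq G) (e0 : R), 0 < e0 /\
  forall y, exists2 g : nat -> G, (forall i, g i \in F) &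
    forall y', y' <> y -> exists n,
      e0 <= cdist (rho0 (code_prod g n) y') (rho0 (code_prod g n) y).
Proof.
have [F [s [c [C [r0 [c1 [k [consts Fm Fe pr]]]]]]]] := shadowing_constants.
have [[s0 s2c _ _] _] := consts.
exists F, c; split; first by lra.
move=> y; have [g hg] := pseudo_code_ex Fe rho0 y.
exists g => [i|y' y'y]; first by have [] := hg i.
have close : hom_close F s rho0 rho0 by move=> b z _; rewrite cdistxx.
have hy : shadows rho0 s rho0 y g y by move=> n; rewrite cdistxx ltW.
have [N hN] := code_shrink F consts pr (cdist_gt0 y'y).
have NN : (N <= N <= N)%N by rewrite leqnn.
exists N; apply: (hN N y g N) => //.
exact: (shadow_code consts (lexx _) close hg hy).
Qed.

(** [h x] is the shadow of a pseudo-code of [x]. Its equivariance is obtained for the finitely many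
    generators and extends to the group along words. *)
Lemma stable_equivariant_map (a : R) : 0 < a -> exists L : seq G, exists2 d, 0 < d &
  forall rho, hom_close L d rho0 rho -> exists h : X -> X,
    (forall g x, h (rho g x) = rho0 g (h x)) /\ forall x, cdist (h x) x < a.
Proof.
move=> a0; have [F [s [c [C [r0 [c1 [k [consts Fm Fe pr]]]]]]]] := shadowing_constants.
have [d1 d10 [L hL]] := shadow_equivariant consts Fm pr (1%g :: (S : seq G)).
have [d2 d20 hd2] := shadow_accuracy F consts pr a0.
have [[s0 _ _ _] _] := consts.
exists (L ++ F), (Num.min (Num.min d1 d2) s); first by rewrite !lt_min d10 d20.
move=> rho close.
have closeL : hom_close L d1 rho0 rho.
  by move=> g x gL; have := close g x; rewrite mem_cat gL !lt_min => /(_ isT) /andP[/andP[]].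
have closeF d' : Num.min (Num.min d1 d2) s <= d' -> hom_close F d' rho0 rho.
  move=> dd' g x gF; apply: lt_le_trans dd'; apply: close.
  by rewrite mem_cat gF orbT.
have [_ equiv] := hL rho closeL.
have closeFs : hom_close F s rho0 rho by apply: closeF; rewrite ge_min lexx orbT.
have sh x : exists y, exists g, pseudo_code rho0 F s C rho x g /\ shadows rho0 s rho x g y.
  have [g hg] := pseudo_code_ex Fe rho x.
  by have [y hy] := shadow_ex consts (lexx _) closeFs hg; exists y, g.
have [h hh] := choice sh; exists h.
have hS g x : g \in (S : seq G) -> h (rho g x) = rho0 g (h x).
  move=> gS; have [f [hf fx]] := hh x; have [f' [hf' fx']] := hh (rho g x).
  by apply: (equiv x f _ g f') => //; rewrite inE gS orbT.
split=> [g x|x].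
  have [w Sw ->] := gensP S g.
  elim: w Sw x => [|b w ih] Sw x; first by rewrite big_nil !hom1.
  move: Sw => /= /andP[bS Sw]; rewrite big_cons !homM.
  case/orP: bS => bS; first by rewrite hS // ih.
  by rewrite -(homK rho0 b^-1%g (h _)) -hS // invgK homK ih.
have [g [hg hy]] := hh x.
have := hd2 rho (closeF d2 _) x g (h x) hg hy 0%N.
by rewrite /= !hom1; apply; rewrite !ge_min lexx orbT.
Qed.

End Stability.

(** * Continuity and monotonicity of the shadowing map *)

Section NearIdentity.
Variable R : realType.
Local Notation X := (circle R).
Local Notation pi := (@circle_proj R).

Lemma circle_proj_inj_near (x y : R) : pi x = pi y -> `|x - y| < 1 -> x = y.
Proof.
move=> /circle_proj_eq[n ->]; rewrite [y + _]addrC addrK.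
have [->|n0] := eqVneq n 0; first by rewrite add0r.
by rewrite ltNge norm_intr_ge1 ?intr_int // intr_eq0.
Qed.

Lemma lift_near_ex (f : R -> X) (Q : R -> R) : {t : R -> R &
  forall x, pi (t x) = f x /\ `|Q x - t x| = cdist (pi (Q x)) (f x)}.
Proof.
apply: (@choice _ _ (fun x t => pi t = f x /\ `|Q x - t| = cdist (pi (Q x)) (f x))).
by move=> x; have [t ht tQ] := cdist_lift (Q x) (f x); exists t.
Qed.

(* The image of a short arc under an injective map is an arc with the same
   endpoints; if it stays near q it cannot go further from q than they do. *)
Lemma short_arc_image (f : X -> X) (a b e : R) (q : X) : continuous f -> injective f ->
  b - a < 1 -> (forall x, a <= x <= b -> cdist (f (pi x)) q < 1 / 4) ->
  cdist (f (pi a)) q < e -> cdist (f (pi b)) q < e ->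
  forall x, a <= x <= b -> cdist (f (pi x)) q < e.
Proof.
move=> fc finj ab1; have [Q <-] := circle_proj_surj q => fq.
have [t tP] := lift_near_ex (fun x => f (pi x)) (fun=> Q).
have tQ x : `|t x - Q| = cdist (f (pi x)) (pi Q).
  by rewrite distrC (tP x).2 cdistC.
move=> ha hb x xab; rewrite -!tQ in ha hb *.
have tclose u v : a <= u <= b -> a <= v <= b ->
    `|t u - t v| = cdist (f (pi u)) (f (pi v)).
  move=> /fq hu /fq hv; rewrite -!tQ in hu hv.
  rewrite -(tP u).1 -(tP v).1 cdist_proj //.
  have := ler_normB (t u - Q) (t v - Q).
  by rewrite (_ : t u - Q - (t v - Q) = t u - t v); [lra|ring].
have tinj u v : a <= u <= b -> a <= v <= b -> t u = t v -> u = v.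
  move=> hu hv tuv; have : f (pi u) = f (pi v) by rewrite -(tP u).1 -(tP v).1 tuv.
  move=> /finj/circle_proj_inj_near; apply.
  by rewrite ltr_norml; lra.
have tcts : {within `[a, b], continuous t}.
  apply/subspace_continuousP => w /=; rewrite in_itv /= => awb.
  apply/cvgrPdist_lt => d d0.
  have [d' d'0 hd'] := circle_uniform_continuity fc d0.
  rewrite /prop_near1 /within /=; apply/nbhs_ballP; exists d' => //= w' ww'.
  rewrite in_itv /= => aw'b; rewrite tclose //.
  by apply: hd'; apply: le_lt_trans (cdist_proj_le _ _) _.
have tinj' : {in `[a, b]%R &, injective t}.
  by move=> u v; rewrite !in_itv /=; exact: tinj.
have ab : a <= b by lra.
have [ain bin xin] : [/\ a \in `[a, b]%R, b \in `[a, b]%R & x \in `[a, b]%R].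
  by rewrite !in_itv /= !lexx ab.
have mono : t a <= t x <= t b \/ t b <= t x <= t a.
  have [tab|/ltW tab] := leP (t a) (t b).
    by left; rewrite !(segment_continuous_inj_le tab tcts tinj').
  by right; rewrite !(segment_continuous_inj_ge tab tcts tinj') // andbC.
rewrite ltr_norml; move: ha hb; rewrite !ltr_norml => /andP[a1 a2] /andP[b1 b2].
by case: mono => /andP[m1 m2]; apply/andP; split; lra.
Qed.

End NearIdentity.

Section StableSemiConjugacy.
Variables (R : realType) (G : groupType) (S : genset G) (rho0 : HomHomeo G (circle R)).
Local Notation X := (circle R).
Local Notation pi := (@circle_proj R).
Hypothesis rho0_expanding : expanding rho0.
Hypothesis rho0_proper : proper_expansion rho0.

(* The graph of h is { (x, y) | rho g x is a-close to rho0 g y for all g }, by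
   expansivity; it is closed. *)
Lemma near_equivariant_continuous (rho : HomHomeo G X) (h : X -> X) (a e0 : R) :
  2 * a < e0 ->
  (forall y y', y' <> y -> exists g, e0 <= cdist (rho0 g y') (rho0 g y)) ->
  (forall g x, h (rho g x) = rho0 g (h x)) -> (forall x, cdist (h x) x < a) ->
  continuous h.
Proof.
move=> ae expd heq ha; apply/circle_continuousP => p e epos.
pose P (d : R) q := forall x, cdist p x < d -> cdist (h x) q < d -> cdist (h p) (h x) < e.
have [d d0 hd] : exists2 d, 0 < d & forall q, P d q.
  apply: (@circle_uniformly R P).
    move=> q d d' dd' hq x px hx; apply: hq; exact: lt_le_trans dd'.
  move=> q0; have [near|far] := ltP (cdist (h p) q0) (e / 2).
    exists (e / 4) => [|q qq0 x px hx]; first by lra.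
    have := cdist_tri q (h x) q0; have := cdist_tri q0 (h p) (h x).
    by rewrite (cdistC q0 (h x)) (cdistC q q0); lra.
  have /expd[g hg] : q0 <> h p by move=> q0p; move: far; rewrite q0p cdistxx; lra.
  pose n := (e0 - 2 * a) / 4; have n0 : 0 < n by rewrite /n; lra.
  have [d1 d10 hd1] := (circle_continuousP _).1 (@hom_continuous _ _ rho0 g) q0 _ n0.
  have [d2 d20 hd2] := (circle_continuousP _).1 (@hom_continuous _ _ rho g) p _ n0.
  exists (Num.min (d1 / 2) d2); first by rewrite lt_min d20 andbT; lra.
  move=> q; rewrite lt_min => /andP[qq0 _] x; rewrite !lt_min => /andP[_ /hd2 px] /andP[hx _].
  have /hd1 qx : cdist q0 (h x) < d1.
    by apply: le_lt_trans (cdist_tri q _ _) _; rewrite (cdistC q (h x)); lra.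
  have h1 := ha (rho g x); have h2 := ha (rho g p); rewrite !heq in h1 h2.
  have t1 := cdist_tri (rho0 g (h x)) (rho0 g q0) (rho0 g (h p)).
  have t2 := cdist_tri (rho g x) (rho0 g (h x)) (rho0 g (h p)).
  have t3 := cdist_tri (rho g p) (rho g x) (rho0 g (h p)).
  rewrite (cdistC (rho g x) (rho g p)) (cdistC (rho g p) (rho0 g (h p))) in t3.
  by move: qx px n0; rewrite /n; lra.
exists d => // x px; apply: (hd (h x) x px); by rewrite cdistxx.
Qed.

Lemma near_identity_lift (h : X -> X) (a : R) : continuous h -> a <= 1 / 8 ->
  (forall x, cdist (h x) x < a) -> exists t : R -> R,
  [/\ is_lift_of t h, forall x, t (x + 1) = t x + 1 & forall x, `|t x - x| < a].
Proof.
move=> hc a8 ha; have [t tP] := lift_near_ex (fun x => h (pi x)) id.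
have tx x : `|t x - x| < a by rewrite distrC (tP x).2 cdistC.
have dbl x y : `|t x - t y| < `|x - y| + 2 * a.
  have := tx x; have := tx y.
  have := ler_normD (t x - x + (x - y)) (y - t y).
  have := ler_normD (t x - x) (x - y); rewrite (distrC y (t y)).
  rewrite (_ : t x - x + (x - y) + (y - t y) = t x - t y); last by ring.
  by lra.
exists t; split => //; last first.
  move=> x; apply: circle_proj_inj_near.
    have e1 : pi (x + 1) = pi x by have := circle_proj_int x 1.
    have e2 : pi (t x + 1) = pi (t x) by have := circle_proj_int (t x) 1.
    by rewrite e2 (tP (x + 1)).1 (tP x).1 e1.
  have := tx (x + 1); have := tx x.
  rewrite !ltr_norml => /andP[h1 h2] /andP[h3 h4]; apply/andP; split; lra.
split; last by move=> x; exact: (tP x).1.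
move=> x; apply/cvgrPdist_lt => e e0.
have [d d0 hd] := circle_uniform_continuity hc e0.
apply/nbhs_ballP; exists (Num.min d (1 / 4)); first by rewrite /= lt_min d0; lra.
move=> y; rewrite /ball /= lt_min => /andP[xy xy4].
rewrite -cdist_proj; last by have := dbl x y; lra.
rewrite (tP x).1 (tP y).1; apply: hd.
exact: le_lt_trans (cdist_proj_le _ _) _.
Qed.

Lemma degree_one_surjective (h : X -> X) (t : R -> R) : is_lift_of t h ->
  (exists M : R, forall x, `|t x - x| <= M) -> range h = setT.
Proof.
move=> [tc th] [M tM]; apply/seteqP; split=> // q _.
have [y <-] := circle_proj_surj q.
have M0 : 0 <= M by apply: le_trans (normr_ge0 _) (tM 0).
have yM : y - M <= y + M by lra.
have := tM (y - M); have := tM (y + M).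
rewrite !ler_norml => /andP[h1 h2] /andP[h3 h4].
have [||x _ tx] := @IVT R t (y - M) (y + M) y yM.
- exact: continuous_subspaceT.
- by rewrite ge_min le_max; apply/andP; split; apply/orP; [left|right]; lra.
by exists (pi x) => //; rewrite -th tx.
Qed.

(** Along a code, the arc from [x0] to [x2] stays near the orbit of [y]: its ends do because [h]
    sends them to [y], the inside by [short_arc_image]. Expansivity of the code then gives [h = y]
    on the arc. Following a code means that each step is a letter of the finite set [F], for which
    the bound 1/4 that [short_arc_image] requires is available. *)
Lemma stable_fibre_connected (rho : HomHomeo G X) (h : X -> X) (t : R -> R)
    (a e0 : R) (F : seq G) :
  a <= 1 / 8 -> 2 * a < e0 ->
  (forall g p q, g \in F -> cdist p q < a -> cdist (rho0 g p) (rho0 g q) < 1 / 8) ->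
  (forall y, exists2 g : nat -> G, (forall i, g i \in F) &
    forall y', y' <> y -> exists n,
      e0 <= cdist (rho0 (code_prod g n) y') (rho0 (code_prod g n) y)) ->
  hom_close F (1 / 8) rho0 rho ->
  (forall g x, h (rho g x) = rho0 g (h x)) -> (forall x, cdist (h x) x < a) ->
  (forall x, pi (t x) = h (pi x)) -> (forall x, `|t x - x| < a) ->
  forall x0 x1 x2, x0 <= x1 <= x2 -> t x0 = t x2 -> t x1 = t x0.
Proof.
move=> a8 ae Fm codes close heq ha tP tx x0 x1 x2 x012 t02.
set y := pi (t x0); have [g gF gexp] := codes y.
have small : x2 - x0 < 1.
  have := tx x0; have := tx x2; rewrite -t02 !ltr_norml => /andP[? ?] /andP[? ?]; lra.
have key n : forall x, x0 <= x <= x2 ->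
    cdist (rho (code_prod g n) (pi x)) (rho0 (code_prod g n) y) < a.
  have ends n' x : t x = t x0 ->
      cdist (rho (code_prod g n') (pi x)) (rho0 (code_prod g n') y) < a.
    by move=> e; have := ha (rho (code_prod g n') (pi x)); rewrite heq -tP e cdistC.
  elim: n => [|n ih] x hx.
    rewrite /= !hom1 cdistC; apply: le_lt_trans (cdist_proj_le _ _) _.
    have := tx x0; have := tx x2; rewrite -t02 !ltr_norml => /andP[? ?] /andP[? ?].
    by apply/andP; split; lra.
  apply: (@short_arc_image R (rho (code_prod g n.+1)) x0 x2 a) => //.
  - exact: hom_continuous.
  - exact: (can_inj (homK rho _)).
  - move=> z hz; rewrite /= !homM.
    have h1 := Fm (g n) _ _ (gF n) (ih z hz).
    have h2 := close (g n) (rho (code_prod g n) (pi z)) (gF n).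
    set p := rho (g n) _ in h2 *; set q := rho0 (g n) (rho _ _) in h1 h2.
    by apply: le_lt_trans (cdist_tri q _ _) _; rewrite (cdistC p q); lra.
  - exact: ends.
  - exact: ends.
have hx1 : h (pi x1) = y.
  apply: contrapT => /gexp[n]; rewrite leNgt => /negP; apply.
  have h1 := ha (rho (code_prod g n) (pi x1)); rewrite heq in h1.
  have h2 := key n x1 x012.
  by apply: le_lt_trans (cdist_tri (rho (code_prod g n) (pi x1)) _ _) _; lra.
apply: circle_proj_inj_near; first by rewrite tP.
have := tx x0; have := tx x2; have := tx x1; rewrite -t02 !ltr_norml.
by move=> /andP[? ?] /andP[? ?] /andP[? ?]; apply/andP; split; lra.
Qed.

Lemma expanding_stable : exists L : seq G, exists2 d : R, 0 < d &
  forall rho, hom_close L d rho0 rho -> semi_conjugate rho rho0.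
Proof.
have [F [e0 [e00 codes]]] := expansive_codes rho0_expanding rho0_proper.
have p8 : 0 < 1 / 8 :> R by lra.
have [m m0 hm] := hom_equicontinuous rho0 F p8.
pose a := Num.min (Num.min (1 / 8) m) (e0 / 4).
have a0 : 0 < a by rewrite !lt_min p8 m0 /=; lra.
have a8 : a <= 1 / 8 by rewrite !ge_min lexx.
have am : a <= m by rewrite !ge_min lexx orbT.
have ae : 2 * a < e0.
  have : a <= e0 / 4 by rewrite ge_min lexx orbT.
  by lra.
have [L [d d0 hL]] := stable_equivariant_map S rho0_expanding rho0_proper a0.
exists (L ++ F), (Num.min d (1 / 8)); first by rewrite lt_min d0.
move=> rho close; have closeF : hom_close F (1 / 8) rho0 rho.
  by move=> g x gF; have := close g x; rewrite mem_cat gF orbT lt_min => /(_ isT)/andP[].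
have [|h [heq ha]] := hL rho.
  by move=> g x gL; have := close g x; rewrite mem_cat gL lt_min => /(_ isT)/andP[].
have hc : continuous h.
  apply: (near_equivariant_continuous ae _ heq ha) => y y' y'y.
  by have [g _ /(_ _ y'y)[n hn]] := codes y; exists (code_prod g n).
have [t [tlift t1 tx]] := near_identity_lift hc a8 ha.
exists h; split=> //.
  by apply: (degree_one_surjective tlift); exists a => x; exact/ltW.
exists t; split=> //.
have fib := stable_fibre_connected a8 ae _ codes closeF heq ha tlift.2 tx.
(* If [t y < t x], the value [t y] is also taken at some [x0 <= x]; constancy between [x0] and [y]
   gives [t x = t y]. *)
move=> x y; rewrite le_eqVlt => /predU1P[->//|xy].
rewrite leNgt; apply/negP => yx.
have tx1 : t (x - 1) = t x - 1 by rewrite -{2}(subrK 1 x) t1 addrK.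
have xy2 : t x - 1 <= t y.
  have := tx x; have := tx y; rewrite !ltr_norml => /andP[? ?] /andP[? ?]; lra.
have x1x : x - 1 <= x by lra.
have [||x0] := @IVT R t (x - 1) x (t y) x1x.
- by apply: continuous_subspaceT; case: tlift.
- by rewrite ge_min le_max tx1 xy2 (ltW yx) orbT.
rewrite in_itv /= => /andP[_ x0x] tx0.
suff : t x = t x0 by move=> e; move: yx; rewrite e tx0 ltxx.
apply: (fib _ x0 x y) => //; last by rewrite x0x ltW.
by move=> g p q gF pq; apply: hm => //; apply: lt_le_trans am.
Qed.

End StableSemiConjugacy.

(** * Deformation along a semi-conjugacy *)

Section ConjugateHom.
Variables (R : realType) (G : groupType).
Local Notation X := (circle R).
Variables (k : homeo X X) (rho : HomHomeo G X).

Definition hom_conj_fun (g : G) : Homeo_group X := homeo_conj k (rho g).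

Lemma hom_conj_morph : {morph hom_conj_fun : g h / (g * h)%g}.
Proof. by move=> g h; apply: homeoP => x /=; rewrite homM homeoK. Qed.

HB.instance Definition _ :=
  isMultiplicative.Build _ _ hom_conj_fun hom_conj_morph.

Definition hom_conj : HomHomeo G X :=
  (hom_conj_fun : {multiplicative G -> Homeo_group X}).

Lemma hom_conjE g x : hom_conj g x = k (rho g (homeo_inv k x)).
Proof. by []. Qed.

End ConjugateHom.

Section DegreeOne.
Variable R : realType.
Local Notation X := (circle R).
Local Notation pi := (@circle_proj R).
Implicit Types (t : R -> R) (x y : R).

Lemma degree_one_int t : (forall x, t (x + 1) = t x + 1) ->
  forall x (n : int), t (x + n%:~R) = t x + n%:~R.
Proof.
move=> t1; have tn x (n : nat) : t (x + n%:R) = t x + n%:R.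
  by elim: n => [|n ih]; rewrite ?addr0 // -natr1 !addrA t1 ih.
move=> x [n|n]; first exact: tn.
rewrite NegzE intrN; have := tn (x - n.+1%:~R) n.+1.
by rewrite subrK => ->; rewrite addrK.
Qed.

Lemma degree_one_bounded t : {homo t : x y / x <= y} -> (forall x, t (x + 1) = t x + 1) ->
  forall x, `|t x - x| <= `|t 0| + 1.
Proof.
move=> tmono t1 x; have /andP[lo hi] := floor_itv x.
have := tmono _ _ lo; have := tmono _ _ (ltW hi).
have tn := degree_one_int t1; rewrite -(add0r (_ + 1)%:~R) -(add0r (Num.floor x)%:~R) !tn.
rewrite intrD in hi *; have := ler_norm (t 0); have := ler_norm (- t 0).
by rewrite normrN ler_norml => *; apply/andP; split; lra.
Qed.

Lemma circle_lift_continuous (h : X -> X) t :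
  continuous t -> (forall x, pi (t x) = h (pi x)) -> continuous h.
Proof.
move=> tc th; apply/continuousP => A oA; rewrite circle_openE.
have -> : pi @^-1` (h @^-1` A) = (pi \o t) @^-1` A.
  by apply/funext => x /=; rewrite th.
have /continuousP ptc : continuous (pi \o t); last exact: ptc.
by move=> x; apply: continuous_comp; [exact: tc|exact: circle_proj_continuous].
Qed.

Lemma degree_one_factor t : (forall x, t (x + 1) = t x + 1) ->
  forall x, pi (t (repr (pi x))) = pi (t x).
Proof.
move=> t1 x; have [n ->] : exists n : int, repr (pi x) = x + n%:~R.
  by apply: circle_proj_eq; rewrite /circle_proj reprK.
by rewrite degree_one_int // circle_proj_int.
Qed.

Lemma degree_one_homeo t (l : R) : 0 < l -> continuous t ->
  (forall x, t (x + 1) = t x + 1) -> (forall x y, x <= y -> l * (y - x) <= t y - t x) ->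
  exists k : homeo X X, forall x, k (pi x) = pi (t x).
Proof.
move=> l0 tc t1 tl.
have surj y : exists x, t x = y.
  have /andP[lo hi] := floor_itv (y - t 0); set n := Num.floor _ in lo hi.
  rewrite intrD in hi; have tn := degree_one_int t1 0 n; rewrite add0r in tn.
  have n1 : (n%:~R : R) <= n%:~R + 1 by lra.
  have [||x _ tx] := @IVT R t n%:~R (n%:~R + 1) y n1.
  - exact: continuous_subspaceT.
  - rewrite ge_min le_max t1 tn.
    by apply/andP; split; apply/orP; [left|right]; lra.
  by exists x.
have [u tu] := choice surj.
have ut x : u (t x) = x.
  have [xy|yx] := leP x (u (t x)); apply/eqP.
    have := tl _ _ xy; rewrite tu subrr pmulr_rle0 // subr_le0 => yx.
    by rewrite eq_le yx.
  have := tl _ _ (ltW yx); rewrite tu subrr pmulr_rle0 // subr_le0 => xy.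
  by rewrite eq_le xy ltW.
have u1 x : u (x + 1) = u x + 1 by rewrite -[x in LHS]tu -t1 ut.
have ul x y : x <= y -> `|u x - u y| <= l^-1 * `|x - y|.
  move=> xy; rewrite ler_pdivlMl //; have [uxy|uyx] := leP (u x) (u y).
    by rewrite (distrC (u x)) (distrC x) !ger0_norm ?subr_ge0 // -{2}(tu y) -{2}(tu x) tl.
  have := tl _ _ (ltW uyx); rewrite !tu => h.
  have : 0 < l * (u x - u y) by rewrite mulr_gt0 ?subr_gt0.
  by lra.
have uc : continuous u.
  move=> x; apply/cvgrPdist_lt => e e0.
  apply/nbhs_ballP; exists (l * e); first by rewrite /= mulr_gt0.
  move=> y; rewrite /ball /= => xy.
  have h : `|u x - u y| <= l^-1 * `|x - y|.
    have [|/ltW yx] := leP x y; first exact: ul.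
    by rewrite distrC [X in _ * X]distrC ul.
  by apply: le_lt_trans h _; rewrite ltr_pdivrMl.
have kc : continuous (fun p : X => pi (t (repr p))).
  by apply: (circle_lift_continuous tc) => x; rewrite degree_one_factor.
have kic : continuous (fun p : X => pi (u (repr p))).
  by apply: (circle_lift_continuous uc) => x; rewrite degree_one_factor.
have kK : cancel (fun p : X => pi (t (repr p))) (fun p : X => pi (u (repr p))).
  by move=> p; rewrite /= (degree_one_factor u1) ut; exact: reprK.
have kiK : cancel (fun p : X => pi (u (repr p))) (fun p : X => pi (t (repr p))).
  by move=> p; rewrite /= (degree_one_factor t1) tu; exact: reprK.
by exists (Homeo kc kic kK kiK) => x /=; rewrite degree_one_factor.
Qed.

(** Parametrizes [[0, 1)] by the whole line: the weight 1, where the homotopy reaches the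
    semi-conjugacy and injectivity may be lost, occurs only as a limit. *)
Definition path_weight (s : R) : R := 1 - (1 + `|s|)^-1.

Lemma path_weight_itv s : 0 <= path_weight s < 1.
Proof.
rewrite /path_weight; have s0 : 0 <= `|s| := normr_ge0 s.
have i0 : 0 < (1 + `|s|)^-1 by rewrite invr_gt0; lra.
have i1 : (1 + `|s|)^-1 <= 1 by rewrite invf_le1; lra.
by apply/andP; split; lra.
Qed.

Lemma path_weight_lip s s' : `|path_weight s - path_weight s'| <= `|s - s'|.
Proof.
rewrite /path_weight; have a0 := normr_ge0 s; have b0 := normr_ge0 s'.
apply: le_trans (ler_dist_dist s s'); move: (`|s|) (`|s'|) a0 b0 => a b a0 b0.
have a1 : 1 + a != 0 by apply/negP => /eqP; lra.
have b1 : 1 + b != 0 by apply/negP => /eqP; lra.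
have -> : 1 - (1 + a)^-1 - (1 - (1 + b)^-1) = (a - b) / ((1 + a) * (1 + b)).
  by field; rewrite a1 b1.
rewrite normrM ler_piMr // normfV invf_le1.
  by rewrite ger0_norm; nra.
by rewrite normr_gt0 mulf_neq0.
Qed.

Lemma path_weight_tends (d M : R) : 0 < d -> 0 <= M -> exists s, (1 - path_weight s) * M < d.
Proof.
move=> d0 M0; exists (M / d); rewrite /path_weight opprB addrC subrK.
have Md : 0 <= M / d by rewrite divr_ge0 // ltW.
rewrite ger0_norm // mulrC ltr_pdivrMr; last by lra.
by rewrite mulrDr mulr1 mulrCA divff ?gt_eqF // mulr1; lra.
Qed.

End DegreeOne.

Section SemiConjugatePath.
Variables (R : realType) (G : groupType).
Local Notation X := (circle R).
Local Notation pi := (@circle_proj R).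
Implicit Types (rho : HomHomeo G X).

(** Writing [x = k w] reduces the estimate to the closeness of [k] to [h] at [w] and at [f w]. With
    [h] a homeomorphism it yields continuity of the path, with [h] the semi-conjugacy its limit. *)
Lemma conj_close (h phi : X -> X) (f : Homeo_group X) (e : R) :
  continuous phi -> (forall x, h (f x) = phi (h x)) -> 0 < e ->
  exists2 d, 0 < d & forall k : homeo X X, (forall x, cdist (h x) (k x) < d) ->
    forall x, cdist (phi x) (k (f (homeo_inv k x))) < e.
Proof.
move=> phic hf e0; have e2 : 0 < e / 2 by lra.
have [d d0 hd] := circle_uniform_continuity phic e2.
exists (Num.min d (e / 2)); first by rewrite lt_min d0.
move=> k hk x; rewrite -{1}(homeoVK k x); set w := homeo_inv k x.
have := hk w; have := hk (f w); rewrite !lt_min => /andP[_ h1] /andP[/hd h2 _].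
rewrite hf in h1; apply: le_lt_trans (cdist_tri (phi (h w)) _ _) _.
by rewrite (cdistC (phi (k w))); lra.
Qed.

Lemma uniform_over_seq (l : seq G) (P : G -> R -> Prop) :
  (forall g d d', d <= d' -> P g d' -> P g d) ->
  (forall g, exists2 d, 0 < d & P g d) ->
  exists2 d, 0 < d & forall g, g \in l -> P g d.
Proof.
move=> mono h.
have [r rP] : {r : G -> R & forall g, 0 < r g /\ P g (r g)}.
  by apply: (@choice _ _ (fun g d => 0 < d /\ P g d)) => g; have [d d0 hd] := h g; exists d.
have [e e0 he] := positive_lower_bound (fun g (_ : g \in l) => (rP g).1).
by exists e => // g gl; apply: mono (he g gl) (rP g).2.
Qed.

(* Straight-line homotopy from the identity to the semi-conjugacy: conjugating
   by its homeomorphisms deforms rho to rho0. *)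
Lemma semi_conjugate_path rho rho0 : semi_conjugate rho rho0 ->
  exists2 k : R -> homeo X X,
    [/\ continuous (fun s => hom_conj (k s) rho), hom_conj (k 0) rho = rho &
     forall l e, 0 < e -> exists s, hom_close l e rho0 (hom_conj (k s) rho)] &
    forall s, exists2 t : R -> R, is_lift_of t (k s) &
       {homo t : x y / x <= y} /\ forall x, t (x + 1) = t x + 1.
Proof.
move=> [h [hc _ [t [[tc th] tmono t1]] heq]].
have M0 : 0 <= `|t 0| + 1 by have := normr_ge0 (t 0); lra.
have tM := degree_one_bounded tmono t1.
set M := `|t 0| + 1 in M0 tM.
pose H s x := x + path_weight s * (t x - x).
have H1 s x : H s (x + 1) = H s x + 1 by rewrite /H t1; ring.
have Hc s : continuous (H s).
  move=> x; apply: cvgD; first exact: cvg_id.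
  by apply: cvgM; [exact: cvg_cst|apply: cvgB; [exact: tc|exact: cvg_id]].
have Hl s x y : x <= y -> (1 - path_weight s) * (y - x) <= H s y - H s x.
  move=> xy; have := tmono _ _ xy; rewrite /H => txy.
  have w0 : 0 <= path_weight s by case/andP: (path_weight_itv s).
  have : 0 <= path_weight s * (t y - t x) by apply: mulr_ge0 => //; rewrite subr_ge0.
  by lra.
have w1 (s : R) : 0 < 1 - path_weight s by rewrite subr_gt0; case/andP: (path_weight_itv s).
have [k kP] := choice (fun s => degree_one_homeo (w1 s) (Hc s) (H1 s) (Hl s)).
have HH s s' x : cdist (k s (pi x)) (k s' (pi x)) <= `|s - s'| * M.
  rewrite !kP; apply: le_trans (cdist_proj_le _ _) _.
  rewrite /H (_ : _ - _ = (path_weight s - path_weight s') * (t x - x)); last by ring.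
  by rewrite normrM ler_pM // path_weight_lip.
have Hh s x : cdist (h (pi x)) (k s (pi x)) <= (1 - path_weight s) * M.
  rewrite kP -th; apply: le_trans (cdist_proj_le _ _) _.
  rewrite /H (_ : _ - _ = (1 - path_weight s) * (t x - x)); last by ring.
  by rewrite normrM ler_pM // ger0_norm // ltW.
exists k; last first.
  move=> s; exists (H s); first by split=> // x; rewrite kP.
  split=> // x y xy; rewrite -subr_ge0; apply: le_trans (Hl s _ _ xy).
  by apply: mulr_ge0; [exact/ltW/w1|rewrite subr_ge0].
split.
- move=> s A /hom_nbhsP[l [e e0 he]].
  pose P (g : G) (d : R) := forall k' : homeo X X, (forall x, cdist (k s x) (k' x) < d) ->
      forall x, cdist (hom_conj (k s) rho g x) (k' (rho g (homeo_inv k' x))) < e.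
  have [d d0 hd] : exists2 d, 0 < d & forall g, g \in l -> P g d.
    apply: uniform_over_seq.
      by move=> g d d' dd' hP k' hk'; apply: hP => x; apply: lt_le_trans dd'.
    move=> g; apply: conj_close => //; first exact: hom_continuous.
    by move=> x; rewrite hom_conjE homeoK.
  have M1 : 0 < M + 1 by lra.
  apply/nbhs_ballP; exists (d / (M + 1)); first by rewrite /= divr_gt0.
  move=> s'; rewrite /ball /= => ss'; apply: he => g x gl; rewrite (hom_conjE (k s')).
  apply: hd => // p; have [y <-] := circle_proj_surj p.
  apply: le_lt_trans (HH _ _ _) _.
  rewrite ltr_pdivlMr // in ss'; apply: le_lt_trans ss'.
  by rewrite ler_wpM2l //; lra.
- have k0 p : k 0 p = p.
    have [x <-] := circle_proj_surj p.
    by rewrite kP /H /path_weight normr0 addr0 invr1 subrr mul0r addr0.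
  apply: HomHomeoP => g; apply: homeoP => x; rewrite -/(hom_conj (k 0) rho g x) hom_conjE k0.
  by congr (rho g _); rewrite -[in LHS](k0 x) homeoK.
- move=> l e e0.
  pose P (g : G) (d : R) := forall k' : homeo X X, (forall x, cdist (h x) (k' x) < d) ->
      forall x, cdist (rho0 g x) (k' (rho g (homeo_inv k' x))) < e.
  have [d d0 hd] : exists2 d, 0 < d & forall g, g \in l -> P g d.
    apply: uniform_over_seq.
      by move=> g d d' dd' hP k' hk'; apply: hP => x; apply: lt_le_trans dd'.
    by move=> g; apply: conj_close => //; exact: hom_continuous.
  have [s hs] := path_weight_tends d0 M0.
  exists s => g x gl; rewrite hom_conjE; apply: hd => // p.
  by have [y <-] := circle_proj_surj p; exact: le_lt_trans hs.
Qed.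

Lemma semi_conjugate_conj (k : homeo X X) rho rho0 : 
  (exists2 t : R -> R, is_lift_of t k &
     {homo t : x y / x <= y} /\ forall x, t (x + 1) = t x + 1) ->
  semi_conjugate (hom_conj k rho) rho0 -> semi_conjugate rho rho0.
Proof.
move=> [t [tc tk] [tm t1]] [h [hc hr [u [[uc uh] um u1]] heq]].
exists (h \o k); split.
- by move=> x; apply: continuous_comp; [exact: homeo_cts|exact: hc].
- apply/seteqP; split=> // q _; have : range h q by rewrite hr.
  by case=> p _ <-; exists (homeo_inv k p) => //=; rewrite homeoVK.
- exists (u \o t); split.
  + split; last by move=> x /=; rewrite uh tk.
    by move=> x; apply: continuous_comp; [exact: tc|exact: uc].
  + by move=> x y xy /=; apply/um/tm.
  + by move=> x /=; rewrite t1 u1.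
- by move=> g x /=; rewrite -heq hom_conjE homeoK.
Qed.

(** [rho0] is reached only in the closure of the path, and the closure of a connected set is
    connected. *)
Lemma semi_conjugate_connected_component rho rho0 : semi_conjugate rho rho0 ->
  connected_component [set: HomHomeo G X] rho0 rho.
Proof.
move=> /semi_conjugate_path[k [kc k0 klim] _].
exists (closure (range (fun s => hom_conj (k s) rho))).
  split=> //.
    move=> A /hom_nbhsP[l [e e0 he]]; have [s hs] := klim l e e0.
    by exists (hom_conj (k s) rho); split; [exists s|exact: he].
  apply: connected_closure; apply: connected_continuous_connected.
    by apply/connected_intervalP => x y /= _ _ z _.
  exact: continuous_subspaceT.
by apply: subset_closure; exists 0.
Qed.

(** Conjugation by one fixed [k s] carries a neighbourhood of [rho] into the neighbourhood of [rho0]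
    where stability holds; the resulting semi-conjugacy is composed with [k s], itself monotone of
    degree one. *)
Lemma semi_conjugate_open (S : genset G) rho rho0 :
  expanding rho0 -> proper_expansion rho0 -> semi_conjugate rho rho0 ->
  exists l, exists2 e, 0 < e &
    forall rho', hom_close l e rho rho' -> semi_conjugate rho' rho0.
Proof.
move=> exp0 pr0 /semi_conjugate_path[k [_ _ klim] kmono].
have [L [d d0 hL]] := expanding_stable S exp0 pr0.
have d2 : 0 < d / 2 by lra.
have [s hs] := klim L (d / 2) d2.
have [e e0 he] := circle_uniform_continuity (@homeo_cts _ _ (k s)) d2.
exists L, e => // rho' close; apply: (semi_conjugate_conj (kmono s)).
apply: hL => g x gL; have h1 := hs g x gL.
have h2 := he _ _ (close g (homeo_inv (k s) x) gL).
rewrite hom_conjE in h1; rewrite hom_conjE.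
by apply: le_lt_trans (cdist_tri (k s (rho g (homeo_inv (k s) x))) _ _) _; lra.
Qed.

End SemiConjugatePath.

(** * Absence of finite orbits *)

Section NoFiniteOrbit.
Variables (R : realType) (G : groupType) (rho : HomHomeo G (circle R)).
Local Notation X := (circle R).
Local Notation pi := (@circle_proj R).
Hypothesis rho_conical : conical rho.
Hypothesis rho_proper : triple_proper rho.
Implicit Types (a g : G) (p q z w u b : X).

Lemma code_prod_const a n : code_prod (fun=> a) n = (a ^+ n)%g.
Proof. by elim: n => //= n ->; rewrite expgS. Qed.

Lemma exists_not_in (E : seq X) : exists z, z \notin E.
Proof.
apply: contrapT => none.
have sub : {subset [seq pi (n.+2%:R)^-1 | n <- iota 0 (size E).+1] <= E}.
  by move=> z _; apply/negP => zE; apply: none; exists z; exact/negP.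
suff /uniq_leq_size/(_ sub) : uniq [seq pi (n.+2%:R)^-1 | n <- iota 0 (size E).+1].
  by rewrite size_map size_iota ltnn.
rewrite map_inj_uniq ?iota_uniq // => n m /circle_proj_inj_near h.
have itv k : 0 < (k.+2%:R : R)^-1 < 1.
  by rewrite invr_gt0 ltr0n /= invf_lt1 ?ltr0n // ltr1n.
have /invr_inj/eqP : (n.+2%:R : R)^-1 = m.+2%:R^-1.
  apply: h; rewrite ltr_norml.
  move: (itv n) (itv m); move: (n.+2%:R^-1) (m.+2%:R^-1) => x y.
  by move=> /andP[? ?] /andP[? ?]; apply/andP; split; lra.
by rewrite eqr_nat => /eqP[].
Qed.

(** The element given by conicality at [z] collapses a set that contains its fixed point [b], hence
    into a [t]-ball around [b]. Its inverse sends the outside of that ball close to [z]. *)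
Lemma fixed_point_contraction b : (forall g, rho g b = b) ->
  forall z, cdist b z = 1 / 3 -> forall t, 0 < t <= 1 / 12 ->
  exists a, forall u, t < cdist u b -> cdist (rho a u) z < 1 / 12.
Proof.
move=> fixb z bz t /andP[t0 t12]; have [c _ hc] := rho_conical.
have s0 : 0 < 1 / 12 :> R by lra.
have [g [_ hg]] := hc _ _ s0 t0 z; exists g^-1%g => u ut.
rewrite ltNge; apply/negP => far.
have bfar : 1 / 12 <= cdist b z by lra.
by have := hg _ b far bfar; rewrite homVK fixb leNgt ut.
Qed.

(* With a, g pushing everything away from b into disjoint balls around z, z',
   the elements a^m g a^-n, m chosen so that the image of a test point returns
   to a fundamental domain of a, all move one triple to separated triples. *)
Lemma no_global_fixed_point b : ~ (forall g, rho g b = b).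
Proof.
move=> fixb; have [beta bE] := circle_proj_surj b.
pose z := pi (beta + 1 / 3); pose z' := pi (beta - 1 / 3).
have bz : cdist b z = 1 / 3.
  have e : `|beta - (beta + 1 / 3)| = 1 / 3 by rewrite ler0_norm; lra.
  by rewrite -bE /z cdist_proj e //; lra.
have bz' : cdist b z' = 1 / 3.
  have e : `|beta - (beta - 1 / 3)| = 1 / 3 by rewrite ger0_norm; lra.
  by rewrite -bE /z' cdist_proj e //; lra.
have zz' : cdist z z' = 1 / 3.
  have e : `|beta + 1 / 3 - (beta - 1 / 3 + 1)| = 1 / 3 by rewrite ler0_norm; lra.
  by rewrite /z' -(circle_proj_int _ 1) /z cdist_proj e //; lra.
have id_lift g x : rho g (id x) = id (rho g x) by [].
have [r0 r00 hr0] := lift_proper_expansion (id_uniform_local_homeo R) id_lift rho_proper.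
pose c := Num.min (1 / 4) r0.
have c0 : 0 < c by rewrite lt_min r00 andbT; lra.
have c4 : c <= 1 / 4 by rewrite ge_min lexx.
have cr0 : c <= r0 by rewrite ge_min lexx orbT.
have [c1 c10 proper_c] := hr0 c c0.
pose t := Num.min (c / 4) (Num.min (c1 / 2) (1 / 12)).
have t0 : 0 < t by rewrite !lt_min; apply/and3P; split; lra.
have tc : t <= c / 4 by rewrite !ge_min lexx.
have tc1 : t <= c1 / 2 by rewrite !ge_min lexx orbT.
have t12 : t <= 1 / 12 by rewrite !ge_min lexx !orbT.
have h12 : 0 < t <= 1 / 12 by rewrite t0.
have h12' : 0 < (1 / 12 : R) <= 1 / 12 by rewrite lexx andbT; lra.
have [a ha] := fixed_point_contraction fixb bz h12.
have [g hg] := fixed_point_contraction fixb bz' h12'.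
have near_z u : cdist u z <= 1 / 12 -> 1 / 4 <= cdist u b.
  by have := cdist_tri u b z; rewrite (cdistC b u); lra.
have near_z' u : cdist u z' <= 1 / 12 -> 1 / 4 <= cdist u b.
  by have := cdist_tri u b z'; rewrite (cdistC b u); lra.
have disj u : cdist u z < 1 / 12 -> cdist u z' < 1 / 12 -> False.
  by have := cdist_tri u z z'; rewrite (cdistC z u); lra.
have stay n u : t < cdist u b -> cdist (rho (a ^+ n.+1)%g u) z < 1 / 12.
  move=> ut; elim: n => [|n ih]; first by rewrite expg1; exact: ha.
  by rewrite expgS homM; apply: ha; have := near_z _ (ltW ih); lra.
(* The constant sequence [a] is an expanding code of the fixed point [b], so [code_shrink] makes
   escape from [b] uniform. *)
have escape r : 0 < r -> exists N, forall n u, (N <= n)%N -> r <= cdist u b ->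
    t < cdist (rho (a ^+ n)%g u) b.
  move=> rpos.
  have consts : [/\ 0 < t, 2 * t < c, 2 * c <= 2 * c & 2 * t <= 1 / 2] /\
      [/\ c <= r0, 2 * t <= c1, 0 < 2 * t & 2 * t <= 2 * t].
    by split; split=> //; lra.
  have [N hN] := code_shrink [:: a] consts proper_c rpos.
  exists N => n u Nn ru.
  have : exp_code rho [:: a] t c n b (fun=> a).
    move=> i _; split; first exact: mem_head.
    rewrite code_prod_const fixb => w tw; rewrite fixb.
    by have /ha/ltW/near_z : t < cdist w b by [lra]; lra.
  move=> hc; have := hN n b _ n hc; rewrite Nn leqnn => /(_ isT u ru).
  rewrite code_prod_const fixb.
  by lra.
(* [p] lies in the images of the ball around [z] under all powers of [a], so its backward orbit
   stays in that ball. *)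
have [p hp] : exists p, forall n, cdist (rho (a ^- n)%g p) z <= 1 / 12.
  apply: (@circle_nested R (fun n q => cdist (rho (a ^- n)%g q) z <= 1 / 12)).
  - move=> n q /negP; rewrite -ltNge => far.
    have e0 : 0 < cdist (rho (a ^- n)%g q) z - 1 / 12 by lra.
    have [e epos he] := (circle_continuousP _).1 (@hom_continuous _ _ rho (a ^- n)%g) q _ e0.
    exists e => // q' /he qq'; apply/negP; rewrite -ltNge.
    by have := cdist_tri (rho (a ^- n)%g q') (rho (a ^- n)%g q) z; lra.
  - move=> n q h; apply: ltW.
    have -> : rho (a ^- n)%g q = rho a (rho (a ^- n.+1)%g q).
      by rewrite -homM expgSr invgM mulVKg.
    by apply: ha; have := near_z _ h; lra.
  - move=> n; exists (rho (a ^+ n)%g z); rewrite homK cdistxx; lra.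
(* [s] is the test point: its backward orbit under [a] tends to [b] without reaching it. *)
have [s sb] : exists s, cdist s b = t by apply: cdist_attains; apply/andP; split; lra.
have far_b u : cdist u b <= t -> 1 / 4 <= cdist u z.
  by have := cdist_tri u b z; rewrite (cdistC b u); lra.
have s_near n : cdist (rho (a ^- n)%g s) b <= t.
  rewrite leNgt; apply/negP; case: n => [|n]; first by rewrite invg1 hom1 sb ltxx.
  by move=> /(stay n); rewrite homVK; have := far_b s; rewrite sb lexx => /(_ isT); lra.
have s_neq n : 0 < cdist (rho (a ^- n)%g s) b.
  apply: cdist_gt0 => e; have : s = b by rewrite -(homVK rho (a ^+ n)%g s) e fixb.
  by move=> sb'; move: sb; rewrite sb' cdistxx; lra.
have s_tends r : 0 < r -> exists N, forall n, (N <= n)%N -> cdist (rho (a ^- n)%g s) b < r.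
  move=> rpos; have [N hN] := escape r rpos; exists N => n Nn.
  by rewrite ltNge; apply/negP => /(hN n _ Nn); rewrite homVK sb ltxx.
have gp n : cdist (rho g (rho (a ^- n)%g p)) z' < 1 / 12.
  by apply: hg; have := near_z _ (hp n); lra.
have quarter : 0 < 1 / 4 :> R by lra.
have [N hN] := escape _ quarter.
(* 1/6 is 1/4 - 1/12: at time [m - 1] one image is within 1/12 of [z], the other still at least 1/4
   from it. *)
have t6 : 0 < 1 / 6 :> R by lra.
have [k1 k10 hk1] := circle_uniform_continuity (@hom_continuous _ _ rho a^-1%g) t6.
have [r rpos hr] := hom_equicontinuous rho
  [seq (a ^+ j * g)%g | j <- iota 0 N.+2] t0.
have [N' hN'] := s_tends r rpos.
pose k := Num.min t k1.
have k0 : 0 < k by rewrite lt_min t0.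
have kt : k <= t by rewrite ge_min lexx.
have kk1 : k <= k1 by rewrite ge_min lexx orbT.
have [B hB] := rho_proper k0.
(* [m] is the first time at which powers of [a] take [g a^-n s] out of the [t]-ball around [b]; the
   triple [b], [p], [s] then becomes separated. *)
have returns n : (N' <= n)%N -> exists m, (a ^+ m * g * a ^- n)%g \in B.
  move=> Nn; pose w := rho g (rho (a ^- n)%g s).
  have w0 : 0 < cdist w b.
    apply: cdist_gt0 => e; have := s_neq n.
    by rewrite -(homK rho g (rho _ s)) -/w e fixb cdistxx ltxx.
  have [M hM] := escape _ w0.
  have ex : exists m, t < cdist (rho (a ^+ m)%g w) b.
    by exists M; apply: hM.
  have [m mt mmin] := ex_minnP ex.
  have mN : (N.+2 <= m)%N.
    rewrite leqNgt; apply/negP => mN.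
    have : cdist (rho (a ^+ m * g)%g (rho (a ^- n)%g s)) (rho (a ^+ m * g)%g b) < t.
      apply: hr; last exact: hN'.
      by apply/mapP; exists m => //; rewrite mem_iota.
    by rewrite !homM !fixb ltNge (ltW mt).
  exists m; apply: (hB _ b p s).
    have := near_z _ (hp 0%N); rewrite invg1 hom1 => pb.
    have := hp 0%N; rewrite invg1 hom1 => pz.
    have sz := far_b s; rewrite sb lexx in sz.
    split; [by rewrite cdistC; lra| |by rewrite cdistC sb].
    by have := cdist_tri p s z; rewrite (cdistC s p) => h; have := sz isT; lra.
  rewrite fixb !homM; set y := rho g (rho _ p).
  have yb : 1 / 4 <= cdist y b by apply/near_z'/ltW/gp.
  have y1 : cdist (rho (a ^+ m.-1)%g y) z < 1 / 12.
    have -> : (m.-1 = (m.-1 - N).-1.+1 + N)%N by move: mN; clear; lia.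
    by rewrite expgnDr homM; apply: stay; apply: hN.
  have mE : rho (a ^+ m)%g y = rho a (rho (a ^+ m.-1)%g y).
    by rewrite -homM -expgS prednK //; move: mN; clear; lia.
  have mE' : rho (a ^+ m)%g w = rho a (rho (a ^+ m.-1)%g w).
    by rewrite -homM -expgS prednK //; move: mN; clear; lia.
  split.
  - have y2 : cdist (rho (a ^+ m)%g y) z < 1 / 12.
      by rewrite mE; apply: ha; have := near_z _ (ltW y1); lra.
    by rewrite cdistC; have := near_z _ (ltW y2); lra.
  - apply: le_trans kk1 _; rewrite leNgt mE mE'; apply/negP => /hk1; rewrite !homK => close.
    have : cdist (rho (a ^+ m.-1)%g w) b <= t.
      rewrite leNgt; apply/negP => /mmin; move: mN; clear; lia.
    move=> /far_b wz.
    by have := cdist_tri (rho (a ^+ m.-1)%g y) (rho (a ^+ m.-1)%g w) z;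
       rewrite (cdistC (rho (a ^+ m.-1)%g w) (rho (a ^+ m.-1)%g y)); lra.
  - by rewrite cdistC; lra.
have [f hf] : {f : nat -> nat & forall n, (a ^+ f n * g * a ^- (N' + n))%g \in B}.
  apply: (@choice _ _ (fun n m => (a ^+ m * g * a ^- (N' + n))%g \in B)) => n.
  by apply: returns; exact: leq_addr.
(* Infinitely many [n] and a finite [B]: two of the elements coincide. *)
have [n [l [l0 eqn]]] : exists n l, (0 < l)%N /\
    (a ^+ f n * g * a ^- (N' + n) = a ^+ f (n + l)%N * g * a ^- (N' + (n + l)))%g.
  apply: contrapT => none.
  pose h n := (a ^+ f n * g * a ^- (N' + n))%g.
  have neq i j : (i < j)%N -> h i <> h j.
    move=> ij e; apply: none; exists i, (j - i)%N; rewrite subn_gt0; split=> //.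
    by rewrite (subnKC (ltnW ij)); exact: e.
  have : uniq [seq h i | i <- iota 0 (size B).+1].
    rewrite map_inj_uniq ?iota_uniq // => i j e.
    by have [ij|ij|//] := ltngtP i j; [case: (neq _ _ ij)|case: (neq _ _ ij)].
  have sub : {subset [seq h i | i <- iota 0 (size B).+1] <= B}.
    by move=> x /mapP[i _ ->]; exact: hf.
  by move=> /uniq_leq_size/(_ sub); rewrite size_map size_iota ltnn.
have eq1 : (a ^+ f n * g * a ^+ l = a ^+ f (n + l)%N * g)%g.
  have := congr1 (fun x => x * a ^+ (N' + (n + l)))%g eqn.
  by rewrite /= mulgVK addnA (expgnDr a (N' + n)%N l) mulgA mulgVK.
have pz := hp 0%N; rewrite invg1 hom1 in pz.
have pb := near_z _ pz.
have pl i : (0 < i)%N -> cdist (rho (a ^+ i)%g p) z < 1 / 12.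
  by case: i => // i _; apply: stay; lra.
have gpl i : cdist (rho g (rho (a ^+ i)%g p)) z' < 1 / 12.
  apply: hg; case: i => [|i]; first by rewrite hom1; lra.
  by have := near_z _ (ltW (pl i.+1 isT)); lra.
have agp i j : (N < j)%N -> cdist (rho (a ^+ j)%g (rho g (rho (a ^+ i)%g p))) z < 1 / 12.
  move=> Nj; have -> : (j = (j - N).-1.+1 + N)%N by move: Nj; clear; lia.
  rewrite expgnDr homM; apply: stay; apply: hN => //.
  exact/near_z'/ltW/gpl.
(* Either way the relation can be iterated until it equates a point that [g] has sent near [z'] with
   one that a high power of [a] has sent near [z]. *)
have [le|gt] := leqP (f n) (f (n + l)%N).
- pose j := (f (n + l)%N - f n)%N.
  have eq2 : (g * a ^+ l = a ^+ j * g)%g.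
    apply: (mulgI (a ^+ f n)%g); rewrite mulgA eq1 mulgA -expgnDr.
    by rewrite /j subnKC.
  have [j0|j0] := posnP j.
    have al1 : (a ^+ l = 1)%g by apply: (mulgI g); rewrite eq2 j0 mul1g mulg1.
    have := @stay l.-1 z'; rewrite prednK // al1 hom1 (cdistC z' b) bz' (cdistC z' z) zz'.
    by lra.
  have eq3 i : (g * a ^+ (l * i) = a ^+ (j * i) * g)%g.
    elim: i => [|i ih]; first by rewrite !muln0 mulg1 mul1g.
    by rewrite !mulnS !expgnDr mulgA eq2 -mulgA ih mulgA.
  have := gpl (l * N.+1)%N; rewrite -homM eq3 homM.
  apply: (disj); have := agp 0%N (j * N.+1)%N; rewrite expg0 hom1; apply.
  by move: j0; case: (j) => // j' _; rewrite mulSn; exact: leq_addr.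
- pose j := (f n - f (n + l)%N)%N.
  have j0 : (0 < j)%N by rewrite subn_gt0.
  have eq2 : (a ^+ j * g * a ^+ l = g)%g.
    apply: (mulgI (a ^+ f (n + l)%N)%g); rewrite -eq1 !mulgA -expgnDr.
    by rewrite /j subnKC // ltnW.
  have eq3 i : (a ^+ (j * i) * g * a ^+ (l * i) = g)%g.
    elim: i => [|i ih]; first by rewrite !muln0 mulg1 mul1g.
    rewrite mulnSr mulnS !expgnDr -!mulgA (mulgA g) (mulgA (a ^+ j)%g).
    by rewrite (mulgA (a ^+ j)%g) eq2 mulgA.
  have := gpl 0%N; rewrite expg0 hom1 -{1}(eq3 N.+1) !homM.
  apply: (disj); apply: agp.
  by move: j0; case: (j) => // j' _; rewrite mulSn; exact: leq_addr.
Qed.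

(** Conicality is applied at a point [z] outside [E]: the collapsed complement contains all of [E],
    whose image would be smaller than the least distance between two points of [E]. *)
Lemma no_finite_orbit (E : seq X) e0 : e0 \in E ->
  ~ (forall g e, e \in E -> rho g e \in E).
Proof.
move=> e0E inv; have [z zE] := exists_not_in E.
have [e1E|] := pselect (exists2 e1, e1 \in E & e1 <> e0); last first.
  move=> single; apply: (@no_global_fixed_point e0) => g.
  by apply: contrapT => ne; apply: single; exists (rho g e0) => //; exact: inv.
have [e1 e1_in e10] := e1E.
have [s s0 hs] : exists2 s : R, 0 < s & forall e, e \in E -> s <= cdist e z.
  apply: positive_lower_bound => e eE; apply: cdist_gt0 => ez.
  by move: zE; rewrite -ez eE.
pose D := [seq (x, y) | x <- E, y <- E].
have [t t0 ht] : exists2 t : R, 0 < t & forall xy : X * X,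
    xy \in [seq xy <- D | xy.1 != xy.2] -> t <= cdist xy.1 xy.2.
  apply: positive_lower_bound => -[x y]; rewrite mem_filter => /andP[/eqP xy _].
  exact: cdist_gt0.
have [c _ hc] := rho_conical; have t2 : 0 < t / 2 by lra.
have [g [_ hg]] := hc _ _ s0 t2 z.
have := hg _ _ (hs _ e1_in) (hs _ e0E).
have := ht (rho g e1, rho g e0); rewrite mem_filter /=.
have -> /= : rho g e1 != rho g e0 by apply/eqP => /(can_inj (homK rho g)).
rewrite /D; move=> /(_ _) h1; have {}h1 := h1 (allpairs_f _ (inv g _ e1_in) (inv g _ e0E)).
by lra.
Qed.

End NoFiniteOrbit.

(** * Limits of semi-conjugacies *)

Section MonotoneGraph.
Variables (R : realType) (T : R -> R).
Local Notation X := (circle R).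
Local Notation pi := (@circle_proj R).
Hypothesis T_mono : {homo T : x y / x <= y}.
Hypothesis T_deg : forall x, T (x + 1) = T x + 1.
Implicit Types (x y : R) (p q : X).

(* The graph of T with its jumps filled in by vertical segments. *)
Definition fills x y : Prop :=
  (forall x1, x1 < x -> T x1 <= y) /\ (forall x2, x < x2 -> y <= T x2).

Definition circle_fills p q : Prop := exists x y, [/\ pi x = p, pi y = q & fills x y].

Lemma fills_self x : fills x (T x).
Proof. by split=> x' h; apply/T_mono/ltW. Qed.

Lemma fills_lt x x' y y' : x < x' -> fills x y -> fills x' y' -> y <= y'.
Proof.
move=> xx' [_ hx] [hx' _]; apply: le_trans (hx ((x + x') / 2) _) (hx' _ _); lra.
Qed.

Lemma fills_convex x y y' z : fills x y -> fills x y' -> y <= z <= y' -> fills x z.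
Proof.
move=> [h1 _] [_ h2] /andP[yz zy']; split=> x' hx'; first exact: le_trans (h1 _ hx') yz.
exact: le_trans zy' (h2 _ hx').
Qed.

Lemma fills_int x y (n : int) : fills x y -> fills (x + n%:~R) (y + n%:~R).
Proof.
have Tn := degree_one_int T_deg; move=> [h1 h2]; split=> x' hx'.
  by rewrite -(subrK n%:~R x') Tn lerD2r; apply: h1; rewrite ltrBlDr.
by rewrite -(subrK n%:~R x') Tn lerD2r; apply: h2; rewrite ltrBrDr.
Qed.

Lemma circle_fills_lift x q : circle_fills (pi x) q -> exists2 y, pi y = q & fills x y.
Proof.
move=> [x' [y [/circle_proj_eq[n x'E] yq f]]]; exists (y - n%:~R).
  by rewrite -intrN circle_proj_int.
have -> : x = x' + (- n)%:~R by rewrite x'E intrN addrK.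
by rewrite -intrN; exact: fills_int.
Qed.

(** The least filled value is the left limit of [T] at [x]. The bound [x - 1 < x1] keeps [x1] and
    [x] distinct on the circle. *)
Lemma fills_lower x : exists2 a, fills x a & (forall y, fills x y -> a <= y) /\
  forall e, 0 < e -> exists2 x1, x - 1 < x1 < x & a - e < T x1.
Proof.
pose E := [set T x1 | x1 in [set x1 | x1 < x]].
have supE : has_sup E.
  split; first by exists (T (x - 1)), (x - 1) => //=; lra.
  by exists (T x) => _ [x1 /= h <-]; apply/T_mono/ltW.
have lub y : (forall x1, x1 < x -> T x1 <= y) -> sup E <= y.
  by move=> h; apply: ge_sup => [|_ [x1 /= h1 <-]]; [exact: supE.1|exact: h].
exists (sup E); first split.
- by move=> x1 h; apply: sup_upper_bound => //; exists x1.
- by move=> x2 h; apply: lub => x1 h1; apply: T_mono; lra.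
split=> [y [hy _]|e e0]; first exact: lub.
have [_ [x1 /= x1x <-] hx1] := sup_adherent e0 supE.
exists (Num.max x1 (x - 1 / 2)).
  by rewrite lt_max gt_max x1x; apply/and3P; split => //; [apply/orP; right|]; lra.
by apply: lt_le_trans hx1 _; apply: T_mono; rewrite le_max lexx.
Qed.

Lemma fills_upper x : exists2 b, fills x b & (forall y, fills x y -> y <= b) /\
  forall e, 0 < e -> exists2 x2, x < x2 & T x2 < b + e.
Proof.
pose E := [set T x2 | x2 in [set x2 | x < x2]].
have infE : has_inf E.
  split; first by exists (T (x + 1)), (x + 1) => //=; lra.
  by exists (T x) => _ [x2 /= h <-]; apply/T_mono/ltW.
have glb y : (forall x2, x < x2 -> y <= T x2) -> y <= inf E.
  by move=> h; apply: lb_le_inf => [|_ [x2 /= h2 <-]]; [exact: infE.1|exact: h].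
exists (inf E); first split.
- by move=> x1 h; apply: glb => x2 h2; apply: T_mono; lra.
- by move=> x2 h; apply: ge_inf; [exact: infE.2|exists x2].
split=> [y [_ hy]|e e0]; first exact: glb.
by have [_ [x2 /= xx2 <-] hx2] := inf_adherent e0 infE; exists x2.
Qed.

(** With [f x] a filled value at least [d] above another one, the integer part of [f x / d]
    increases strictly from one jump to the next and is bounded over a period. *)
Lemma finitely_many_jumps (d : R) : 0 < d -> exists L : seq R,
  forall x y y', 0 <= x < 1 -> fills x y -> fills x y' -> d <= y' - y -> x \in L.
Proof.
move=> d0.
pose P x := 0 <= x < 1 /\ exists y y', [/\ fills x y, fills x y' & d <= y' - y].
have [f fP] : {f : R -> R & forall x, P x ->
    fills x (f x) /\ exists2 y, fills x y & d <= f x - y}.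
  apply: (@choice _ _ (fun x v => P x -> fills x v /\ exists2 y, fills x y & d <= v - y)) => x.
  have [[_ [y [y' [h1 h2 h3]]]]|nP] := pselect (P x); last by exists 0.
  by exists y' => _; split=> //; exists y.
have finj x x' : P x -> P x' -> Num.floor (f x / d) = Num.floor (f x' / d) -> x = x'.
  have lt_floor u u' : P u -> P u' -> u < u' -> Num.floor (f u / d) < Num.floor (f u' / d).
    move=> /fP[hu _] /fP[hu' [y hy dy]] uu'.
    have h := fills_lt uu' hu hy.
    rewrite -lezD1 floor_ge_int intrD; apply: le_trans (_ : f u / d + 1 <= _).
      by rewrite lerD2r; have /andP[] := floor_itv (f u / d).
    by rewrite ler_pdivlMr // mulrDl mul1r divfK ?gt_eqF //; lra.
  move=> Px Px' e; have [xx'|x'x|//] := ltgtP x x'.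
    by have := lt_floor _ _ Px Px' xx'; rewrite e ltxx.
  by have := lt_floor _ _ Px' Px x'x; rewrite e ltxx.
have [n nP] : exists n : nat, forall x, P x -> (`|Num.floor (f x / d)| < n)%N.
  pose M := `|T (-1)| + `|T 1|; have M0 : 0 <= M by rewrite addr_ge0.
  exists (Num.trunc (M / d + 1)).+1 => x Px; have [[h1 h2] _] := fP x Px.
  have [/andP[x0 x1] _] := Px.
  have lo : T (-1) <= f x by apply: h1; lra.
  have hi : f x <= T 1 by apply: h2.
  have fM : `|f x| <= M.
    rewrite ler_norml /M; have := ler_norm (T 1); have := ler_norm (- T (-1)).
    by rewrite normrN; have := normr_ge0 (T 1); have := normr_ge0 (T (-1)) => *;
      apply/andP; split; lra.
  rewrite -(ltr_nat R) natr_absz; apply: le_lt_trans (truncnS_gt _).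
  have fd : `|f x / d| <= M / d by rewrite normrM normfV (gtr0_norm d0) ler_pM2r ?invr_gt0.
  have /andP[fl1 fl2] := floor_itv (f x / d); rewrite intrD in fl2.
  move: fd; rewrite intr_norm !ler_norml => /andP[fd1 fd2]; apply/andP; split; lra.
(* The jump with integer [k], or 0 if there is none. *)
pose pick (k : int) := xget 0 [set x | P x /\ Num.floor (f x / d) = k].
exists ([seq pick k%:Z | k <- iota 0 n] ++ [seq pick (- k%:Z) | k <- iota 0 n]).
move=> x y y' x01 hy hy' hd.
have Px : P x by split=> //; exists y, y'.
have xE : pick (Num.floor (f x / d)) = x.
  have [Pp pE] : P (pick (Num.floor (f x / d))) /\
      Num.floor (f (pick (Num.floor (f x / d))) / d) = Num.floor (f x / d).
    apply: (@xgetPex _ 0 [set x' | P x' /\ Num.floor (f x' / d) = Num.floor (f x / d)]).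
    by exists x.
  exact: finj.
have nk : `|Num.floor (f x / d)|%N \in iota 0 n by rewrite mem_iota nP.
rewrite mem_cat -xE; case: (intP (Num.floor (f x / d))) (nk) => [|k|k] nk'.
- by apply/orP; left; apply/mapP; exists 0%N.
- by apply/orP; left; apply/mapP; exists k.+1.
- by apply/orP; right; apply/mapP; exists k.+1.
Qed.

End MonotoneGraph.

(** The limit is the supremum of the lower bounds valid on a member of [W]. A larger number is not
    such a bound, and the ultrafilter then contains the set where the opposite inequality holds. *)
Lemma ultra_limit (R : realType) (I : Type) (W : set_system I) (u : I -> R) (M : R) :
  UltraFilter W -> (forall i, `|u i| <= M) ->
  exists l : R, forall e, 0 < e -> W [set i | `|u i - l| < e].
Proof.
move=> UW uM; pose E := [set r : R | W [set i | r <= u i]].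
have supE : has_sup E.
  split.
    exists (- M); apply: filterS filterT => i _ /=.
    by have := uM i; rewrite ler_norml => /andP[].
  exists M => r Er; have [i /= ri] := @filter_ex _ W _ _ Er.
  by apply: le_trans ri _; have := uM i; rewrite ler_norml => /andP[].
exists (sup E) => e e0.
have [r Er hr] := sup_adherent e0 supE.
have e2 : 0 < e / 2 by lra.
have nE : ~ E (sup E + e / 2).
  by move=> /(sup_upper_bound supE); lra.
have [//|hi] := in_ultra_setVsetC [set i | sup E + e / 2 <= u i] UW.
apply: filterS (filterI Er hi) => i [/= ri /negP]; rewrite -ltNge => ui.
by rewrite ltr_norml; apply/andP; split; lra.
Qed.

Section LimitOfSemiConjugacies.
Variables (R : realType) (G : groupType) (rho rho0 : HomHomeo G (circle R)).
Local Notation X := (circle R).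
Local Notation pi := (@circle_proj R).
Variables (I : Type) (W : set_system I).
Hypothesis UW : UltraFilter W.
Variables (rhoi : I -> HomHomeo G X) (h : I -> X -> X) (t : I -> R -> R) (T : R -> R).
Hypothesis tP : forall i, is_lift_of (t i) (h i) /\ {homo t i : x y / x <= y}.
Hypothesis t_near : forall i x, `|t i x - x| <= 2.
Hypothesis h_equiv : forall i g p, h i (rhoi i g p) = rho0 g (h i p).
Hypothesis rhoi_tends : forall g e, 0 < e ->
  W [set i | forall p, cdist (rho g p) (rhoi i g p) < e].
Hypothesis T_lim : forall x e, 0 < e -> W [set i | `|t i x - T x| < e].
Implicit Types (x y e : R) (p q : X) (g : G).

Lemma limit_mono : {homo T : x y / x <= y}.
Proof.
move=> x y xy; rewrite leNgt; apply/negP => yx.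
have e0 : 0 < (T x - T y) / 2 by lra.
have [i [/= hx hy]] := @filter_ex _ W _ _ (filterI (T_lim x e0) (T_lim y e0)).
have := (tP i).2 _ _ xy; move: hx hy; rewrite !ltr_norml => /andP[? ?] /andP[? ?]; lra.
Qed.

(** The filled graph is the limit of the graphs of the [t i] as sets; the vertical segments come
    from the intermediate value theorem. In this form invariance passes to the limit even where [T]
    is discontinuous. *)
Lemma fills_limit x y : fills T x y <->
  forall e, 0 < e -> W [set i | exists2 x', `|x' - x| < e & `|t i x' - y| < e].
Proof.
split=> [[f1 f2] e e0|hW].
  have e2 : 0 < e / 2 by lra.
  have l1 : T (x - e / 2) <= y by apply: f1; lra.
  have l2 : y <= T (x + e / 2) by apply: f2; lra.
  apply: filterS (filterI (T_lim (x - e / 2) e2) (T_lim (x + e / 2) e2)) => i /= [h1 h2].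
  move: h1 h2; rewrite !ltr_norml => /andP[h1 h1'] /andP[h2 h2'].
  have [y1|y1] := leP y (t i (x - e / 2)).
    by exists (x - e / 2); rewrite ltr_norml; apply/andP; split; lra.
  have [y2|y2] := leP (t i (x + e / 2)) y.
    by exists (x + e / 2); rewrite ltr_norml; apply/andP; split; lra.
  have xx : x - e / 2 <= x + e / 2 by lra.
  have [||x' x'P tx'] := @IVT R (t i) _ _ y xx.
  - by apply: continuous_subspaceT; case: (tP i) => -[].
  - by rewrite ge_min le_max (ltW y1) (ltW y2) orbT.
  move: x'P; rewrite in_itv /= => /andP[? ?]; exists x'; last by rewrite tx' subrr normr0.
  by rewrite ltr_norml; apply/andP; split; lra.
split=> x' xx'; rewrite leNgt; apply/negP => yT.
  pose e := Num.min (x - x') ((T x' - y) / 2).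
  have e0 : 0 < e by rewrite lt_min; apply/andP; split; lra.
  have e1 : e <= x - x' by rewrite ge_min lexx.
  have e2 : e <= (T x' - y) / 2 by rewrite ge_min lexx orbT.
  have [i [[x'' /= h1 h2] h3]] := @filter_ex _ W _ _ (filterI (hW e e0) (T_lim x' e0)).
  move: h1 h2 h3; rewrite /= !ltr_norml => /andP[? ?] /andP[? ?] /andP[? ?].
  have : t i x' <= t i x'' by apply: (tP i).2; lra.
  by lra.
pose e := Num.min (x' - x) ((y - T x') / 2).
have e0 : 0 < e by rewrite lt_min; apply/andP; split; lra.
have e1 : e <= x' - x by rewrite ge_min lexx.
have e2 : e <= (y - T x') / 2 by rewrite ge_min lexx orbT.
have [i [[x'' /= h1 h2] h3]] := @filter_ex _ W _ _ (filterI (hW e e0) (T_lim x' e0)).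
move: h1 h2 h3; rewrite /= !ltr_norml => /andP[? ?] /andP[? ?] /andP[? ?].
have : t i x'' <= t i x' by apply: (tP i).2; lra.
by lra.
Qed.

Lemma ultra_seq (A : eqType) (l : seq A) (P : A -> set I) :
  W [set i | exists2 a, a \in l & P a i] -> exists2 a, a \in l & W (P a).
Proof.
elim: l => [|a l ih] hW.
  by have [i [b]] := @filter_ex _ W _ _ hW.
have [Wa|Wa] := in_ultra_setVsetC (P a) UW; first by exists a => //; exact: mem_head.
have [b bl Wb] : exists2 b, b \in l & W (P b).
  apply: ih; apply: filterS (filterI hW Wa) => i [[b]].
  by rewrite inE => /predU1P[->//|bl] Pb _; exists b.
by exists b => //; rewrite inE bl orbT.
Qed.

(** Acting on a point of the graph of [t i] near [(x, y)] gives one near [(x', y' + n)], with an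
    integer [n] that depends on [i]. As [t i] is within 2 of the identity, finitely many [n] occur,
    and the ultrafilter selects one. *)
Lemma circle_fills_equivariant g p q : circle_fills T p q ->
  circle_fills T (rho g p) (rho0 g q).
Proof.
move=> [x [y [xp yq /fills_limit hK]]].
have [x' x'E] := circle_proj_surj (rho g p); have [y' y'E] := circle_proj_surj (rho0 g q).
pose M := (Num.trunc (`|x'| + `|y'| + 4)).+1.
pose ns := [seq k%:Z | k <- iota 0 M.+1] ++ [seq - k%:Z | k <- iota 0 M.+1].
pose Q e (n : int) : set I :=
  [set i | exists2 u, `|u - x'| < e & `|t i u - (y' + n%:~R)| < e].
have near e : 0 < e -> e <= 1 -> W [set i | exists2 n, n \in ns & Q e n i].
  move=> e0 e1; have e2 : 0 < e / 2 by lra.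
  have [d1 d10 hd1] := circle_uniform_continuity (@hom_continuous _ _ rho g) e2.
  have [d2 d20 hd2] := circle_uniform_continuity (@hom_continuous _ _ rho0 g) e0.
  have d0 : 0 < Num.min d1 d2 by rewrite lt_min d10.
  apply: filterS (filterI (hK _ d0) (rhoi_tends g e2)) => i [[v vx tvy] /= conv].
  have [u uE ux] := cdist_lift x' (rhoi i g (pi v)).
  have x'u : `|x' - u| < e.
    rewrite ux x'E; apply: le_lt_trans (cdist_tri (rho g (pi v)) _ _) _.
    have : cdist (rho g p) (rho g (pi v)) < e / 2.
      apply: hd1; rewrite -xp cdistC; apply: le_lt_trans (cdist_proj_le _ _) _.
      by apply: lt_le_trans vx _; rewrite ge_min lexx.
    by have := conv (pi v); lra.
  have tu : cdist (pi y') (pi (t i u)) < e.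
    rewrite y'E (tP i).1.2 uE h_equiv; apply: hd2; rewrite -yq -(tP i).1.2 cdistC.
    apply: le_lt_trans (cdist_proj_le _ _) _.
    by apply: lt_le_trans tvy _; rewrite ge_min lexx orbT.
  have [n hn] := int_dist_ex (y' - t i u); rewrite cdistE hn in tu.
  have tn := t_near i u.
  have nM : `|n%:~R : R| <= `|x'| + `|y'| + 4.
    move: tu tn x'u; rewrite !ltr_norml !ler_norml => /andP[? ?] /andP[? ?] /andP[? ?].
    have := ler_norm x'; have := ler_norm (- x'); have := ler_norm y'; have := ler_norm (- y').
    by rewrite !normrN => *; apply/andP; split; lra.
  exists (- n).
    have nM' : (`|n|%N <= M)%N.
      apply: ltnW; rewrite -(ltr_nat R) natr_absz intr_norm.
      by apply: le_lt_trans nM _; exact: truncnS_gt.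
    rewrite mem_cat; case: (intP n) nM' => [|k|k] nk.
    - by apply/orP; left; apply/mapP; exists 0%N; rewrite ?mem_iota.
    - by apply/orP; right; apply/mapP; exists k.+1; rewrite ?mem_iota.
    - by apply/orP; left; apply/mapP; exists k.+1; rewrite ?mem_iota ?opprK.
  exists u; first by rewrite distrC.
  have -> : t i u - (y' + (- n)%:~R) = - (y' - t i u - n%:~R) by rewrite intrN; ring.
  by rewrite normrN.
(* One [n] must serve all [e]: if each failed for some [e], the least of these finitely many would
   contradict [near]. *)
have [n _ hn] : exists2 n, n \in ns & forall e, 0 < e -> W (Q e n).
  apply: contrapT => none.
  have bad n : exists e, n \in ns -> 0 < e /\ ~ W (Q e n).
    have [nns|] := boolP (n \in ns); last by exists 0.
    apply: contrapT => h'; apply: none; exists n => // e e0.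
    by apply: contrapT => nW; apply: h'; exists e.
  have [f fP] := choice bad.
  have [e e0 he] := positive_lower_bound (fun n nns => (fP n nns).1).
  have e1 : 0 < Num.min e 1 by rewrite lt_min e0 ltr01.
  have e1' : Num.min e 1 <= 1 by rewrite ge_min lexx orbT.
  have [n nns Wn] := ultra_seq (near _ e1 e1').
  have [_] := fP n nns; apply; apply: filterS Wn => i [u u1 u2].
  have le : Num.min e 1 <= f n by apply: le_trans (he n nns); rewrite ge_min lexx.
  by exists u; [apply: lt_le_trans u1 le|apply: lt_le_trans u2 le].
exists x', (y' + n%:~R); split=> //; first by rewrite circle_proj_int.
by apply/fills_limit => e e0; exact: hn.
Qed.

End LimitOfSemiConjugacies.

(** * Excluding jumps of the limit *)

Section NoJump.
Variables (R : realType) (G : groupType).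
Local Notation X := (circle R).
Local Notation pi := (@circle_proj R).
Variables (psi : X -> X) (rhob rho0 rho : HomHomeo G X) (T : R -> R).
Hypothesis psiP : uniform_local_homeo psi.
Hypothesis lift : forall g x, rhob g (psi x) = psi (rho0 g x).
Hypothesis rhob_conical : conical rhob.
Hypothesis rhob_proper : triple_proper rhob.
Hypothesis T_mono : {homo T : x y / x <= y}.
Hypothesis T_deg : forall x, T (x + 1) = T x + 1.
Local Notation J := (circle_fills T).
Hypothesis J_equiv : forall g p q, J p q -> J (rho g p) (rho0 g q).
Implicit Types (x y e : R) (p q v : X) (g : G).

(** The filled values at [x] contain a ball, whose image under [psi] contains a ball around [psi q].
    Conicality there collapses the complement into [A], so the jump at [rho g (pi x)] covers,
    through [psi], everything outside [A]. *)
Lemma jump_expands x y1 y2 : y1 < y2 -> fills T x y1 -> fills T x y2 ->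
  forall e, 0 < e -> exists p (A : set X),
    (forall v v', A v -> A v' -> cdist v v' <= e) /\
    (forall v, ~ A v -> exists2 q, J p q & psi q = v).
Proof.
move=> y12 f1 f2 e e0; have [psic hopen _] := psiP.
set q := pi ((y1 + y2) / 2); pose n := (y2 - y1) / 2.
have n0 : 0 < n by rewrite /n; lra.
have inJ q' : cdist q q' < n -> J (pi x) q'.
  rewrite /q; have [y' <- yy'] := cdist_lift ((y1 + y2) / 2) q'; rewrite -yy' => close.
  exists x, y'; split=> //; apply: (fills_convex f1 f2).
  by move: close; rewrite ltr_norml /n => /andP[? ?]; apply/andP; split; lra.
have [d d0 hd] := hopen _ n0.
have [c _ hc] := rhob_conical; have [g [_ hg]] := hc _ _ d0 e0 (psi q).
exists (rho g (pi x)), [set rhob g w | w in [set w | d <= cdist w (psi q)]]; split.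
  by move=> _ _ [w /= dw <-] [w' /= dw' <-]; exact: hg.
move=> v nA; have : cdist (psi q) (rhob g^-1%g v) < d.
  rewrite ltNge cdistC; apply/negP => far; apply: nA.
  by exists (rhob g^-1%g v) => //; rewrite homVK.
move=> /hd[q' /inJ Jq' q'v]; exists (rho0 g q'); first exact: J_equiv.
by rewrite -lift q'v homVK.
Qed.

Lemma spread_jumps_finite : exists L : seq R, forall p q q', J p q -> J p q' ->
  1 / 3 <= cdist (psi q) (psi q') -> exists2 x, x \in L & pi x = p.
Proof.
have [psic _ _] := psiP; have third : 0 < 1 / 3 :> R by lra.
have [d d0 hd] := circle_uniform_continuity psic third.
have [L hL] := finitely_many_jumps T d0; exists L => p q q'.
have [x0 <-] := circle_proj_surj p; pose x := x0 - (Num.floor x0)%:~R.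
have xE : pi x = pi x0 by rewrite /x -intrN circle_proj_int.
have x01 : 0 <= x < 1.
  have /andP[lo hi] := floor_itv x0; rewrite intrD in hi.
  by apply/andP; rewrite /x; split; lra.
rewrite -xE => /(circle_fills_lift T_deg)[y <- fy] /(circle_fills_lift T_deg)[y' <- fy'] far.
have dy : d <= `|y - y'|.
  rewrite leNgt; apply/negP => close; move: far; rewrite leNgt => /negP; apply.
  by apply: hd; apply: le_lt_trans (cdist_proj_le _ _) _.
exists x => //; have [yy'|/ltW yy'] := leP y y'.
  by apply: (hL x y y') => //; move: dy; rewrite ler0_norm; lra.
by apply: (hL x y' y) => //; move: dy; rewrite ger0_norm; lra.
Qed.

(** Density is asked of the image under [psi], where conicality holds; unlike a size, it is
    preserved by the action. *)
Definition dense_jump p : Prop := forall v e, 0 < e ->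
  exists2 q, J p q & cdist (psi q) v <= e.

Lemma dense_jump_equivariant p g : dense_jump p -> dense_jump (rho g p).
Proof.
move=> dp v e e0.
have [d d0 hd] := (circle_continuousP _).1 (@hom_continuous _ _ rhob g) (rhob g^-1%g v) _ e0.
have d2 : 0 < d / 2 by lra.
have [q Jq hq] := dp (rhob g^-1%g v) _ d2; exists (rho0 g q); first exact: J_equiv.
rewrite -lift cdistC; have := hd (psi q); rewrite homVK => h.
by apply/ltW/h; rewrite cdistC; lra.
Qed.

Lemma dense_jump_spread p : dense_jump p -> exists q q',
  [/\ J p q, J p q' & 1 / 3 <= cdist (psi q) (psi q')].
Proof.
move=> dp; have e0 : 0 < 1 / 12 :> R by lra.
have [v' vv'] : exists v', cdist v' (pi 0) = 1 / 2.
  by apply: cdist_attains; rewrite lexx andbT; lra.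
have [q Jq hq] := dp (pi 0) _ e0; have [q' Jq' hq'] := dp v' _ e0.
exists q, q'; split=> //.
have := cdist_tri (psi q') v' (pi 0); have := cdist_tri (psi q) (psi q') (pi 0).
by rewrite (cdistC v' (psi q')) (cdistC (psi q') (psi q)); lra.
Qed.

Lemma small_complement_spread (A : set X) :
  (forall v v', A v -> A v' -> cdist v v' <= 1 / 8) ->
  exists v v', [/\ ~ A v, ~ A v' & 1 / 3 <= cdist v v'].
Proof.
move=> hA; pose v0 := pi 0; pose v1 := pi (1 / 3); pose v2 := pi (- (1 / 3)).
have d01 : 1 / 3 <= cdist v0 v1.
  have e : `|0 - 1 / 3 : R| = 1 / 3 by rewrite ler0_norm; lra.
  by rewrite /v0 /v1 cdist_proj e; lra.
have d02 : 1 / 3 <= cdist v0 v2.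
  have e : `|0 - - (1 / 3) : R| = 1 / 3 by rewrite ger0_norm; lra.
  by rewrite /v0 /v2 cdist_proj e; lra.
have d12 : 1 / 3 <= cdist v1 v2.
  have e : `|1 / 3 - (- (1 / 3) + 1) : R| = 1 / 3 by rewrite ler0_norm; lra.
  by rewrite /v1 /v2 -(circle_proj_int (- (1 / 3)) 1) cdist_proj e; lra.
have far v v' : A v -> 1 / 3 <= cdist v v' -> ~ A v'.
  by move=> Av vv' Av'; have := hA _ _ Av Av'; lra.
have [A0|A0] := pselect (A v0).
  by exists v1, v2; split=> //; [exact: far d01|exact: far d02].
have [A1|A1] := pselect (A v1); last by exists v0, v1.
by exists v0, v2; split=> //; exact: far d12.
Qed.

(** A jump over the finite list [L] that is not dense misses a ball, of radius at least some common
    [d]. [jump_expands] at a scale below [d] gives a jump that belongs to the list by its spread,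
    yet misses only a set too small to contain its ball. *)
Lemma dense_jump_ex x y1 y2 : y1 < y2 -> fills T x y1 -> fills T x y2 ->
  exists p, dense_jump p.
Proof.
move=> y12 f1 f2; apply: contrapT => none.
have [L hL] := spread_jumps_finite.
have bad x' : exists ve : X * R, 0 < ve.2 <= 1 / 2 /\
    forall q, J (pi x') q -> ve.2 < cdist (psi q) ve.1.
  apply: contrapT => h; apply: none; exists (pi x') => v e e0.
  apply: contrapT => h'; apply: h; exists (v, Num.min e (1 / 2)) => /=; split.
    by rewrite lt_min e0 ge_min lexx orbT !andbT; lra.
  move=> q Jq; rewrite ltNge; apply/negP => close; apply: h'; exists q => //.
  by apply: le_trans close _; rewrite ge_min lexx.
have [f fP] := choice bad.
have [d d0 hd] := positive_lower_bound (fun x' (_ : x' \in L) => (andP (fP x').1).1).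
have e0 : 0 < Num.min (1 / 8) (d / 2) by rewrite lt_min; apply/andP; split; lra.
have [p [A [hA hJ]]] := jump_expands y12 f1 f2 e0.
have [|v [v' [nAv nAv' vv']]] := @small_complement_spread A.
  by move=> v v' Av Av'; apply: le_trans (hA _ _ Av Av') _; rewrite ge_min lexx.
have [q Jq qv] := hJ _ nAv; have [q' Jq' q'v'] := hJ _ nAv'.
have [|x' x'L x'p] := hL p q q' Jq Jq'; first by rewrite qv q'v'.
have [/andP[fx0 fx2] hf] := fP x'; rewrite x'p in hf.
have inA w : cdist w (f x').1 <= (f x').2 -> A w.
  move=> close; apply: contrapT => /hJ[q'' /hf far q''w].
  by move: far; rewrite q''w ltNge close.
have [|w hw] := @cdist_attains R (f x').1 (f x').2; first by rewrite (ltW fx0).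
have := hA w (f x').1; rewrite hw => h.
have := h (inA _ _) (inA _ _); rewrite hw cdistxx lexx (ltW fx0) => /(_ isT isT).
by have := hd _ x'L; rewrite le_min => ? /andP[_ ?]; lra.
Qed.

(** Endpoints are the values approached by values filled over other points. This uses only the
    filled graph and the topology, hence is equivariant, whereas a reversal of orientation exchanges
    lower and upper ends. *)
Definition jump_endpoint q : Prop := exists p, [/\ dense_jump p, J p q &
  forall e, 0 < e -> exists p' q', [/\ p' <> p, J p' q' & cdist q q' < e]].

Lemma jump_endpoint_equivariant q g : jump_endpoint q -> jump_endpoint (rho0 g q).
Proof.
move=> [p [dp Jq hq]]; exists (rho g p); split.
- exact: dense_jump_equivariant.
- exact: J_equiv.
move=> e e0.
have [d d0 hd] := (circle_continuousP _).1 (@hom_continuous _ _ rho0 g) q _ e0.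
have [p' [q' [p'p Jq' qq']]] := hq _ d0.
exists (rho g p'), (rho0 g q'); split; [|exact: J_equiv|exact: hd].
by move=> /(can_inj (homK rho g)).
Qed.

(** A value strictly between the extreme filled values at [x] has a neighbourhood filled over [x]
    alone; so an endpoint is one of two extremes over finitely many points. *)
Lemma jump_endpoint_finite : exists E : seq X, forall q, jump_endpoint q -> q \in E.
Proof.
have [L hL] := spread_jumps_finite.
have ends x : exists ab : R * R, [/\ fills T x ab.1, fills T x ab.2 &
    forall y, fills T x y -> ab.1 <= y <= ab.2].
  have [a fa [la _]] := fills_lower T_mono x; have [b fb [lb _]] := fills_upper T_mono x.
  by exists (a, b); split=> // y fy; rewrite la // lb.
have [f fP] := choice ends.
exists ([seq pi (f x).1 | x <- L] ++ [seq pi (f x).2 | x <- L]).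
move=> q [p [dp Jq hq]].
have [q1 [q2 [Jq1 Jq2 far]]] := dense_jump_spread dp.
have [x xL xp] := hL p q1 q2 Jq1 Jq2 far; rewrite -xp in Jq hq.
have [y yq fy] := circle_fills_lift T_deg Jq.
have [fa fb /(_ y fy)/andP[ay yb]] := fP x.
rewrite mem_cat; apply/orP.
have [ya|ya] := eqVneq y (f x).1; first by left; apply/mapP; exists x; rewrite -?ya.
have [yb'|yb'] := eqVneq y (f x).2; first by right; apply/mapP; exists x; rewrite -?yb'.
exfalso; have {}ay : (f x).1 < y by rewrite lt_neqAle eq_sym ya.
have {}yb : y < (f x).2 by rewrite lt_neqAle yb'.
have e0 : 0 < Num.min (y - (f x).1) ((f x).2 - y) by rewrite lt_min !subr_gt0 ay.
have [p' [q' [p'x [x' [y' [x'p' y'q' fy']]] close]]] := hq _ e0.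
have [y'' y''q' yy''] := cdist_lift y q'.
rewrite -yq -yy'' lt_min in close; move/andP: close => [c1 c2].
have [n y''E] : exists n : int, y'' = y' + n%:~R.
  by apply: circle_proj_eq; rewrite y''q' y'q'.
have f'' := fills_int T_deg n fy'; rewrite -y''E in f''.
have [xx|xx|xx] := ltgtP (x' + n%:~R) x.
- have := fills_lt xx f'' fa; move: c1; rewrite ltr_norml => /andP[? ?]; lra.
- have := fills_lt xx fb f''; move: c2; rewrite ltr_norml => /andP[? ?]; lra.
- by apply: p'x; rewrite -x'p' -xx circle_proj_int.
Qed.

Lemma jump_endpoint_ex p : dense_jump p -> exists q, jump_endpoint q.
Proof.
have [x <-] := circle_proj_surj p; move=> dp.
have [a fa [_ ha]] := fills_lower T_mono x.
exists (pi a), (pi x); split=> //; first by exists x, a.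
move=> e e0; have [x1 /andP[x1l x1x] Tx1] := ha e e0.
exists (pi x1), (pi (T x1)); split.
- move=> /circle_proj_inj_near h; have : x1 = x; last by lra.
  by apply: h; rewrite ltr_norml; apply/andP; split; lra.
- by exists x1, (T x1); split=> //; exact: fills_self.
- apply: le_lt_trans (cdist_proj_le _ _) _.
  have := fills_lt x1x (fills_self T_mono x1) fa => Ta.
  by rewrite ger0_norm; lra.
Qed.

Lemma fills_unique x y y' : fills T x y -> fills T x y' -> y = y'.
Proof.
suff no_jump y1 y2 : y1 < y2 -> fills T x y1 -> fills T x y2 -> False.
  by move=> f1 f2; have [yy|yy|//] := ltgtP y y';
     [case: (no_jump _ _ yy f1 f2)|case: (no_jump _ _ yy f2 f1)].
move=> y12 f1 f2; have [p dp] := dense_jump_ex y12 f1 f2.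
have [q Eq] := jump_endpoint_ex dp; have [E hE] := jump_endpoint_finite.
apply: (@no_finite_orbit R G rhob rhob_conical rhob_proper
  [seq psi q' | q' <- E & `[< jump_endpoint q' >]] (psi q)).
  by apply/mapP; exists q => //; rewrite mem_filter hE // andbT; apply/asboolP.
move=> g _ /mapP[q' + ->]; rewrite mem_filter => /andP[/asboolP Eq' _].
have Eg := jump_endpoint_equivariant g Eq'.
by rewrite lift map_f // mem_filter hE // andbT; apply/asboolP.
Qed.

Lemma limit_semi_conjugate : semi_conjugate rho rho0.
Proof.
have Tc : continuous T.
  move=> x; apply/cvgrPdist_lt => e e0.
  have [a fa [_ ha]] := fills_lower T_mono x; have [b fb [_ hb]] := fills_upper T_mono x.
  have fx := fills_self T_mono x.
  have aT := fills_unique fa fx; have bT := fills_unique fb fx.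
  have [x1 /andP[_ x1x] Tx1] := ha e e0; have [x2 xx2 Tx2] := hb e e0.
  apply/nbhs_ballP; exists (Num.min (x - x1) (x2 - x)).
    by rewrite /= lt_min !subr_gt0 x1x.
  move=> x'; rewrite /ball /= lt_min !ltr_norml => /andP[/andP[? ?] /andP[? ?]].
  have h1 : T x1 <= T x' by apply: T_mono; lra.
  have h2 : T x' <= T x2 by apply: T_mono; lra.
  by apply/andP; split; lra.
pose h (p : X) := pi (T (repr p)).
have hT x : pi (T x) = h (pi x) by rewrite /h degree_one_factor.
have Tlift : is_lift_of T h by [].
exists h; split.
- exact: circle_lift_continuous Tc hT.
- apply: (degree_one_surjective Tlift); exists (`|T 0| + 1).
  exact: degree_one_bounded T_mono T_deg.
- by exists T.
- move=> g p; have Jp : J p (h p).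
    have [x <-] := circle_proj_surj p; exists x, (T x); split=> //.
    exact: fills_self.
  have [x [y [<- <- fy]]] := J_equiv g Jp.
  by rewrite -hT (fills_unique fy (fills_self T_mono x)).
Qed.

End NoJump.

Section Closed.
Variables (R : realType) (G : groupType).
Local Notation X := (circle R).
Local Notation pi := (@circle_proj R).
Variables (psi : X -> X) (rhob rho0 : HomHomeo G X).
Hypothesis psiP : uniform_local_homeo psi.
Hypothesis lift : forall g x, rhob g (psi x) = psi (rho0 g x).
Hypothesis rhob_conical : conical rhob.
Hypothesis rhob_proper : triple_proper rhob.

(** An integer translation puts [t 0] in [[0, 1)]. The bound 2 is then uniform in [h], so that
    limits along an ultrafilter exist. *)
Lemma normalized_lift (h : X -> X) : monotone_degree_one h -> exists t : R -> R,
  [/\ is_lift_of t h, {homo t : x y / x <= y}, forall x, t (x + 1) = t x + 1 &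
    forall x, `|t x - x| <= 2].
Proof.
move=> [t [[tc th] tm t1]]; pose n := Num.floor (t 0).
have um : {homo (fun x => t x - n%:~R) : x y / x <= y} by move=> x y /tm; rewrite lerD2r.
have u1 x : t (x + 1) - n%:~R = t x - n%:~R + 1 by rewrite t1 addrAC.
exists (fun x => t x - n%:~R); split=> //.
  split; last by move=> x; rewrite -intrN circle_proj_int.
  by move=> x; apply: cvgB; [exact: tc|exact: cvg_cst].
move=> x; apply: le_trans (degree_one_bounded um u1 x) _.
have /andP[lo hi] := floor_itv (t 0); rewrite intrD in hi.
by rewrite ger0_norm /n; lra.
Qed.

Lemma semi_conjugate_closed (rho : HomHomeo G X) :
  (forall l e, 0 < e -> exists2 rho', semi_conjugate rho' rho0 & hom_close l e rho rho') ->
  semi_conjugate rho rho0.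
Proof.
(* An index is a basic neighbourhood of [rho]: finitely many elements and a precision. [W] will be
   an ultrafilter refining the tails of this directed set. *)
move=> near; pose I := (seq G * nat)%type.
have pick (i : I) : exists rht : HomHomeo G X * (X -> X) * (R -> R),
    [/\ hom_close i.1 (i.2.+1%:R^-1) rho rht.1.1,
     is_lift_of rht.2 rht.1.2 /\ {homo rht.2 : x y / x <= y},
     forall x, rht.2 (x + 1) = rht.2 x + 1,
     forall x, `|rht.2 x - x| <= 2 &
     forall g p, rht.1.2 (rht.1.1 g p) = rho0 g (rht.1.2 p)].
  have i0 : 0 < (i.2.+1%:R^-1 : R) by rewrite invr_gt0 ltr0n.
  have [rho' [h [_ _ hm heq]] close] := near i.1 _ i0.
  have [t [tl tm t1 t2]] := normalized_lift hm.
  by exists (rho', h, t).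
have [F FP] := choice pick.
pose base (i : I) : set I := 
  [set j : I | {subset (i.1 : seq G) <= (j.1 : seq G)} /\ (i.2 <= j.2)%N].
have Ffilter : ProperFilter (filter_from setT base).
  apply: filter_from_proper; last by move=> i _; exists i; split.
  apply: filter_from_filter; first by exists ([::], 0%N).
  move=> [l n] [l' n'] _ _; exists (l ++ l', maxn n n') => // -[k m] /= [sub].
  rewrite geq_max => /andP[nm n'm]; split; split=> //= g gl; apply: sub.
    by rewrite mem_cat gl.
  by rewrite mem_cat gl orbT.
have [W [UW FW]] := ultraFilterLemma Ffilter.
have lim x : exists l : R, forall e, 0 < e -> W [set i | `|(F i).2 x - l| < e].
  apply: (@ultra_limit R I W (fun i => (F i).2 x) (`|x| + 2)) => i.
  have [_ _ _ /(_ x) h _] := FP i.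
  by have := ler_normD ((F i).2 x - x) x; rewrite subrK; lra.
have [T TP] := choice lim.
have T1 x : T (x + 1) = T x + 1.
  apply/eqP; rewrite -subr_eq0 -normr_le0 leNgt; apply/negP => d0.
  have e0 : 0 < `|T (x + 1) - (T x + 1)| / 2 by lra.
  have [i [/= h1 h2]] := @filter_ex _ W _ _ (filterI (TP (x + 1) _ e0) (TP x _ e0)).
  have [_ _ t1 _ _] := FP i; rewrite t1 in h1.
  have := ler_normB ((F i).2 x - T x) ((F i).2 x + 1 - T (x + 1)).
  rewrite (_ : _ - _ - _ = T (x + 1) - (T x + 1)); last by ring.
  by lra.
have tP i : is_lift_of (F i).2 (F i).1.2 /\ {homo (F i).2 : x y / x <= y} by case: (FP i).
have tnear i x : `|(F i).2 x - x| <= 2 by case: (FP i).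
have heq i g p : (F i).1.2 ((F i).1.1 g p) = rho0 g ((F i).1.2 p) by case: (FP i).
have conv g e : 0 < e -> W [set i | forall p, cdist (rho g p) ((F i).1.1 g p) < e].
  move=> e0; pose n := Num.trunc e^-1.
  apply: FW; exists ([:: g], n) => // i /= [sub ni] p.
  have [close _ _ _ _] := FP i.
  apply: lt_trans (close g p (sub g (mem_head _ _))) _.
  rewrite invf_plt ?posrE ?ltr0n //; apply: lt_le_trans (truncnS_gt _) _.
  by rewrite ler_nat.
have Tm := limit_mono UW tP TP.
apply: (limit_semi_conjugate psiP lift rhob_conical rhob_proper Tm T1).
by move=> g p q; exact: (circle_fills_equivariant UW tP tnear heq conv TP).
Qed.

End Closed.

(** * Conclusion: the connected component *)

Section ConnectedComponent.
Variables (R : realType) (G : groupType) (S : genset G).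
Local Notation X := (circle R).
Variables (psi : X -> X) (rhob rho0 : HomHomeo G X).
Hypothesis psiP : uniform_local_homeo psi.
Hypothesis lift : forall g x, rhob g (psi x) = psi (rho0 g x).
Hypothesis rhob_conical : conical rhob.
Hypothesis rhob_proper : triple_proper rhob.

Lemma semi_conjugate_refl : semi_conjugate rho0 rho0.
Proof.
exists id; split=> //; first by move=> x; exact: cvg_id.
  by apply/seteqP; split=> // x _; exists x.
by exists id; split=> //; split=> // x; exact: cvg_id.
Qed.

Lemma connected_component_lift :
  connected_component [set: HomHomeo G X] rho0 = [set rho | semi_conjugate rho rho0].
Proof.
apply/seteqP; split=> rho; last exact: semi_conjugate_connected_component.
move=> [A [Arho0 _ conA] Arho].
pose SC : set (HomHomeo G X) := [set rho | semi_conjugate rho rho0].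
suff : A `&` SC = A by move=> E; rewrite -E in Arho; case: Arho.
apply: conA.
- by exists rho0; split=> //; exact: semi_conjugate_refl.
- exists SC => //; rewrite openE => rho' SCrho'; apply/hom_nbhsP.
  apply: (semi_conjugate_open S (lift_expanding psiP lift rhob_conical)) SCrho'.
  exact: lift_proper_expansion psiP lift rhob_proper.
- exists SC => // rho' clrho'.
  apply: (semi_conjugate_closed psiP lift rhob_conical rhob_proper) => l e e0.
  have : nbhs rho' [set rho1 | hom_close l e rho' rho1] by apply/hom_nbhsP; exists l, e.
  by move=> /clrho'[rho1 [SCrho1 close]]; exists rho1.
Qed.

End ConnectedComponent.

Theorem theorem1p3 (R : realType) (G : groupType) (S : genset G)
  (hypG : hyperbolic S) (phi : homeo (boundary S) (circle R))
  (rho0 : HomHomeo G (circle R))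
  (hrho0 : rho0 = boundary_action phi \/
    exists2 k : nat, (1 <= k)%N &
      is_lift_to_cover k (boundary_action phi) rho0) :
  connected_component [set: HomHomeo G (circle R)] rho0 =
    [set rho | semi_conjugate rho rho0].
Proof.
have con := boundary_action_conical hypG phi.
have prop := boundary_action_triple_proper hypG phi.
case: hrho0 => [->|[k _ [psi [cov _] lift]]].
  exact: (connected_component_lift S (id_uniform_local_homeo R) _ con prop).
exact: (connected_component_lift S (covering_map_uniform_local_homeo cov) lift con prop).
Qed.
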